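(* Let $x,y,z\in\mathbb{C}^*$ with $|q|<|x|<1$, $|q|<|y|<1$ and $|q|<|z|<1$. Then $$\begin{aligned} \sum_{\substack{\mathrm{sg}(r)=\mathrm{sg}(s)=\mathrm{sg}(t)\\ r\equiv s\equiv t\ (\mathrm{mod}\ 2)}}q^{rs+rt+st}x^ry^sz^t &=\frac{J_4^3j(y^2z^2;q^4)}{j(y^2;q^4)j(z^2;q^4)}\,m\Big(-\frac{qx}{yz},q^2,-yz\Big)+\frac{J_4^3j(x^2z^2;q^4)}{j(x^2;q^4)j(z^2;q^4)}\,m\Big(-\frac{qy}{xz},q^2,-xz\Big)\\ &\quad+\frac{J_4^3j(x^2y^2;q^4)}{j(x^2;q^4)j(y^2;q^4)}\,m\Big(-\frac{qz}{xy},q^2,-xy\Big)\\ &\quad+\frac{J_1^3J_2^3}{j(x;q)j(y;q)j(z;q)}\cdot\frac{j(xy;q^2)j(xz;q^2)j(yz;q^2)}{j(-x;q^2)j(-y;q^2)j(-z;q^2)}. \end{aligned}$$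
   Context: $q$ is a fixed complex number with $0<|q|<1$, $\mathbb{C}^*=\mathbb{C}\setminus\{0\}$. $(x;q)_\infty=\prod_{i\ge0}(1-q^ix)$, $j(x;q)=(x;q)_\infty(q/x;q)_\infty(q;q)_\infty=\sum_{n\in\mathbb{Z}}(-1)^nq^{\binom n2}x^n$, and $J_m=\prod_{i\ge1}(1-q^{mi})$ for positive integers $m$. The Appell–Lerch function is $$m(x,q,z)=\frac1{j(z;q)}\sum_{r=-\infty}^{\infty}\frac{(-1)^rq^{\binom r2}z^r}{1-q^{r-1}xz}.$$ For an integer $r$, $\mathrm{sg}(r)=1$ if $r\ge0$ and $\mathrm{sg}(r)=-1$ if $r<0$. The sum on the left runs over integers $r,s,t$. *)

(* Defs.v *)
From HB Require Import structures.
From mathcomp Require Import all_boot all_order all_algebra.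
From mathcomp Require Import finmap complex.
From mathcomp Require Import all_classical all_reals topology normedtype.
From mathcomp.analysis.showcase Require Import summability.

Set Implicit Arguments.
Unset Strict Implicit.
Unset Printing Implicit Defensive.

Import Order.TTheory GRing.Theory Num.Theory.
Import numFieldNormedType.Exports.

Local Open Scope classical_set_scope.
Local Open Scope ring_scope.
Local Open Scope complex_scope.

(* The complex numbers are R[i] for a real type R. The topology and the norm of
   R[i] are carried by the alias R[i]^o, which is convertible to R[i]. *)

Definition qpoch (R : realType) (x q : R[i]) : R[i] :=
  lim ((fun n : nat => \prod_(0 <= k < n) (1 - q ^+ k * x) : R[i]^o) @ \oo).

(* j(x; q), by its product expression rather than as a theta series. *)
Definition jtheta (R : realType) (x q : R[i]) : R[i] :=
  qpoch x q * qpoch (q / x) q * qpoch q q.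

(* J_m, whose dependence on q is implicit in the usual notation. *)
Definition Jeta (R : realType) (q : R[i]) (m : nat) : R[i] :=
  lim ((fun n : nat => \prod_(1 <= k < n.+1) (1 - q ^+ (m * k)) : R[i]^o)
       @ \oo).

(* binom(r, 2) for a possibly negative integer r; the division is exact. *)
Definition binz2 (r : int) : int := ((r * (r - 1)) %/ 2)%Z.

(* m(x, q, z). The bilateral series is summed along the net of finite subsets
   of the integers; it converges absolutely whenever 0 < |q| < 1, z <> 0 and no
   denominator vanishes. *)
Definition appell (R : realType) (x q z : R[i]) : R[i] :=
  (jtheta z q)^-1 *
  sum (fun r : int =>
         (-1) ^ r * q ^ binz2 r * z ^ r / (1 - q ^ (r - 1) * x * z) : R[i]^o).

(* Unlike sgz, this sign takes the value 1 at 0. *)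
Definition sg (r : int) : int := if 0 <= r then 1 else -1.

Definition triple_index (r s t : int) : bool :=
  [&& sg r == sg s, sg s == sg t,
      (r == s %[mod 2])%Z & (s == t %[mod 2])%Z].

(* The summand of the triple series, extended by 0 to all of Z^3. *)
Definition triple_term (R : realType) (q x y z : R[i])
    (p : int * int * int) : R[i]^o :=
  let: (r, s, t) := p in
  if triple_index r s t
  then q ^ (r * s + r * t + s * t) * x ^ r * y ^ s * z ^ t
  else 0.

(* Main.v *)
Require Import Defs.
From HB Require Import structures.
From mathcomp Require Import all_boot all_order all_algebra.
From mathcomp Require Import finmap complex.
From mathcomp Require Import all_classical all_reals topology normedtype.
From mathcomp.analysis.showcase Require Import summability.
From mathcomp Require Import ring zify.


(* Fix [x] and [z], put [p = q^2], and let [D y] be the difference of the two sides.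
   Summing over the exponent of [y] continues the triple series to all [y], with simple poles at
   [y = p^n] and [y = - p^n] only.  Shifting the exponents by (1, -1, 1), and using Kronecker's
   identity for the boundary terms, gives an inhomogeneous functional equation under [y -> p y];
   the right-hand side satisfies the same one, so [D (p y) = q y / (x z) * D y].  Hence
   [E y = j(y; p) j(- y; p) j(q y; p) D y] satisfies [E (p y) = E y / (x z y^2)], and it has an
   everywhere convergent Laurent expansion.  Such functions form a two-dimensional space spanned by
   an even and an odd theta function, neither of which vanishes at [1] when
   [|q|^2 < |x z| < 1].  The residues of [D] at [1] and [-1] vanish, i.e. [E 1 = E (-1) = 0],
   therefore [E = 0].  Kronecker's identity and the relation between Appell-Lerch sums giving the
   residues are obtained by the same uniqueness argument, in degree one. *)

Set Implicit Arguments.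
Unset Strict Implicit.
Unset Printing Implicit Defensive.

Import Order.TTheory GRing.Theory Num.Theory.
Import numFieldNormedType.Exports.

Local Open Scope classical_set_scope.
Local Open Scope ring_scope.
Local Open Scope complex_scope.

(** * Sums along the net of finite subsets *)

Section HasSum.
Variable C : numFieldType.

(** No complex analysis is used: a function on the punctured plane is represented by a bilateral
    coefficient sequence converging absolutely at every radius. That its values on one circle
    determine these coefficients replaces Liouville's theorem and the identity theorem, so a
    functional equation need be checked only on one circle, where no denominator vanishes. The
    obstacle is to obtain such an expansion for a series whose terms have poles. It is overcome term
    by term: [theta y / (1 - p ^ n * y)] has explicit Laurent coefficients, with bounds in [n] good
    enough for summation over [n]. At a removed pole a single term survives, which is how residues
    are computed. The parity condition turns the sum over the exponent of [y] into half the sum of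
    [1 / (1 - w)] and [(-1) ^ r / (1 + w)], whence the factors [j(y; p) j(- y; p)]; the factor
    [j(q y; p)] clears the one Appell-Lerch sum with [y] in its denominators. Under [y -> p y] each
    of the three factors contributes [y ^- 1] up to a constant, which together with [q y / (x z)]
    leaves degree two. *)

Definition has_sum (I : choiceType) (f : I -> C) (S : C) :=
  forall e : C, 0 < e -> exists A0 : {fset I}, forall A : {fset I},
    (A0 `<=` A)%fset -> `|S - \sum_(i <- A) f i| < e.

(** Absolute summability phrased by bounded finite sums, so that it makes sense before any limit is
    known to exist. *)
Definition abs_bounded (I : choiceType) (f : I -> C) :=
  exists M : C, forall A : {fset I}, \sum_(i <- A) `|f i| <= M.

Lemma has_sum_unique (I : choiceType) (f : I -> C) S T :
  has_sum f S -> has_sum f T -> S = T.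
Proof.
move=> fS fT; apply/eqP; rewrite -subr_eq0 -normr_eq0.
apply/negPn/negP => ne0.
have e0 : 0 < `|S - T| / 2 by rewrite divr_gt0 // lt_neqAle eq_sym ne0 normr_ge0.
have [A hA] := fS _ e0; have [B hB] := fT _ e0.
have h1 := hA (A `|` B)%fset (fsubsetUl _ _).
have h2 := hB (A `|` B)%fset (fsubsetUr _ _).
have : `|S - T| < `|S - T| / 2 + `|S - T| / 2.
  apply: le_lt_trans (ltrD h1 h2).
  rewrite [X in _ <= _ + X]distrC; apply: le_trans (ler_normD _ _).
  by rewrite addrA subrK.
by rewrite -splitr ltxx.
Qed.

Lemma eq_has_sum (I : choiceType) (f g : I -> C) S :
  f =1 g -> has_sum f S -> has_sum g S.
Proof. by move=> /funext ->. Qed.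

Lemma has_sumD (I : choiceType) (f g : I -> C) S T :
  has_sum f S -> has_sum g T -> has_sum (fun i => f i + g i) (S + T).
Proof.
move=> fS gT e e0; have e2 : 0 < e / 2 by rewrite divr_gt0.
have [A hA] := fS _ e2; have [B hB] := gT _ e2.
exists (A `|` B)%fset => D; rewrite fsubUset => /andP[AD BD].
rewrite big_split /= opprD addrACA (splitr e).
exact: le_lt_trans (ler_normD _ _) (ltrD (hA _ AD) (hB _ BD)).
Qed.

Lemma has_sumZ (I : choiceType) (f : I -> C) S a :
  has_sum f S -> has_sum (fun i => a * f i) (a * S).
Proof.
move=> fS e e0; have a0 : 0 < `|a| + 1 by rewrite ltr_wpDl.
have [A hA] := fS (e / (`|a| + 1)) (divr_gt0 e0 a0).
exists A => D AD; rewrite -mulr_sumr -mulrBr normrM.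
have := hA D AD; rewrite ltr_pdivlMr // => h.
apply: le_lt_trans h; rewrite mulrC ler_wpM2l //.
by rewrite lerDl.
Qed.

Lemma has_sumB (I : choiceType) (f g : I -> C) S T :
  has_sum f S -> has_sum g T -> has_sum (fun i => f i - g i) (S - T).
Proof.
move=> fS /(has_sumZ (-1)) gT; rewrite -mulN1r.
by apply: eq_has_sum (has_sumD fS gT) => i; rewrite mulN1r.
Qed.

Lemma has_sum0 (I : choiceType) : has_sum (fun _ : I => 0) 0.
Proof.
by move=> e e0; exists fset0 => A _; rewrite big1 // subr0 normr0.
Qed.

End HasSum.

(** * Absolutely summable families of complex numbers *)

Section ComplexSums.
Variable R : realType.
Local Notation C := R[i].

Lemma has_sum_real_ge0 (I : choiceType) (g : I -> R) (M : R) :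
  (forall i, 0 <= g i) -> (forall A : {fset I}, \sum_(i <- A) g i <= M) ->
  exists S, has_sum (fun i => (g i)%:C) S.
Proof.
move=> g0 gM.
pose E : set R := [set u | exists A : {fset I}, u = \sum_(i <- A) g i].
have supE : has_sup E.
  split; first by exists (\sum_(i <- fset0) g i); exists fset0.
  by exists M => u [A ->].
exists (sup E)%:C => e e0.
have [e1 ee1] : exists e1, e = e1%:C.
  by move: (ltW e0); case: (e) => a b; rewrite lecE => /= /andP[/eqP -> _]; exists a.
rewrite {}ee1 ltcR in e0 *.
have [_ [A ->] hA] := sup_adherent e0 supE.
exists A => B AB; rewrite -rmorph_sum -rmorphB normc_def /= expr0n addr0 sqrtr_sqr.
rewrite ltcR ger0_norm; last first.
  by rewrite subr_ge0; apply: (sup_upper_bound supE); exists B.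
rewrite ltrBlDl -ltrBlDr; apply: lt_le_trans hA _.
rewrite (big_fsetID _ (mem A) B) /=.
rewrite (_ : [fset x in B | x \in A]%fset = A) ?lerDl ?sumr_ge0 //.
by apply/fsetP => x; rewrite !inE /= andbC; have /fsubsetP := AB => /(_ x); case: (x \in A) => //= ->.
Qed.

(** Real and imaginary parts are dominated by [|f|], and a dominated real family [g] is the
    difference of the nonnegative families [|g| + g] and [|g|], each summed as a supremum. *)
Lemma abs_bounded_has_sum (I : choiceType) (f : I -> C) :
  abs_bounded f -> exists S, has_sum f S.
Proof.
move=> [M fM].
have real_part (g : I -> R) : (forall i, `|g i|%:C <= `|f i|) ->
    exists S, has_sum (fun i => (g i)%:C) S.
  move=> gf.
  have gM (A : {fset I}) : \sum_(i <- A) `|g i| <= complex.Re M.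
    have : (\sum_(i <- A) `|g i|)%:C <= M.
      by apply: le_trans (fM A); rewrite rmorph_sum /=; apply: ler_sum => i _.
    by rewrite lecE => /andP[].
  have [|A|S1 h1] := @has_sum_real_ge0 I (fun i => `|g i| + g i) (complex.Re M + complex.Re M).
  - by move=> i; rewrite -lerBlDr sub0r; have := ler_norm (- g i); rewrite normrN.
  - rewrite big_split /=; apply: lerD => //; apply: le_trans (gM A).
    by apply: ler_sum => i _; apply: ler_norm.
  have [//|//|S2 h2] := @has_sum_real_ge0 I (fun i => `|g i|) (complex.Re M).
  exists (S1 - S2); apply: eq_has_sum (has_sumB h1 h2) => i.
  by rewrite -rmorphB /= addrC addKr.
have [S1 h1] := real_part (fun i => complex.Re (f i)) (fun i => normc_ge_Re _).
have [|S2 h2] := real_part (fun i => complex.Im (f i)).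
  move=> i; have := normc_ge_Re (- (f i * 'i)); rewrite normrN normrM.
  have -> : `|'i| = 1 :> C by rewrite normc_def /= expr0n expr1n add0r sqrtr1.
  by rewrite mulr1; case: (f i) => a b /=; rewrite mulr0 mulr1 sub0r opprK.
exists (S1 + 'i * S2); apply: eq_has_sum (has_sumD h1 (has_sumZ 'i h2)) => i.
by rewrite -complexE.
Qed.

Lemma has_sum_partial (I : choiceType) (f : I -> C) S :
  has_sum f S -> partial_sum (f : I -> R[i]^o) @ totally --> (S : R[i]^o).
Proof.
move=> fS; have FF := @filter_filter _ _ (@totally_filter I).
apply/cvgrPdist_lt => e e0; have [A hA] := fS _ e0.
exists A => // B /= AB; rewrite /partial_sum -(big_seq_fsetE _ B xpredT f); exact: hA.
Qed.

Lemma has_sum_sumE (I : choiceType) (f : I -> C) S :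
  has_sum f S -> sum (f : I -> R[i]^o) = S.
Proof.
move=> /has_sum_partial h; have FF := @totally_filter I.
by apply: cvg_lim h; apply: norm_hausdorff.
Qed.

End ComplexSums.

(* Working over an abstract such field, rather than over [R[i]], keeps conversion from
   unfolding the complex operations. *)
Record sum_field := SumField {
  sum_field_sort :> numClosedFieldType;
  abs_bounded_sum : forall (I : choiceType) (f : I -> sum_field_sort),
    abs_bounded f -> exists S, has_sum f S }.

Definition complex_sum_field (R : realType) : sum_field := SumField (@abs_bounded_has_sum R).

(** A family without a sum gets the value [0]; locking keeps unification from unfolding the
    choice. *)
HB.lock Definition csum (C : numFieldType) (I : choiceType) (f : I -> C) : C :=
  xget 0 [set S | has_sum f S].

(** * Reindexing, Fubini and products for unconditional sums *)

Section UnconditionalSums.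
Variable C : sum_field.

Lemma csumE (I : choiceType) (f : I -> C) S : has_sum f S -> csum f = S.
Proof.
move=> fS; apply: (@has_sum_unique _ I f) => //.
by rewrite csum.unlock; case: xgetP => [y _ //|/(_ S)].
Qed.

Lemma csumP (I : choiceType) (f : I -> C) : abs_bounded f -> has_sum f (csum f).
Proof. by move=> /abs_bounded_sum[S hS]; rewrite (csumE hS). Qed.

Lemma has_sum_norm_le (I : choiceType) (f : I -> C) S M :
  has_sum f S -> (forall A : {fset I}, \sum_(i <- A) `|f i| <= M) -> `|S| <= M.
Proof.
move=> fS fM; apply/ler_addgt0Pr => e e0; have [A /(_ A (fsubset_refl A)) hA] := fS _ e0.
rewrite -[S](subrK (\sum_(i <- A) f i)) addrC.
apply: le_trans (ler_normD _ _) _; apply: lerD; last exact: ltW.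
exact: le_trans (ler_norm_sum _ _ _) (fM A).
Qed.

Lemma eq_csum (I : choiceType) (f g : I -> C) : f =1 g -> csum f = csum g.
Proof. by move=> /funext ->. Qed.

Lemma abs_bounded_le (I : choiceType) (f g : I -> C) :
  (forall i, `|f i| <= `|g i|) -> abs_bounded g -> abs_bounded f.
Proof.
move=> fg [M gM]; exists M => A; apply: le_trans (gM A).
by apply: ler_sum => i _.
Qed.

Lemma abs_boundedZ (I : choiceType) (f : I -> C) a :
  abs_bounded f -> abs_bounded (fun i => a * f i).
Proof.
move=> [M fM]; exists (`|a| * M) => A.
rewrite (eq_bigr (fun i => `|a| * `|f i|)); last by move=> i _; rewrite normrM.
by rewrite -mulr_sumr ler_wpM2l.
Qed.

Lemma abs_boundedD (I : choiceType) (f g : I -> C) :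
  abs_bounded f -> abs_bounded g -> abs_bounded (fun i => f i + g i).
Proof.
move=> [M fM] [N gN]; exists (M + N) => A; apply: le_trans (lerD (fM A) (gN A)).
by rewrite -big_split /=; apply: ler_sum => i _; apply: ler_normD.
Qed.

Lemma abs_bounded_norm (I : choiceType) (f : I -> C) :
  abs_bounded f -> abs_bounded (fun i => `|f i|).
Proof. by apply: abs_bounded_le => i; rewrite normr_id. Qed.

Lemma abs_bounded_inj (I J : choiceType) (phi : J -> I) (f : I -> C) :
  injective phi -> abs_bounded f -> abs_bounded (f \o phi).
Proof.
move=> inj [M fM]; exists M => A.
by have := fM (phi @` A)%fset; rewrite big_imfset //= => x y _ _ /inj.
Qed.

Lemma has_sum_reindex (I J : choiceType) (phi : J -> I) (psi : I -> J) (f : I -> C) S :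
  cancel phi psi -> cancel psi phi -> has_sum f S -> has_sum (f \o phi) S.
Proof.
move=> phiK psiK fS e e0; have [A hA] := fS _ e0.
exists (psi @` A)%fset => B AB.
have := hA (phi @` B)%fset; rewrite big_imfset /=; last by move=> x y _ _ /(can_inj phiK).
apply; apply/fsubsetP => x xA; apply/imfsetP; exists (psi x); last by rewrite psiK.
by move/fsubsetP: AB; apply; apply/imfsetP; exists x.
Qed.

(** No summability is assumed: both families have the same set of possible sums, so even the default
    value of [csum] is transported. *)
Lemma csum_reindex (I J : choiceType) (phi : J -> I) (psi : I -> J) (f : I -> C) :
  cancel phi psi -> cancel psi phi -> csum (f \o phi) = csum f.
Proof.
move=> phiK psiK; rewrite !csum.unlock; congr xget; apply/seteqP; split => S /= h.
  have -> : f = (f \o phi) \o psi by apply/funext => x /=; rewrite psiK.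
  exact: has_sum_reindex h.
exact: has_sum_reindex h.
Qed.

(** This discards indices where [f] vanishes: the membership condition means [phi (psi i) = i], so
    [f] is [0] off the image of the injection [phi]. *)
Lemma has_sum_inj (I J : choiceType) (phi : J -> I) (psi : I -> J) (f : I -> C) S :
  cancel phi psi -> (forall i, psi i \in [pred j | phi j == i] \/ f i = 0) ->
  has_sum (f \o phi) S -> has_sum f S.
Proof.
move=> phiK fim fS e e0; have [A hA] := fS _ e0.
exists (phi @` A)%fset => B AB.
pose D := (psi @` [fset i in B | phi (psi i) == i])%fset.
have AD : (A `<=` D)%fset.
  apply/fsubsetP => a aA; apply/imfsetP; exists (phi a); rewrite ?phiK //.
  rewrite !inE /= phiK eqxx andbT; move/fsubsetP: AB; apply.
  by apply/imfsetP; exists a.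
have := hA _ AD; rewrite big_imfset /=; last first.
  move=> x y; rewrite !inE /= => /andP[_ /eqP ex] /andP[_ /eqP ey] exy.
  by rewrite -ex -ey exy.
rewrite -(@big_fset_incl _ _ _ _ [fset i in B | phi (psi i) == i]%fset B f).
- congr (`|_ - _| < e); apply: eq_fbigr => x.
  by rewrite !inE /= => /andP[_ /eqP ->].
- by apply/fsubsetP => x; rewrite !inE /= => /andP[].
move=> x xB; rewrite !inE /= xB /= => ne.
by case: (fim x) => // h; move: ne; rewrite [_ == _]h.
Qed.

Lemma big_fsetM (I J : choiceType) (A : {fset I}) (B : {fset J}) (F : I * J -> C) :
  \sum_(k <- (A `*` B)%fset) F k = \sum_(i <- A) \sum_(j <- B) F (i, j).
Proof.
apply/esym; apply: etrans (pair_big_dep_cond _ A (fun=> B) xpredT (fun=> xpredT) (fun i j => F (i, j))) _.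
apply: eq_fbig => [[i j]|[i j] //]; rewrite [RHS]in_fsetM /=. apply/imfset2P/andP => /=.
  by move=> [a]; rewrite !inE /= andbT => aA [b]; rewrite !inE /= andbT => bB [-> ->].
by move=> [iA jB]; exists i; rewrite ?inE ?iA //; exists j; rewrite ?inE ?jB.
Qed.

Lemma has_sum_fubini (I J : choiceType) (f : I * J -> C) (g : I -> C) S :
  has_sum f S -> (forall i, has_sum (fun j => f (i, j)) (g i)) -> has_sum g S.
Proof.
move=> fS fg e e0; have e2 : 0 < e / 2 by rewrite divr_gt0.
have [A0 hA] := fS _ e2.
exists (fst @` A0)%fset => B AB.
(* The summand [1] keeps [k] positive when [B] is empty; with error [e / 2 / k] per row, all rows
   together cost at most [e / 2]. *)
pose k : C := (#|` B|%:R + 1).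
have k0 : 0 < k by rewrite ltr_wpDl // ler0n.
have ek : 0 < e / 2 / k by rewrite divr_gt0.
have /choice[J_ hJ] : forall i, exists Ji : {fset J}, forall D : {fset J}, (Ji `<=` D)%fset ->
    `|g i - \sum_(j <- D) f (i, j)| < e / 2 / k.
  by move=> i; exact: fg.
pose D := ((snd @` A0) `|` \bigcup_(i <- B) J_ i)%fset.
have A0BD : (A0 `<=` B `*` D)%fset.
  apply/fsubsetP => -[i j] ijA; rewrite in_fsetM /=; apply/andP; split.
    by move/fsubsetP: AB; apply; apply/imfsetP; exists (i, j).
  by rewrite /D in_fsetU; apply/orP; left; apply/imfsetP; exists (i, j).
have := hA _ A0BD; rewrite big_fsetM => h1.
rewrite -[S](subrK (\sum_(i <- B) \sum_(j <- D) f (i, j))) -addrA (splitr e).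
apply: le_lt_trans (ler_normD _ _) _; apply: ltr_leD => //.
rewrite -sumrB; apply: le_trans (ler_norm_sum _ _ _) _.
apply: (@le_trans _ _ (\sum_(i <- B) (e / 2 / k))); last first.
  rewrite big_const_seq count_predT iter_addr addr0 -[leLHS]mulr_natr.
  by rewrite mulrAC ler_pdivrMr // ler_wpM2l ?ltW // /k ltrDl.
rewrite big_seq [leRHS]big_seq; apply: ler_sum => i iB; rewrite distrC; apply/ltW/hJ.
rewrite /D; apply: fsubset_trans (fsubsetUr _ _); exact: bigfcup_sup.
Qed.

Lemma abs_bounded_pair (I J : choiceType) (f : I * J -> C) (b : I -> C) :
  (forall i (B : {fset J}), \sum_(j <- B) `|f (i, j)| <= b i) ->
  abs_bounded b -> abs_bounded f.
Proof.
move=> fb [M bM]; exists M => A.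
pose A1 := (fst @` A)%fset; pose A2 := (snd @` A)%fset.
have sA : (A `<=` A1 `*` A2)%fset.
  apply/fsubsetP => x xA; rewrite in_fsetM; apply/andP.
  by split; apply/imfsetP; exists x.
apply: (@le_trans _ _ (\sum_(k <- (A1 `*` A2)%fset) `|f k|)).
  rewrite [leRHS](big_fsetID _ (mem A)) /=.
  rewrite (_ : [fset x in _ | x \in A]%fset = A) ?lerDl ?sumr_ge0 //.
  by apply/fsetP => x; rewrite !inE /= andbC; case xA: (x \in A) => //=; have := fsubsetP sA _ xA; rewrite !inE.
rewrite big_fsetM; apply: le_trans (bM A1); apply: ler_sum => i _.
have b0 : 0 <= b i := le_trans (sumr_ge0 _ (fun _ _ => normr_ge0 _)) (fb i A2).
by rewrite (ger0_norm b0).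
Qed.

Lemma abs_bounded_fiber (I J : choiceType) (f : I * J -> C) i :
  abs_bounded f -> abs_bounded (fun j => f (i, j)).
Proof. by move=> /(abs_bounded_inj (phi := fun j => (i, j))); apply; move=> x y []. Qed.

Lemma csum_pair (I J : choiceType) (f : I * J -> C) :
  abs_bounded f -> has_sum (fun i => csum (fun j => f (i, j))) (csum f).
Proof.
move=> fb; apply: has_sum_fubini (csumP fb) _ => i.
exact/csumP/abs_bounded_fiber.
Qed.

Lemma csum_pair_swap (I J : choiceType) (f : I * J -> C) :
  abs_bounded f -> has_sum (fun j => csum (fun i => f (i, j))) (csum f).
Proof.
move=> fb; pose swap (A B : choiceType) (p : A * B) := (p.2, p.1).
have sK (A B : choiceType) : cancel (@swap A B) (@swap B A) by case.
rewrite -(csum_reindex (phi := @swap J I) f (sK _ _) (sK _ _)).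
exact: csum_pair (abs_bounded_inj (can_inj (sK _ _)) fb).
Qed.

Lemma abs_bounded_mul (I J : choiceType) (f : I -> C) (g : J -> C) :
  abs_bounded f -> abs_bounded g -> abs_bounded (fun k : I * J => f k.1 * g k.2).
Proof.
move=> fb [N gN]; apply: (@abs_bounded_pair _ _ _ (fun i => `|f i| * N)).
  move=> i B /=; rewrite (eq_bigr (fun j => `|f i| * `|g j|)); last by move=> j _; rewrite normrM.
  by rewrite -mulr_sumr ler_wpM2l.
under eq_fun do rewrite mulrC.
by apply: abs_boundedZ; apply: abs_bounded_norm.
Qed.

Lemma csum_mul (I J : choiceType) (f : I -> C) (g : J -> C) :
  abs_bounded f -> abs_bounded g ->
  has_sum (fun k : I * J => f k.1 * g k.2) (csum f * csum g).
Proof.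
move=> fb gb; have fg := abs_bounded_mul fb gb.
suff <- : csum (fun k : I * J => f k.1 * g k.2) = csum f * csum g by apply: csumP.
apply: has_sum_unique (csum_pair fg) _.
rewrite mulrC; apply: eq_has_sum (has_sumZ (csum g) (csumP fb)) => i /=.
by rewrite mulrC; apply/esym/csumE/has_sumZ/csumP.
Qed.

End UnconditionalSums.

(** * Tails and convergence tests *)

Section SumTools.
Variable C : sum_field.

Lemma abs_bounded_tail (I : choiceType) (f : I -> C) e : abs_bounded f -> 0 < e ->
  exists A0 : {fset I}, forall A : {fset I}, [disjoint A0 & A]%fset ->
    \sum_(i <- A) `|f i| < e.
Proof.
move=> /abs_bounded_norm fb e0; have e2 : 0 < e / 2 by rewrite divr_gt0.
have [A0 hA] := csumP fb e2; exists A0 => A dA.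
have := hA A0 (fsubset_refl _); have := hA (A0 `|` A)%fset (fsubsetUl _ _).
have -> : \sum_(i <- (A0 `|` A)%fset) `|f i| = \sum_(i <- A0) `|f i| + \sum_(i <- A) `|f i|.
  rewrite (big_fsetID _ (mem A0)) /=; congr (_ + _); apply: eq_fbigl => i; rewrite !inE /=.
    by case: (i \in A0) => //=; rewrite andbF.
  have := fdisjointP dA i; case: (i \in A0) => //= => [/(_ isT)|_]; last by rewrite andbT.
  by move=> /negbTE ->.
set S := csum _; set a := \sum_(i <- A0) _; set b := \sum_(i <- A) _ => h1 h2.
rewrite (splitr e); have := ltrD h1 h2; rewrite [X in _ + X]distrC.
move=> /(le_lt_trans (ler_normD _ _)); rewrite (_ : _ + _ = - b); last by ring.
by rewrite normrN ger0_norm // sumr_ge0.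
Qed.

Lemma leq_bigmax_fset (A : {fset nat}) n : n \in A -> (n <= \max_(i <- A) i)%N.
Proof. by move=> nA; rewrite (big_fsetD1 n) //= leq_maxl. Qed.

Lemma abs_bounded_small (f : nat -> C) e : abs_bounded f -> 0 < e ->
  exists N, forall n, (N <= n)%N -> `|f n| < e.
Proof.
move=> fb /(abs_bounded_tail fb)[A0 hA].
exists (\max_(i <- A0) i).+1 => n hn.
have := hA [fset n]%fset; rewrite big_seq_fset1; apply.
apply/fdisjointP => i iA; rewrite inE; apply: contraTneq hn => <-.
by rewrite -leqNgt; exact: leq_bigmax_fset.
Qed.

Lemma abs_bounded_nat (f : nat -> C) M :
  (forall N, \sum_(0 <= i < N) `|f i| <= M) -> abs_bounded f.
Proof.
move=> fM; exists M => A; apply: le_trans (fM (\max_(i <- A) i).+1).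
rewrite [leRHS](bigID (mem A)) /= -[leLHS]addr0; apply: lerD; last exact: sumr_ge0.
rewrite -[leRHS]big_filter le_eqVlt; apply/orP; left; apply/eqP.
apply: perm_big; apply: uniq_perm; rewrite ?fset_uniq ?filter_uniq ?iota_uniq //.
move=> i; rewrite mem_filter /= mem_index_iota /=.
case iA: (i \in A) => //=; rewrite ltnS; apply/esym.
exact: leq_bigmax_fset.
Qed.

Lemma abs_bounded_ratio (f : nat -> C) N :
  (forall n, (N <= n)%N -> `|f n.+1| *+ 2 <= `|f n|) -> abs_bounded f.
Proof.
move=> hf; apply: (@abs_bounded_nat _ (\sum_(0 <= i < N) `|f i| + `|f N| *+ 2)).
(* Subtracting twice the last term makes the bound inductive: since terms halve, the new term is
   paid for by the decrease of the subtracted one. *)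
have H k : \sum_(0 <= i < N + k) `|f i| <=
    \sum_(0 <= i < N) `|f i| + `|f N| *+ 2 - `|f (N + k)%N| *+ 2.
  elim: k => [|k IH]; first by rewrite addn0 addrK.
  rewrite addnS big_nat_recr //=.
  have h := hf (N + k)%N (leq_addr _ _).
  rewrite lerBrDr; apply: le_trans (_ : (\sum_(0 <= i < N + k) `|f i| + `|f (N + k)%N| *+ 2) <= _).
    by rewrite -addrA lerD2l mulr2n lerD2l.
  by rewrite -lerBrDr.
move=> K; case: (leqP N K) => [/subnKC <-|KN].
  by apply: le_trans (H _) _; rewrite gerBl mulrn_wge0.
rewrite (@big_cat_nat _ _ _ K 0%N N) //=; last exact: ltnW.
by rewrite -addrA lerDl addr_ge0 ?sumr_ge0 ?mulrn_wge0.
Qed.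

Lemma abs_bounded_geo (r : C) : `|r| < 1 -> abs_bounded (fun n : nat => r ^+ n).
Proof.
move=> r1; have r0 : 0 < 1 - `|r| by rewrite subr_gt0.
apply: (@abs_bounded_nat _ (1 - `|r|)^-1) => N.
have -> : \sum_(0 <= i < N) `|r ^+ i| = (1 - `|r| ^+ N) / (1 - `|r|).
  apply: (mulIf (lt0r_neq0 r0)); rewrite mulfVK ?lt0r_neq0 //.
  rewrite -[RHS]opprB subrX1 -mulNr opprB mulrC big_mkord.
  by under eq_bigr do rewrite normrX.
rewrite ler_pdivrMr // mulVf ?lt0r_neq0 //.
by rewrite gerBl exprn_ge0.
Qed.

Lemma pow_small (r e : C) : `|r| < 1 -> 0 < e ->
  exists N, forall n, (N <= n)%N -> `|r| ^+ n < e.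
Proof.
move=> /abs_bounded_geo h /(abs_bounded_small h)[N hN]; exists N => n /hN.
by rewrite normrX.
Qed.

Lemma abs_bounded_finType (I : finType) (f : I -> C) : abs_bounded f.
Proof.
exists (\sum_i `|f i|) => A; rewrite -[leLHS]/(\sum_(i <- enum_fset A) `|f i|).
rewrite big_uniq ?fset_uniq //= [leRHS](bigID (mem A)) /=.
by rewrite lerDl sumr_ge0.
Qed.

Lemma abs_bounded_int (f : int -> C) :
  abs_bounded (fun n => f (Posz n)) -> abs_bounded (fun n => f (Negz n)) -> abs_bounded f.
Proof.
move=> [M fM] [N fN].
pose g (k : bool * nat) := f (if k.1 then Posz k.2 else Negz k.2).
have gb : abs_bounded g.
  apply: (@abs_bounded_pair _ _ _ _ (fun b => if b then M else N)).
    by case=> B; rewrite /g.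
  exact: abs_bounded_finType.
pose psi (n : int) := match n with Posz n => (true, n) | Negz n => (false, n) end.
have := @abs_bounded_inj _ _ _ psi g _ gb.
rewrite (_ : g \o psi = f); last by apply/funext; case.
by apply; case=> m [] n // [->].
Qed.

Lemma has_sum_sum (I J : choiceType) (s : seq I) (f : I -> J -> C) (S : I -> C) :
  (forall i, has_sum (f i) (S i)) -> has_sum (fun j => \sum_(i <- s) f i j) (\sum_(i <- s) S i).
Proof.
move=> hf; elim: s => [|a s IH].
  by rewrite big_nil; apply: eq_has_sum (@has_sum0 C J) => j; rewrite big_nil.
rewrite big_cons; apply: eq_has_sum (has_sumD (hf a) IH) => j.
by rewrite big_cons.
Qed.


(** Multiplying each row sum by its phase [u i] turns the sum of the norms into a single sum over
    [J], bounded by [has_sum_norm_le]. For a vanishing row sum the phase is [0], because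
    [0 / 0 = 0]. *)
Lemma abs_bounded_csum (I J : choiceType) (F : I * J -> C) :
  abs_bounded F -> abs_bounded (fun i => csum (fun j => F (i, j))).
Proof.
move=> Fb; have [M hM] := Fb; exists M => A.
pose S i := csum (fun j => F (i, j)); pose u i := `|S i| / S i.
have u1 i : `|u i| <= 1.
  rewrite /u; have [->|s0] := eqVneq (S i) 0; first by rewrite normr0 mul0r normr0.
  by rewrite normrM normr_id normfV divff // normr_eq0.
have hS i : has_sum (fun j => u i * F (i, j)) `|S i|.
  have -> : `|S i| = u i * S i.
    rewrite /u; have [->|s0] := eqVneq (S i) 0; first by rewrite normr0 mulr0.
    by rewrite mulfVK.
  exact/has_sumZ/csumP/abs_bounded_fiber.
have := has_sum_sum A hS => /has_sum_norm_le h.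
rewrite -[leLHS]ger0_norm ?sumr_ge0 //; apply: h => B.
apply: le_trans (hM (A `*` B)%fset).
have -> : \sum_(k <- (A `*` B)%fset) `|F k| = \sum_(j <- B) \sum_(i <- A) `|F (i, j)|.
  rewrite exchange_big /=; exact: big_fsetM.
apply: ler_sum => j _; apply: le_trans (ler_norm_sum _ _ _) _.
by apply: ler_sum => i _; rewrite normrM ler_piMl.
Qed.

End SumTools.

Section Binomials.

Lemma binz2_double (n : int) : 2 * binz2 n = n * (n - 1).
Proof.
rewrite /binz2 mulrC divzK //; apply/dvdzP.
have [k [->|->]] : exists k, n = k * 2 \/ n = k * 2 + 1.
  exists (n %/ 2)%Z; have := divz_eq n 2.
  have := modz_ge0 n (isT : 2 != 0 :> int); have := @ltz_pmod n 2 isT; lia.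
- by exists (k * (k * 2 - 1)); ring.
by exists ((k * 2 + 1) * k); ring.
Qed.

Lemma binz2S n : binz2 (n + 1) = binz2 n + n.
Proof.
have h1 := binz2_double n; have h2 := binz2_double (n + 1).
have : 2 * binz2 (n + 1) = 2 * (binz2 n + n) by rewrite mulrDr h1 h2; ring.
lia.
Qed.

Lemma binz2D m n : binz2 (m + n) = binz2 m + binz2 n + m * n.
Proof.
have h1 := binz2_double n; have h2 := binz2_double m; have h3 := binz2_double (m + n).
have : 2 * binz2 (m + n) = 2 * (binz2 m + binz2 n + m * n) by rewrite 2!mulrDr h1 h2 h3; ring.
lia.
Qed.

Lemma binz2N n : binz2 (- n) = binz2 n + n.
Proof.
have h1 := binz2_double n; have h3 := binz2_double (- n).
have : 2 * binz2 (- n) = 2 * (binz2 n + n) by rewrite mulrDr h1 h3; ring.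
lia.
Qed.

Lemma binz20 : binz2 0 = 0. Proof. by []. Qed.

End Binomials.

(** * Laurent series on the punctured plane *)

Section Laurent.
Variable C : sum_field.

Lemma normr_expz (x : C) (n : int) : `|x ^ n| = `|x| ^ n.
Proof. by case: n => n; rewrite ?NegzE -?exprnN -?exprnP ?normfV normrX. Qed.

(** These are the coefficient sequences of the functions holomorphic on the punctured plane. *)
Definition laurent (e : int -> C) :=
  forall r : C, 0 < r -> abs_bounded (fun n => e n * r ^ n).

Definition lsum (e : int -> C) (y : C) : C := csum (fun n => e n * y ^ n).

(** Nothing is asked at [0], so functions of [y^-1] qualify as well. *)
Definition laurent_fun (f : C -> C) :=
  exists2 e, laurent e & forall y, y != 0 -> f y = lsum e y.

Lemma laurent_bounded e y : laurent e -> y != 0 -> abs_bounded (fun n => e n * y ^ n).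
Proof.
move=> he y0; have := he `|y|; rewrite normr_gt0 y0 => /(_ isT).
by apply: abs_bounded_le => n; rewrite !normrM !normr_expz normr_id.
Qed.

Lemma laurent_sum e y : laurent e -> y != 0 -> has_sum (fun n => e n * y ^ n) (lsum e y).
Proof. by move=> he y0; apply: csumP; apply: laurent_bounded. Qed.

Lemma laurent_fun_ext f g : (forall y, y != 0 -> f y = g y) -> laurent_fun f -> laurent_fun g.
Proof. by move=> fg [e he ef]; exists e => // y y0; rewrite -fg // ef. Qed.

Lemma laurent_funD f g : laurent_fun f -> laurent_fun g -> laurent_fun (fun y => f y + g y).
Proof.
move=> [e he ef] [d hd dg]; exists (fun n => e n + d n).
  by move=> r r0; under eq_fun do rewrite mulrDl; apply: abs_boundedD; [apply: he|apply: hd].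
move=> y y0; rewrite ef // dg //; apply/esym/csumE.
by apply: eq_has_sum (has_sumD (laurent_sum he y0) (laurent_sum hd y0)) => n; rewrite mulrDl.
Qed.

Lemma laurent_funZ f a : laurent_fun f -> laurent_fun (fun y => a * f y).
Proof.
move=> [e he ef]; exists (fun n => a * e n).
  by move=> r r0; under eq_fun do rewrite -mulrA; apply/abs_boundedZ/he.
move=> y y0; rewrite ef //; apply/esym/csumE.
by apply: eq_has_sum (has_sumZ a (laurent_sum he y0)) => n; rewrite mulrA.
Qed.

Lemma laurent_funB f g : laurent_fun f -> laurent_fun g -> laurent_fun (fun y => f y - g y).
Proof.
move=> hf /(laurent_funZ (-1)) hg.
by apply: laurent_fun_ext (laurent_funD hf hg) => y _; rewrite mulN1r.
Qed.

Lemma laurent_fun_scale f a : a != 0 -> laurent_fun f -> laurent_fun (fun y => f (a * y)).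
Proof.
move=> a0 [e he ef]; exists (fun n => e n * a ^ n).
  move=> r r0; have ar : a * r != 0 by rewrite mulf_neq0 // gt_eqF.
  by apply: abs_bounded_le (laurent_bounded he ar) => n; rewrite -mulrA expfzMl.
move=> y y0; rewrite ef ?mulf_neq0 //.
by apply: eq_csum => n; rewrite -mulrA expfzMl.
Qed.

(** Joint absolute convergence at each radius lets the two summations be exchanged, so the
    coefficients of the sum are the sums of the coefficients. Both products and series of pole-free
    kernels get their expansion from this. *)
Lemma laurent_fun_sum (I : choiceType) (a : I -> int -> C) :
  (forall r, 0 < r -> abs_bounded (fun k : I * int => a k.1 k.2 * r ^ k.2)) ->
  (forall y, y != 0 -> has_sum (fun i => lsum (a i) y) (csum (fun i => lsum (a i) y))) /\
  laurent_fun (fun y => csum (fun i => lsum (a i) y)).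
Proof.
move=> ha.
have hy y : y != 0 -> abs_bounded (fun k : I * int => a k.1 k.2 * y ^ k.2).
  move=> y0; have := ha `|y|; rewrite normr_gt0 y0 => /(_ isT).
  by apply: abs_bounded_le => n; rewrite !normrM !normr_expz normr_id.
have hS y : y != 0 -> csum (fun i => lsum (a i) y) = csum (fun k : I * int => a k.1 k.2 * y ^ k.2).
  by move=> y0; apply: csumE; exact: (csum_pair (hy y y0)).
split=> [y y0|]; first by rewrite hS //; exact: (csum_pair (hy y y0)).
have hsw r : r != 0 -> abs_bounded (fun k : int * I => a k.2 k.1 * r ^ k.1).
  move=> r0; pose sw (k : int * I) := (k.2, k.1).
  by apply: (abs_bounded_inj (phi := sw) _ (hy r r0)) => -[x u] [x' u'] [-> ->].
exists (fun n => csum (fun i => a i n)).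
  move=> r r0; have rn0 : r != 0 by rewrite gt_eqF.
  apply: abs_bounded_le (abs_bounded_csum (hsw r rn0)) => n.
  rewrite (_ : csum _ * _ = csum (fun i => a i n * r ^ n)) //.
  have rn : r ^ n != 0 by rewrite expfz_neq0.
  have hb : abs_bounded (fun i => a i n).
    have := abs_boundedZ (r ^ n)^-1 (abs_bounded_fiber n (hsw r rn0)).
    by apply: abs_bounded_le => i /=; rewrite mulrC mulfK.
  apply/esym/csumE; rewrite mulrC.
  by apply: eq_has_sum (has_sumZ (r ^ n) (csumP hb)) => i; rewrite mulrC.
move=> y y0; rewrite hS //; apply/esym/csumE.
apply: eq_has_sum (csum_pair_swap (hy y y0)) => n /=.
have yn : y ^ n != 0 by rewrite expfz_neq0.
have hb : abs_bounded (fun i => a i n).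
  have := abs_boundedZ (y ^ n)^-1 (abs_bounded_fiber n (hsw y y0)).
  by apply: abs_bounded_le => i /=; rewrite mulrC mulfK.
apply/csumE; rewrite mulrC.
by apply: eq_has_sum (has_sumZ (y ^ n) (csumP hb)) => i; rewrite mulrC.
Qed.

Lemma laurent_funM f g : laurent_fun f -> laurent_fun g -> laurent_fun (fun y => f y * g y).
Proof.
move=> [e he ef] [d hd dg].
(* The Cauchy product, read as a sum over the exponent [k] of [f] of shifted copies of the series of
   [g]. *)
have [|h1 h2] := @laurent_fun_sum int (fun k n => e k * d (n - k)).
  move=> r r0; have rn : r != 0 by rewrite gt_eqF.
  have := abs_bounded_mul (he r r0) (hd r r0).
  pose phi (k : int * int) := (k.1, k.2 - k.1).
  move=> /(abs_bounded_inj (phi := phi)); rewrite (_ : _ \o phi = fun k : int * int => e k.1 * d (k.2 - k.1) * r ^ k.2).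
    by apply=> -[x u] [x' u'] [-> /addIr ->].
  apply/funext => k; rewrite /phi /= mulrACA -expfzDr //.
  by rewrite [k.1 + _]addrC subrK.
apply: laurent_fun_ext h2 => y y0; rewrite ef // dg //; apply: csumE.
rewrite mulrC; apply: eq_has_sum (has_sumZ (lsum d y) (laurent_sum he y0)) => k /=.
rewrite mulrC; apply/esym/csumE.
have := has_sumZ (e k * y ^ k) (laurent_sum hd y0).
move=> /(has_sum_reindex (phi := fun n => n - k) (psi := fun n => n + k)) h.
apply: eq_has_sum (h _ _) => [n|n|n]; rewrite ?subrK ?addrK //=.
by rewrite mulrACA -expfzDr // [k + _]addrC subrK.
Qed.

(* A sum over [n] congruent to [k] modulo [2 ^ m] is obtained from the one modulo
   [2 ^ m.-1] by averaging over [y] and [w * y], where [w ^ (2 ^ m.-1) = -1]. *)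
Lemma laurent_uniq e r : laurent e -> 0 < r ->
  (forall y, `|y| = r -> lsum e y = 0) -> forall n, e n = 0.
Proof.
move=> he r0 e0 k.
have H m y : `|y| = r -> has_sum (fun n => if (2 ^+ m %| n - k)%Z then e n * y ^ n else 0) 0.
  elim: m y => [|m IH] y yr.
    have y0 : y != 0 by rewrite -normr_gt0 yr.
    rewrite -(e0 _ yr); apply: eq_has_sum (laurent_sum he y0) => n.
    by rewrite expr0 dvd1z.
  have m0 : (0 < 2 ^ m)%N by rewrite expn_gt0.
  pose w : C := (2 ^ m).-root (-1).
  have wm : w ^+ (2 ^ m) = -1 by apply: rootCK.
  have w1 : `|w| = 1.
    by apply/eqP; rewrite -(@pexpr_eq1 _ _ (2 ^ m)) // -normrX wm normrN normr1.
  have w0 : w != 0 by rewrite -normr_gt0 w1.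
  have wyr : `|w * y| = r by rewrite normrM w1 mul1r.
  have h := has_sumZ (2^-1) (has_sumD (IH y yr) (has_sumZ (w ^ (- k)) (IH (w * y) wyr))).
  rewrite !mulr0 addr0 mulr0 in h; apply: eq_has_sum h => n.
  case: ifP => [/dvdzP[d hd]|h1]; last first.
    rewrite mulr0 addr0 mulr0; case: ifP => // h2.
    by move: h1; rewrite (dvdz_trans _ h2) // exprSr dvdz_mulr.
  have -> : w ^ (- k) * (e n * (w * y) ^ n) = (-1) ^ d * (e n * y ^ n).
    have <- : w ^ (n - k) = (-1) ^ d.
      by rewrite hd mulrC -exprz_exp (_ : 2 ^+ m = Posz (2 ^ m)) -?exprnP ?wm // -[RHS]natz natrX.
    by rewrite expfzDr // expfzMl; ring.
  have -> : (2 ^+ m.+1 %| n - k)%Z = (2 %| d)%Z.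
    by rewrite hd exprS !dvdzE !abszM dvdn_pmul2r // absz_gt0 expf_neq0.
  rewrite -[X in X + _]mul1r -mulrDl.
  have sq1 : (-1 : C) ^ (2 : int) = 1 by rewrite -[LHS]/((-1) ^+ 2) sqrrN expr1n.
  have [->|->] : d = 2 * (d %/ 2)%Z \/ d = 2 * (d %/ 2)%Z + 1.
  - have := divz_eq d 2; have := modz_ge0 d (isT : 2 != 0 :> int).
    have := @ltz_pmod d 2 isT; lia.
  - rewrite dvdz_mulr // -exprz_exp sq1 exp1rz.
    by rewrite mulrA mulVf ?mul1r // pnatr_eq0.
  have -> : (2 %| 2 * (d %/ 2)%Z + 1)%Z = false by apply/negP => /dvdzP[c]; lia.
  rewrite expfzDr ?oppr_eq0 ?oner_eq0 // -exprz_exp sq1 exp1rz.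
  by rewrite mul1r expr1z subrr mul0r mulr0.
have rn : r != 0 by rewrite gt_eqF.
suff /eqP : e k * r ^ k = 0 by rewrite mulf_eq0 (negbTE (expfz_neq0 k rn)) orbF => /eqP.
apply/eqP; rewrite -normr_le0; apply/ler_addgt0Pr => eps eps0; rewrite add0r.
have e2 : 0 < eps / 2 by rewrite divr_gt0.
have [A0 hA0] := abs_bounded_tail (he r r0) e2.
(* As [m < 2 ^ m], no index of [A0] other than [k] is congruent to [k] modulo [2 ^ m]; the other
   surviving terms lie outside [A0], where the norms sum to less than [eps / 2]. *)
pose m := (\max_(n <- A0) `|n - k|)%N.
have [A1 hA1] := H m r (gtr0_norm r0) _ e2.
have kD : k \in (k |` (A1 `|` A0))%fset by rewrite !inE eqxx.
have := hA1 (k |` (A1 `|` A0))%fset; rewrite sub0r normrN (big_fsetD1 _ kD) /= subrr dvdz0 => h1.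
have {}h1 := h1 (fsubset_trans (fsubsetUl A1 A0) (fsubsetU1 _ _)).
set g := (X in `|X|); set T := (X in `|g + X|) in h1.
rewrite -[g](addrK T) (splitr eps); apply: le_trans (ler_normB _ _) _.
apply: lerD; first exact: ltW.
clear h1; rewrite {}/T; set D := (_ `\ k)%fset.
rewrite (big_fsetID _ (mem A0)) /= [X in `|X + _|]big1_fset => [|n]; last first.
  rewrite !inE /= => /andP[/andP[nk _] nA] _; case: ifP => // hdiv.
  have : (`|n - k| <= m)%N by rewrite /m (big_fsetD1 n) //= leq_maxl.
  have nk0 : (0 < `|n - k|)%N by rewrite absz_gt0 subr_eq0.
  have : (2 ^ m <= `|n - k|)%N.
    by apply: dvdn_leq nk0 _; move: hdiv; rewrite /dvdz /= abszX.
  by move=> h2 /(leq_trans h2); rewrite leqNgt ltn_expl.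
rewrite add0r; apply: le_trans (ler_norm_sum _ _ _) _.
have /hA0/ltW : [disjoint A0 & [fset x in D | x \notin A0]]%fset.
  by apply/fdisjointP => x xA; rewrite !inE /= xA andbF.
apply: le_trans; apply: ler_sum => n _.
by case: ifP => // _; rewrite normr0.
Qed.

(** This stands in for the identity theorem: the circle can be chosen where a series converges or a
    factor is invertible. *)
Lemma laurent_fun_eq f g (r : C) : laurent_fun f -> laurent_fun g -> 0 < r ->
  (forall y, `|y| = r -> f y = g y) -> forall y, y != 0 -> f y = g y.
Proof.
move=> hf hg r0 fg y y0; apply/eqP; rewrite -subr_eq0; apply/eqP.
have [e he ef] := laurent_funB hf hg; rewrite (ef _ y0).
have e0 : forall n, e n = 0.
  apply: (laurent_uniq he r0) => z zr; have z0 : z != 0 by rewrite -normr_gt0 zr.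
  by rewrite -ef // fg // subrr.
apply: csumE; apply: eq_has_sum (@has_sum0 C int) => n.
by rewrite e0 mul0r.
Qed.

End Laurent.

(** * Power series near the origin *)

Section PowerSeries.
Variable C : sum_field.

Lemma has_sum_delta (I : choiceType) (a : I) (v : C) :
  has_sum (fun i => if i == a then v else 0) v.
Proof.
move=> e e0; exists [fset a]%fset => A; rewrite fsub1set => aA.
rewrite (big_fsetD1 a) //= eqxx big1_fset ?addr0 ?subrr ?normr0 // => i.
by rewrite !inE => /andP[/negbTE ->].
Qed.

Lemma has_sum_nat_shift (f : nat -> C) S :
  has_sum (fun n => f n.+1) S -> has_sum f (f 0%N + S).
Proof.
move=> hf; pose g n := if n is m.+1 then f n else 0.
have hg : has_sum g S.
  by apply: (@has_sum_inj _ _ _ succn predn) => // -[|n]; [right|left; rewrite inE].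
by apply: eq_has_sum (has_sumD (has_sum_delta 0%N (f 0%N)) hg) => -[|n] /=; rewrite ?addr0 ?add0r.
Qed.

(** A quantitative continuity at [0]; with it, invariance under [w -> p * w] becomes an evaluation
    at [0]. *)
Lemma power_series_near0 (c : nat -> C) r : 0 < r -> abs_bounded (fun n => c n * r ^+ n) ->
  exists2 M, 0 < M & forall w, `|w| <= r ->
    `|csum (fun n => c n * w ^+ n) - c 0%N| <= M * `|w|.
Proof.
move=> r0 cb; have [M hM] := cb.
have M0 : 0 <= M by apply: le_trans (hM fset0); rewrite big_seq_fset0.
exists (M / r + 1); first by rewrite ltr_wpDl // divr_ge0 // ltW.
move=> w wr.
have cw : abs_bounded (fun n => c n * w ^+ n).
  apply: abs_bounded_le cb => n; rewrite !normrM ler_wpM2l // !normrX lerXn2r ?nnegrE //.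
  by rewrite (gtr0_norm r0).
have h := has_sumB (csumP cw) (has_sum_delta 0%N (c 0%N)).
apply: (has_sum_norm_le h) => A.
apply: (@le_trans _ _ (\sum_(n <- A) `|w| / r * `|c n * r ^+ n|)); last first.
  rewrite -mulr_sumr mulrC; apply: le_trans (_ : M * (`|w| / r) <= _).
    by rewrite ler_wpM2r // divr_ge0 // ltW.
  by rewrite mulrDl mul1r mulrA mulrAC lerDl.
apply: ler_sum => -[|n] _ /=.
  by rewrite mulr1 subrr normr0 mulr_ge0 // divr_ge0 // ltW.
rewrite subr0 !normrM !normrX (gtr0_norm r0) !exprS [leRHS]mulrCA ler_wpM2l //.
rewrite [leRHS]mulrA mulfVK ?gt_eqF // ler_wpM2l //.
by rewrite lerXn2r ?nnegrE // ltW.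
Qed.

Lemma conv_bounded0 (v : C) (u : nat -> C) M (r : C) : `|r| < 1 -> 0 <= M ->
  (forall n, `|v - u n| <= M * `|r| ^+ n) ->
  forall e, 0 < e -> exists N, forall n, (N <= n)%N -> `|v - u n| < e.
Proof.
move=> r1 M0 h e e0; have M1 : 0 < M + 1 by rewrite ltr_wpDl.
have [N hN] := pow_small r1 (divr_gt0 e0 M1).
exists N => n /hN; rewrite ltr_pdivlMr // => h2.
apply: le_lt_trans (h n) (le_lt_trans _ h2).
by rewrite mulrC ler_wpM2l ?exprn_ge0 // lerDl.
Qed.

Lemma conv0_eq (v : C) M (r : C) : `|r| < 1 -> 0 <= M ->
  (forall n, `|v| <= M * `|r| ^+ n) -> v = 0.
Proof.
move=> r1 M0 h; apply/eqP; rewrite -normr_le0; apply/ler_addgt0Pr => e e0.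
have [|N /(_ N (leqnn N))] := @conv_bounded0 v (fun=> 0) M r r1 M0 _ e e0.
  by move=> n; rewrite subr0.
by rewrite subr0 add0r => /ltW.
Qed.

Lemma laurent_fun_inv (f : C -> C) : laurent_fun f -> laurent_fun (fun y => f y^-1).
Proof.
move=> [e he ef]; exists (fun n => e (- n)).
  move=> r r0; have := he r^-1; rewrite invr_gt0 => /(_ r0).
  move=> /(abs_bounded_inj (phi := -%R) (@oppr_inj _)); apply: abs_bounded_le => n /=.
  by rewrite exprz_inv opprK.
move=> y y0; rewrite ef ?invr_eq0 //.
rewrite -[LHS](csum_reindex (phi := -%R) (psi := -%R) _ (@opprK _) (@opprK _)).
by apply: eq_csum => n /=; rewrite exprz_inv opprK.
Qed.

End PowerSeries.

HB.lock Definition theta_coef (C : fieldType) (p : C) (n : int) : C :=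
  (-1) ^ n * p ^ binz2 n.

(** * Theta coefficients and Euler's two expansions *)

Section QSeries.
Variable C : sum_field.
Variable p : C.
Hypothesis p01 : 0 < `|p| < 1.

Let p1 : `|p| < 1. Proof. by case/andP: p01. Qed.
Let p0 : p != 0. Proof. by rewrite -normr_gt0; case/andP: p01. Qed.
Let q0 : 0 < 1 - `|p|. Proof. by rewrite subr_gt0. Qed.

Definition fin_poch (n : nat) : C := \prod_(0 <= k < n) (1 - p ^+ k.+1).

Lemma sub1_expr_ge k : 1 - `|p| <= `|1 - p ^+ k.+1|.
Proof.
apply: le_trans (_ : 1 - `|p ^+ k.+1| <= _).
  by rewrite lerD2l lerN2 normrX exprS ler_piMr // exprn_ile1 // ltW.
by have := lerB_dist 1 (p ^+ k.+1); rewrite normr1.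
Qed.

Lemma sub1_expr_neq0 k : 1 - p ^+ k.+1 != 0.
Proof. by rewrite -normr_gt0; exact: lt_le_trans (sub1_expr_ge k). Qed.

Lemma fin_pochS n : fin_poch n.+1 = fin_poch n * (1 - p ^+ n.+1).
Proof. by rewrite /fin_poch big_nat_recr. Qed.

Lemma fin_poch0 : fin_poch 0 = 1.
Proof. by rewrite /fin_poch big_geq. Qed.

Lemma fin_poch_neq0 n : fin_poch n != 0.
Proof.
elim: n => [|n IH]; first by rewrite fin_poch0 oner_eq0.
by rewrite fin_pochS mulf_neq0 ?sub1_expr_neq0.
Qed.

Local Notation tcoef := (theta_coef p).

Lemma tcoefE n : tcoef n = (-1) ^ n * p ^ binz2 n.
Proof. by rewrite theta_coef.unlock. Qed.

Lemma normr_tcoef n : `|tcoef n| = `|p| ^ binz2 n.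
Proof. by rewrite tcoefE normrM !normr_expz normrN1 exp1rz mul1r. Qed.

Lemma tcoefD m n : tcoef (m + n) = tcoef m * tcoef n * p ^ (m * n).
Proof.
rewrite !tcoefE binz2D !expfzDr ?oppr_eq0 ?oner_eq0 //.
by ring.
Qed.

Lemma tcoef1 : tcoef 1 = -1.
Proof. by rewrite !tcoefE expr1z mulr1. Qed.

Lemma tcoef0 : tcoef 0 = 1.
Proof. by rewrite !tcoefE expr0z mulr1. Qed.

Lemma tcoefS n : tcoef (n + 1) = - (tcoef n * p ^ n).
Proof. by rewrite tcoefD tcoef1 mulr1 mulrN1 mulNr. Qed.

Lemma tcoefN n : tcoef (- n) = tcoef n * p ^ n.
Proof.
rewrite !tcoefE binz2N expfzDr // mulrA; congr (_ * _ * _).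
by rewrite -exprz_inv invrN1.
Qed.

Lemma laurent_tcoef : laurent tcoef.
Proof.
(* On either half-line the ratio of consecutive terms is [|p| ^+ s n] times a constant, hence
   eventually below one half. *)
have H (r : C) (c : C) (s : nat -> nat) (f : nat -> C) : 0 < r -> (forall n, (n <= s n)%N) ->
    (forall n, `|f n.+1| = `|f n| * `|p| ^+ s n * r) -> abs_bounded f.
  move=> r0 sn fS.
  have [|N hN] := @pow_small C p (2^-1 / r) p1; first by rewrite divr_gt0 // invr_gt0.
  apply: (@abs_bounded_ratio C _ N) => n nN; rewrite fS -mulrA -mulrnAr ler_piMr //.
  have /ltW := hN (s n) (leq_trans nN (sn n)); rewrite ler_pdivlMr // => h.
  by rewrite -mulr_natr -ler_pdivlMr ?ltr0n // mul1r.
move=> r r0; have rn : r != 0 by rewrite gt_eqF.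
apply: abs_bounded_int.
  apply: (H r 1 id) => // n; rewrite intS addrC tcoefS expfzDr // expr1z.
  by rewrite !normrM normrN !normrM !normr_expz (gtr0_norm r0) -!exprnP; ring.
apply: (H r^-1 1 (fun n => n.+2)) => [||n].
- by rewrite invr_gt0.
- by move=> n; rewrite (leq_trans (leqnSn _)).
have -> : Negz n.+1 = Negz n + -1 by rewrite !NegzE; lia.
rewrite tcoefD tcoefN tcoef1 !expfzDr // !normrM normrN1 !normr_expz (gtr0_norm r0) exprN1.
have -> : Negz n * -1 = Posz n.+1 by rewrite NegzE; lia.
by rewrite -exprnP expr1z !exprS; ring.
Qed.

Definition theta (y : C) : C := lsum tcoef y.

Lemma laurent_fun_theta : laurent_fun theta.
Proof. by exists tcoef => //; exact: laurent_tcoef. Qed.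

Lemma theta_sum y : y != 0 -> has_sum (fun n => tcoef n * y ^ n) (theta y).
Proof. exact/laurent_sum/laurent_tcoef. Qed.

Definition euler_coef (n : nat) : C := tcoef n / fin_poch n.

(* [poch x] is [(x; p)_oo], defined by Euler's expansion so that it is visibly entire. *)
Definition poch (x : C) : C := csum (fun n => euler_coef n * x ^+ n).

(* [1 / poch x] near [0]. *)
Definition euler_inv (x : C) : C := csum (fun n => x ^+ n / fin_poch n).

Lemma normr_fin_poch n : `|(fin_poch n)^-1| <= (1 - `|p|) ^- n.
Proof.
rewrite normfV lef_pV2 ?posrE ?exprn_gt0 ?normr_gt0 ?fin_poch_neq0 //.
elim: n => [|n IH]; first by rewrite fin_poch0 normr1 expr0.
rewrite fin_pochS normrM exprSr ler_pM ?exprn_ge0 ?(ltW q0) //.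
exact: sub1_expr_ge.
Qed.

Lemma euler_coef_bounded (x : C) : abs_bounded (fun n => euler_coef n * x ^+ n).
Proof.
have [->|x0] := eqVneq x 0.
  apply: (@abs_bounded_ratio C _ 1) => n _.
  by rewrite exprS mul0r mulr0 normr0 mul0rn.
have r0 : 0 < `|x| / (1 - `|p|) by rewrite divr_gt0 ?normr_gt0.
have := abs_bounded_inj (phi := Posz) (can_inj (fun n => erefl : absz (Posz n) = n)) (laurent_tcoef r0).
apply: abs_bounded_le => n /=; rewrite !normrM -exprnP [X in _ <= _ * X]normrX.
rewrite (gtr0_norm r0) expr_div_n -mulrA. rewrite ler_wpM2l // normrX [leLHS]mulrC.
by rewrite ler_wpM2l ?exprn_ge0 // normr_fin_poch.
Qed.

Lemma poch_sum x : has_sum (fun n => euler_coef n * x ^+ n) (poch x).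
Proof. exact/csumP/euler_coef_bounded. Qed.

(** The crude bound on [fin_poch] yields the disc of radius [1 - |p|] rather than the unit disc.
    This is enough, since the triple product is first proved for large arguments and then
    extended. *)
Lemma euler_inv_bounded (x : C) : `|x| < 1 - `|p| -> abs_bounded (fun n => x ^+ n / fin_poch n).
Proof.
move=> hx; have r1 : `|(`|x| / (1 - `|p|))| < 1.
  by rewrite ger0_norm ?divr_ge0 ?(ltW q0) // ltr_pdivrMr // mul1r.
apply: abs_bounded_le (abs_bounded_geo r1) => n.
rewrite normrM normrX [leRHS]ger0_norm ?exprn_ge0 ?divr_ge0 ?(ltW q0) //.
by rewrite expr_div_n ler_wpM2l ?exprn_ge0 // normr_fin_poch.
Qed.

Lemma euler_coefS n : euler_coef n.+1 * (1 - p ^+ n.+1) = - (euler_coef n * p ^+ n).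
Proof.
rewrite /euler_coef intS addrC tcoefS -exprnP fin_pochS.
by field; rewrite fin_poch_neq0 sub1_expr_neq0.
Qed.

(** Comparison of coefficients in [poch x - poch (p * x) = - x * poch (p * x)]. Iterating it, with
    [poch] near [1] at the origin, recovers the infinite product. *)
Lemma poch_eq x : poch x = (1 - x) * poch (p * x).
Proof.
apply/eqP; rewrite -subr_eq0 mulrBl mul1r opprB addrCA -[X in X + _]opprK -opprB opprK.
have h1 := has_sumB (poch_sum x) (poch_sum (p * x)).
have h2 : has_sum (fun n => euler_coef n * x ^+ n - euler_coef n * (p * x) ^+ n) (0 - x * poch (p * x)).
  have := @has_sum_nat_shift C (fun n => euler_coef n * x ^+ n - euler_coef n * (p * x) ^+ n)
    (- x * poch (p * x)); rewrite !expr0 subrr mulNr; apply.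
  rewrite -mulNr; apply: eq_has_sum (has_sumZ (- x) (poch_sum (p * x))) => n.
  transitivity (euler_coef n.+1 * (1 - p ^+ n.+1) * x ^+ n.+1); last by rewrite exprMn; ring.
  by rewrite euler_coefS exprMn exprS; ring.
have := has_sum_unique h1 h2 => /eqP; rewrite sub0r -addr_eq0 => h.
by move: h; congr (_ == _); ring.
Qed.

Lemma poch0 : poch 0 = 1.
Proof.
apply: csumE; apply: eq_has_sum (has_sum_delta 0%N 1) => -[|n] /=.
  by rewrite expr0 mulr1 /euler_coef fin_poch0 divr1 tcoef0.
by rewrite exprS mul0r mulr0.
Qed.

Lemma euler_inv_eq x : `|x| < 1 - `|p| -> euler_inv (p * x) = (1 - x) * euler_inv x.
Proof.
move=> hx; have hpx : `|p * x| < 1 - `|p|.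
  by rewrite normrM; apply: le_lt_trans hx; rewrite ler_piMl // ltW.
have hx1 := csumP (euler_inv_bounded hx); have hx2 := csumP (euler_inv_bounded hpx).
have h1 := has_sumB hx1 hx2.
have h2 : has_sum (fun n => x ^+ n / fin_poch n - (p * x) ^+ n / fin_poch n) (0 + x * euler_inv x).
  have := @has_sum_nat_shift C (fun n => x ^+ n / fin_poch n - (p * x) ^+ n / fin_poch n)
    (x * euler_inv x); rewrite !expr0 subrr; apply.
  apply: eq_has_sum (has_sumZ x hx1) => n.
  rewrite exprMn fin_pochS !exprS.
  field; rewrite fin_poch_neq0 /= andbT.
  by have := sub1_expr_neq0 n; rewrite exprS.
have := has_sum_unique h1 h2; rewrite add0r mulrBl mul1r => <-.
by rewrite /euler_inv; ring.
Qed.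

Lemma poch_near0 r : 0 < r -> exists2 M, 0 < M & forall w, `|w| <= r -> `|poch w - 1| <= M * `|w|.
Proof.
move=> r0; have [M M0 hM] := power_series_near0 r0 (euler_coef_bounded r).
exists M => // w /hM; by rewrite /euler_coef fin_poch0 divr1 tcoef0.
Qed.

Lemma poch_iter n x : poch x = \prod_(0 <= k < n) (1 - p ^+ k * x) * poch (p ^+ n * x).
Proof.
elim: n => [|n IH]; first by rewrite big_geq // mul1r expr0 mul1r.
by rewrite big_nat_recr //= -mulrA IH; congr (_ * _); rewrite poch_eq mulrA exprS.
Qed.

Lemma normr_pXn_le n (x : C) : `|p ^+ n * x| <= `|x|.
Proof. by rewrite normrM normrX ler_piMl // exprn_ile1 // ltW. Qed.

(** The product is invariant under [x -> p * x], because the two factors [1 - x] cancel, and both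
    series equal [1] at the origin. *)
Lemma euler_inv_poch x : `|x| < 1 - `|p| -> poch x * euler_inv x = 1.
Proof.
move=> hx.
have H n : poch x * euler_inv x = poch (p ^+ n * x) * euler_inv (p ^+ n * x).
  elim: n => [|n ->]; first by rewrite expr0 mul1r.
  rewrite poch_eq exprS -mulrA -/(p ^+ n * x) euler_inv_eq; last exact: le_lt_trans (normr_pXn_le _ _) hx.
  by ring.
have [->|x0] := eqVneq x 0.
  rewrite poch0 mul1r; apply: csumE; apply: eq_has_sum (has_sum_delta 0%N 1) => -[|n] /=.
    by rewrite expr0 fin_poch0 divr1.
  by rewrite exprS mul0r mul0r.
have xr : 0 < `|x| by rewrite normr_gt0.
have [M M0 hM] := poch_near0 xr.
have [|N N0 hN] := @power_series_near0 C (fun n => (fin_poch n)^-1) `|x| xr.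
  by apply: abs_bounded_le (euler_inv_bounded hx) => n; rewrite mulrC !normrM !normrX normr_id.
have {}hN w : `|w| <= `|x| -> `|euler_inv w - 1| <= N * `|w|.
  move=> /hN; rewrite fin_poch0 invr1 /euler_inv.
  by rewrite (eq_csum (g := fun n => w ^+ n / fin_poch n)) // => n; rewrite mulrC.
apply/eqP; rewrite -subr_eq0; apply/eqP.
apply: (@conv0_eq C _ (M * `|x| * (1 + N * `|x|) + N * `|x|) p p1).
  by rewrite ?addr_ge0 ?mulr_ge0 ?addr_ge0 ?mulr_ge0 ?(ltW M0) ?(ltW N0).
move=> n; rewrite (H n); set w := p ^+ n * x; have hw : `|w| <= `|x| := normr_pXn_le n x.
have -> : poch w * euler_inv w - 1 = (poch w - 1) * (1 + (euler_inv w - 1)) + (euler_inv w - 1) by ring.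
apply: le_trans (ler_normD _ _) _; rewrite normrM.
have -> : (M * `|x| * (1 + N * `|x|) + N * `|x|) * `|p| ^+ n =
          M * `|w| * (1 + N * `|x|) + N * `|w| by rewrite /w normrM normrX; ring.
apply: lerD (hN _ hw); apply: ler_pM => //; first exact: hM.
apply: le_trans (ler_normD _ _) _; rewrite normr1 lerD2l; apply: le_trans (hN _ hw) _.
by rewrite ler_wpM2l // ltW.
Qed.

Lemma laurent_fun_poch : laurent_fun poch.
Proof.
pose e (n : int) := if n is Posz m then euler_coef m else 0.
have E y : has_sum (fun n => e n * y ^ n) (poch y).
  apply: (@has_sum_inj _ _ _ Posz absz) => //.
    by case=> n; [left; rewrite inE|right; rewrite mul0r].
  exact: poch_sum.
exists e => [r r0|y _]; last by rewrite /lsum (csumE (E y)).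
apply: abs_bounded_int; first exact: euler_coef_bounded.
by exists 0 => A; rewrite big1 // => i _; rewrite mul0r normr0.
Qed.

End QSeries.

(** * The Jacobi triple product and the zeros of theta *)

Section Theta.
Variable C : sum_field.
Variable p : C.
Hypothesis p01 : 0 < `|p| < 1.

Local Notation tcoef := (theta_coef p).
Local Notation poch := (poch p).
Local Notation euler_inv := (euler_inv p).
Local Notation theta := (theta p).

Let p1 : `|p| < 1. Proof. by case/andP: p01. Qed.
Let p0 : p != 0. Proof. by rewrite -normr_gt0; case/andP: p01. Qed.
Let q0 : 0 < 1 - `|p|. Proof. by rewrite subr_gt0. Qed.

Lemma poch_near1 x : exists N, forall n, (N <= n)%N -> `|poch (p ^+ n * x) - 1| < 2^-1.
Proof.
have r0 : 0 < `|x| + 1 by rewrite ltr_wpDl.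
have [M M0 hM] := poch_near0 p01 r0.
have [|N hN] := @pow_small C p (2^-1 / (M * (`|x| + 1))) p1.
  by rewrite divr_gt0 ?invr_gt0 ?mulr_gt0.
exists N => n nN; have hx : `|p ^+ n * x| <= `|x| + 1.
  by apply: le_trans (normr_pXn_le p01 n x) _; rewrite lerDl.
apply: le_lt_trans (hM _ hx) _; have := hN n nN; rewrite ltr_pdivlMr ?mulr_gt0 //.
apply: le_lt_trans; rewrite normrM normrX mulrCA ler_wpM2l ?exprn_ge0 //.
by rewrite ler_wpM2l ?(ltW M0) // lerDl.
Qed.

Lemma poch_tail_ge x : exists N, forall n, (N <= n)%N -> 2^-1 <= `|poch (p ^+ n * x)|.
Proof.
have [N hN] := poch_near1 x; exists N => n /hN h.
have := lerB_dist 1 (1 - poch (p ^+ n * x)); rewrite subKr normr1 distrC.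
apply: le_trans; rewrite lerBrDr -lerBrDl; apply: le_trans (ltW h) _.
by rewrite [X in _ <= X - _](splitr 1) mul1r addrK.
Qed.

Lemma poch_neq0 x : (forall k : nat, p ^+ k * x != 1) -> poch x != 0.
Proof.
move=> hx; have [N /(_ N (leqnn N)) h] := poch_tail_ge x.
rewrite (poch_iter p01 N) mulf_neq0 //; last first.
  by rewrite -normr_gt0; apply: lt_le_trans h; rewrite invr_gt0.
elim: N {h} => [|n IH]; first by rewrite big_geq // oner_eq0.
by rewrite big_nat_recr //= mulf_neq0 // subr_eq0 eq_sym.
Qed.

Lemma poch_conv x e : 0 < e -> exists N, forall n, (N <= n)%N ->
  `|poch x - \prod_(0 <= k < n) (1 - p ^+ k * x)| < e.
Proof.
move=> e0; have r0 : 0 < `|x| + 1 by rewrite ltr_wpDl.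
have [M M0 hM] := poch_near0 p01 r0; have [N1 hN1] := poch_tail_ge x.
have K0 : 0 < `|poch x| * 2 * M * (`|x| + 1) + 1.
  by rewrite ltr_wpDl // !mulr_ge0 // ?ltW.
have [N2 hN2] := pow_small p1 (divr_gt0 e0 K0).
exists (maxn N1 N2) => n; rewrite geq_max => /andP[/hN1 h1 /hN2 h2].
set w := p ^+ n * x in h1 *; have E := poch_iter p01 n x.
set P := \prod_(0 <= k < n) _ in E *; rewrite E -/w.
have hw : `|w| <= `|x| + 1 by apply: le_trans (normr_pXn_le p01 n x) _; rewrite lerDl.
have -> : P * poch w - P = P * (poch w - 1) by ring.
have hP : `|P| <= `|poch x| * 2.
  rewrite E -/w normrM -mulrA ler_peMr // -ler_pdivrMr ?ltr0n // mul1r.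
  exact: h1.
rewrite normrM; apply: le_lt_trans (ler_pM _ _ hP (hM w hw)) _ => //.
move: h2; rewrite ltr_pdivlMr //; apply: le_lt_trans.
rewrite [leRHS]mulrDr mulr1 ler_wpDr ?exprn_ge0 //.
rewrite /w normrM normrX.
have -> : `|poch x| * 2 * (M * (`|p| ^+ n * `|x|)) = `|p| ^+ n * (`|poch x| * 2 * M * `|x|) by ring.
by rewrite ler_wpM2l ?exprn_ge0 // ler_wpM2l ?lerDl // !mulr_ge0 // ltW.
Qed.

Lemma poch1 : poch 1 = 0.
Proof. by rewrite poch_eq // subrr mul0r. Qed.

Lemma poch_pN (k : nat) : poch (p ^ (- Posz k)) = 0.
Proof.
elim: k => [|k IH]; first by rewrite oppr0 expr0z poch1.
rewrite poch_eq // (_ : p * p ^ (- Posz k.+1) = p ^ (- Posz k)) ?IH ?mulr0 //.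
by rewrite -[X in X * _]expr1z -expfzDr //; congr (_ ^ _); lia.
Qed.

Lemma poch_p (k : nat) : poch (p ^+ k.+1) = poch p / fin_poch p k.
Proof.
elim: k => [|k IH]; first by rewrite expr1 fin_poch0 divr1.
have := poch_eq p01 (p ^+ k.+1); rewrite IH -exprS fin_pochS => /eqP h.
apply/eqP; move: h; rewrite -subr_eq0 => /eqP h; rewrite -subr_eq0; apply/eqP.
have f0 := fin_poch_neq0 p01 k; have g0 := sub1_expr_neq0 p01 k.
apply: (mulfI g0); rewrite mulr0 -[RHS]oppr0 -h; field.
by rewrite f0 g0.
Qed.

Definition jprod (x : C) : C := poch x * poch (p / x) * poch p.

(** In [theta x * euler_inv (p / x)] the coefficient of [x ^ n] is [tcoef n * poch (p ^ (n + 1))],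
    by Euler's expansion of [poch]. It vanishes for [n < 0], and for [n >= 0] it is
    [poch p * euler_coef p n], so Euler's expansion again gives [poch p * poch x]. *)
Lemma theta_large x : `|p / x| < 1 - `|p| -> x != 0 -> theta x = jprod x.
Proof.
move=> hpx x0; have hE := euler_inv_bounded p01 hpx.
suff h : theta x * euler_inv (p / x) = poch p * poch x.
  have := euler_inv_poch p01 hpx; rewrite /jprod => h2.
  rewrite -[LHS]mulr1 -h2 mulrCA h; ring.
have hth := laurent_bounded (laurent_tcoef p01) x0.
have hs := csum_mul hth hE.
pose phi (k : int * nat) := (k.1 + Posz k.2, k.2); pose psi (k : int * nat) := (k.1 - Posz k.2, k.2).
have phiK : cancel phi psi by case=> a b; rewrite /phi /psi /= addrK.
have psiK : cancel psi phi by case=> a b; rewrite /phi /psi /= subrK.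
have {}hs := has_sum_reindex phiK psiK hs.
have hab : abs_bounded ((fun k : int * nat => tcoef k.1 * x ^ k.1 * ((p / x) ^+ k.2 / fin_poch p k.2)) \o phi).
  exact: (abs_bounded_inj (can_inj phiK) (abs_bounded_mul hth hE)).
have h1 := csum_pair hab; rewrite (csumE hs) in h1.
apply: (has_sum_unique h1).
have h2 : has_sum (fun n : nat => poch p * (euler_coef p n * x ^+ n)) (poch p * poch x).
  exact/has_sumZ/poch_sum.
apply: (@has_sum_inj _ _ _ Posz absz) => //.
  case=> n; [by left; rewrite inE|right].
  apply: csumE; rewrite -(mulr0 (tcoef (Negz n) * x ^ Negz n)) -(poch_pN n).
  apply: eq_has_sum (has_sumZ _ (poch_sum p01 _)) => m /=.
  rewrite /phi /= tcoefD // expfzDr // -exprnP expr_div_n /euler_coef.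
  rewrite NegzE (_ : p ^ (- Posz n.+1 * Posz m) = (p ^ (- Posz n)) ^+ m / p ^+ m).
    by field; rewrite fin_poch_neq0 // !expf_neq0.
  rewrite exprnP exprz_exp [p ^+ m]exprnP -[X in _ = _ / X]exprnP exprnN.
  by rewrite -expfzDr //; congr (_ ^ _); rewrite -addn1 PoszD; ring.
apply: eq_has_sum h2 => n /=.
rewrite (_ : poch p * (euler_coef p n * x ^+ n) = tcoef n * x ^+ n * poch (p ^+ n.+1)); last first.
  by rewrite poch_p /euler_coef; field; rewrite fin_poch_neq0.
apply/esym/csumE; apply: eq_has_sum (has_sumZ _ (poch_sum p01 _)) => m /=.
rewrite /phi /= tcoefD // expfzDr // -!exprnP expr_div_n /euler_coef.
by rewrite exprM exprS exprMn; field; rewrite fin_poch_neq0 // !expf_neq0.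
Qed.

Lemma laurent_fun_jprod : laurent_fun jprod.
Proof.
have h1 := laurent_fun_poch p01.
have h2 : laurent_fun (fun x => poch (p / x)).
  by have := laurent_fun_inv (laurent_fun_scale p0 h1).
have h3 := laurent_funZ (poch p) (laurent_funM h1 h2).
by apply: laurent_fun_ext h3 => x _; rewrite /jprod mulrC.
Qed.

Lemma thetaE x : x != 0 -> theta x = jprod x.
Proof.
(* Large enough that [|p / y| < 1 - |p|] on the circle [|y| = r]. *)
pose r := `|p| / (1 - `|p|) + 1.
have r0 : 0 < r by rewrite ltr_wpDl // divr_ge0 // ltW.
apply: (laurent_fun_eq (laurent_fun_theta p01) laurent_fun_jprod r0) => y yr.
have y0 : y != 0 by rewrite -normr_gt0 yr.
apply: theta_large y0; rewrite normrM normfV yr ltr_pdivrMr //.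
by rewrite /r mulrDr mulr1 mulrCA divff ?gt_eqF // mulr1 ltrDl.
Qed.

Lemma theta_p x : x != 0 -> theta (p * x) = - x^-1 * theta x.
Proof.
move=> x0; rewrite !thetaE ?mulf_neq0 // /jprod.
have -> : p / (p * x) = x^-1 by rewrite invfM mulrA divff ?mul1r.
rewrite [poch x]poch_eq // [poch x^-1]poch_eq //.
by field.
Qed.

Lemma theta1 : theta 1 = 0.
Proof. by rewrite thetaE ?oner_eq0 // /jprod poch1 !mul0r. Qed.

(** By the product formula a zero is a power of [p], and the modulus of [x] lies strictly between
    consecutive ones. *)
Lemma theta_neq0 (x : C) k : `|p| ^ (k + 1) < `|x| < `|p| ^ k -> theta x != 0.
Proof.
have pp : 0 < `|p| by rewrite normr_gt0.
have mono (a b : int) : a <= b -> `|p| ^ b <= `|p| ^ a.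
  move=> ab; have [n ->] : exists n : nat, b = a + Posz n by exists `|b - a|%N; lia.
  rewrite expfzDr ?gt_eqF // ler_piMr ?exprz_ge0 // -exprnP exprn_ile1 //; exact: ltW.
have noteq (n : int) : `|p| ^ (k + 1) < `|x| < `|p| ^ k -> x != p ^ n.
  move=> /andP[h1 h2]; apply/eqP => xn; move: h1 h2; rewrite xn normr_expz.
  case: (lerP n k) => [/mono h|nk] h1 h2; first by have := le_lt_trans h h2; rewrite ltxx.
  have /mono h : k + 1 <= n by lia.
  by have := le_lt_trans h h1; rewrite ltxx.
move=> hx; have x0 : x != 0.
  by rewrite -normr_gt0; case/andP: hx => h _; apply: lt_trans h; rewrite exprz_gt0.
rewrite (thetaE x0) /jprod !mulf_neq0 //; apply: poch_neq0 => n.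
- apply: contraTneq hx => h; apply/negP => /noteq => /(_ (- Posz n)).
  by rewrite -exprnN -[x](mulKf (expf_neq0 n p0)) h mulr1 eqxx.
- apply: contraTneq hx => h; apply/negP => /noteq => /(_ (Posz n.+1)).
  rewrite -exprnP; move: h; rewrite mulrA -exprSr => /(canRL (mulfVK x0)) ->.
  by rewrite mul1r eqxx.
- by rewrite -exprSr; have := sub1_expr_neq0 p01 n; rewrite subr_eq0 eq_sym.
Qed.

End Theta.

(** * Theta divided by one of its linear factors *)

Section Kernel.
Variable C : sum_field.
Variable p : C.
Hypothesis p01 : 0 < `|p| < 1.

Local Notation tcoef := (theta_coef p).
Local Notation poch := (poch p).
Local Notation theta := (theta p).

Let p1 : `|p| < 1. Proof. by case/andP: p01. Qed.
Let p0 : p != 0. Proof. by rewrite -normr_gt0; case/andP: p01. Qed.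
Let pp : 0 < `|p|. Proof. by case/andP: p01. Qed.

Lemma expz_anti (a b : int) : a <= b -> `|p| ^ b <= `|p| ^ a.
Proof.
move=> ab; have [n ->] : exists n : nat, b = a + Posz n by exists `|b - a|%N; lia.
rewrite expfzDr ?gt_eqF // ler_piMr ?exprz_ge0 // -exprnP exprn_ile1 //; exact: ltW.
Qed.

(* The partial sums of [tcoef]: since [tcoef (1 - k) = - tcoef k], they are even in [k],
   so that they can be written with the rapidly decreasing tail on the negative side. *)
Definition scoef (k : int) : C := csum (fun j : nat => tcoef (- Posz `|k| - Posz j)).

Lemma scoef_bound : exists2 M, 0 <= M &
  forall k, abs_bounded (fun j : nat => tcoef (- Posz `|k| - Posz j)) /\
            `|scoef k| <= M * `|p| ^ binz2 (- Posz `|k|).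
Proof.
have inj : injective (fun j : nat => - Posz j) by move=> a b /oppr_inj[].
have [M hM] := abs_bounded_inj inj (laurent_tcoef p01 ltr01).
have M0 : 0 <= M by apply: le_trans (hM fset0); rewrite big_seq_fset0.
exists M => // k; set a := `|k|%N.
have h (A : {fset nat}) :
    \sum_(j <- A) `|tcoef (- Posz a - Posz j)| <= M * `|p| ^ binz2 (- Posz a).
  apply: le_trans (_ : (\sum_(j <- A) `|tcoef (- Posz j)|) * `|p| ^ binz2 (- Posz a) <= _).
    rewrite mulr_suml; apply: ler_sum => j _.
    rewrite !normr_tcoef -expfzDr ?gt_eqF //; apply: expz_anti.
    by rewrite binz2D; lia.
  rewrite ler_wpM2r ?exprz_ge0 //; apply: le_trans (hM A); apply: ler_sum => j _ /=.
  by rewrite exp1rz mulr1.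
have hb : abs_bounded (fun j : nat => tcoef (- Posz a - Posz j)) by exists (M * `|p| ^ binz2 (- Posz a)).
by split=> //; apply: has_sum_norm_le (csumP hb) h.
Qed.

Lemma scoef_rec (a : nat) : scoef (Posz a) = tcoef (- Posz a) + scoef (Posz a.+1).
Proof.
have [M M0 hM] := scoef_bound; have [hb _] := hM (Posz a.+1).
have h := @has_sum_nat_shift C (fun j : nat => tcoef (- Posz a - Posz j)) (scoef (Posz a.+1)).
rewrite /scoef /= -/(scoef _); apply: csumE; rewrite -[X in tcoef X]subr0; apply: h.
apply: eq_has_sum (csumP hb) => j; congr (tcoef _); rewrite /=; lia.
Qed.

Lemma scoefB k : scoef k - scoef (k - 1) = tcoef k.
Proof.
have abs_eq k' : scoef k' = scoef (Posz `|k'|) by [].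
case: (lerP k 0) => hk.
  rewrite (abs_eq k) (abs_eq (k - 1)) (_ : `|k - 1|%N = `|k|.+1); last by lia.
  by rewrite scoef_rec addrK; congr tcoef; lia.
rewrite (abs_eq k) (abs_eq (k - 1)) (_ : `|k|%N = `|k - 1|.+1); last by lia.
rewrite (scoef_rec `|k - 1|) opprD addrCA subrr addr0.
have -> : - Posz `|k - 1| = - k + 1 by lia.
by rewrite tcoefS // opprK tcoefN // -mulrA -expfzDr // subrr expr0z mulr1.
Qed.

(** Dividing [theta y] by [1 - p ^ n * y] gives the coefficient
    [sum_(j <= m) tcoef j * p ^ (n * (m - j))]; putting [j = n + i] and using [tcoefD] leaves the
    partial sum of [tcoef] up to [m - n]. *)
Definition hcoef (n m : int) : C := tcoef n * p ^ (n * (m - n)) * scoef (m - n).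

(** With [k = m - n], the decay exponent [binz2 (- |k|)] of [scoef] dominates both [binz2 k] and
    [binz2 k + k]. The first choice gives a bound uniform in [n], the second gains [|p| ^ (- n)],
    which absorbs coefficients growing like [|p| ^ n] for negative [n]. *)
Lemma hcoef_bound : exists2 M, 0 <= M & forall n m,
  `|hcoef n m| <= M * `|p| ^ binz2 m /\ `|hcoef n m| <= M * `|p| ^ (binz2 m + m - n).
Proof.
have [M M0 hM] := scoef_bound; exists M => // n m.
have E : binz2 m = binz2 n + n * (m - n) + binz2 (m - n).
  by have := binz2D n (m - n); rewrite [n + _]addrC subrK => ->; ring.
have H d : d <= binz2 (- Posz `|m - n|) -> `|hcoef n m| <= M * `|p| ^ (binz2 n + n * (m - n) + d).
  move=> hd; rewrite /hcoef normrM [ `|tcoef n * _|]normrM normr_tcoef normr_expz -expfzDr ?gt_eqF //.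
  rewrite [leRHS]mulrC [in leRHS]expfzDr ?gt_eqF // -mulrA ler_wpM2l ?exprz_ge0 // [leRHS]mulrC.
  apply: le_trans (proj2 (hM _)) _; rewrite ler_wpM2l //; exact: expz_anti.
have {}E2 : binz2 m + m - n = binz2 n + n * (m - n) + (binz2 (m - n) + (m - n)) by rewrite E; ring.
split; first rewrite E; last rewrite E2; apply: H; rewrite ?E ?E2.
- case: (lerP 0 (m - n)) => h; last by rewrite (_ : - Posz `|m - n| = m - n) //; lia.
  by rewrite (_ : - Posz `|m - n| = - (m - n)) ?binz2N; lia.
- case: (lerP 0 (m - n)) => h; last by rewrite (_ : - Posz `|m - n| = m - n) //; lia.
  by rewrite (_ : - Posz `|m - n| = - (m - n)) ?binz2N; lia.
Qed.

(* [hfun n y] is the entire extension of [theta y / (1 - p ^ n * y)]. *)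
Definition hfun (n : int) (y : C) : C := lsum (hcoef n) y.

Lemma laurent_hcoef n : laurent (hcoef n).
Proof.
have [M M0 hM] := hcoef_bound => r r0; have := abs_boundedZ M (laurent_tcoef p01 r0).
apply: abs_bounded_le => m; have [h _] := hM n m; move: (hcoef n m) h => g h.
by rewrite !normrM mulrA ler_wpM2r // normr_tcoef (ger0_norm M0).
Qed.

Lemma hfun_mul n y : y != 0 -> (1 - p ^ n * y) * hfun n y = theta y.
Proof.
move=> y0; have h := laurent_sum (laurent_hcoef n) y0.
have h2 : has_sum (fun m => p ^ n * hcoef n (m - 1) * y ^ m) (p ^ n * y * hfun n y).
  have := has_sum_reindex (phi := fun m => m - 1) (psi := fun m => m + 1) _ _ (has_sumZ (p ^ n * y) h).
  move=> /(_ (fun m => subrK 1 m) (fun m => addrK 1 m)).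
  apply: eq_has_sum => m /=; rewrite expfzDr // exprN1; field; exact: y0.
have h3 := has_sumB h h2; rewrite mulrBl mul1r.
apply: has_sum_unique h3 _; apply: eq_has_sum (theta_sum p01 y0) => m.
rewrite -mulrBl; congr (_ * _); rewrite /hcoef -[m in LHS](subrK n) [in LHS]addrC tcoefD // -(scoefB (m - n)).
have -> : m - 1 - n = m - n - 1 by ring.
have -> : n * (m - n - 1) = n * (m - n) - n by ring.
rewrite expfzDr // -invr_expz; field; exact: expfz_neq0.
Qed.

(** The two growth regimes allowed for [c] are those matched by the two bounds of [hcoef_bound]. *)
Lemma hfun_sum (I : choiceType) (c b : I -> C) (nn : I -> int) : abs_bounded b ->
  (forall i, `|c i| <= `|b i| \/ `|c i| <= `|b i| * `|p| ^ nn i) ->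
  (forall y, y != 0 -> abs_bounded (fun i => c i * hfun (nn i) y)) /\
  laurent_fun (fun y => csum (fun i => c i * hfun (nn i) y)).
Proof.
move=> hb hc; have [M M0 hM] := hcoef_bound.
pose a i m := c i * hcoef (nn i) m.
have aE i y : y != 0 -> lsum (a i) y = c i * hfun (nn i) y.
  move=> y0; apply: csumE; apply: eq_has_sum (has_sumZ (c i) (laurent_sum (laurent_hcoef (nn i)) y0)) => m.
  by rewrite /a mulrA.
have ha (r : C) : 0 < r -> abs_bounded (fun k : I * int => a k.1 k.2 * r ^ k.2).
  move=> r0; have pr : 0 < `|p| * r by rewrite mulr_gt0.
  have hg : abs_bounded (fun m : int => M * (`|tcoef m * r ^ m| + `|tcoef m * (`|p| * r) ^ m|)).
    by apply/abs_boundedZ/abs_boundedD; apply/abs_bounded_norm/laurent_tcoef.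
  apply: abs_bounded_le (abs_bounded_mul hb hg) => -[i m]; rewrite /a /=.
  have [h1 h2] := hM (nn i) m; move: (hcoef (nn i) m) h1 h2 => g h1 h2.
  rewrite [leRHS]normrM [ `|M * _|]ger0_norm ?mulr_ge0 ?addr_ge0 //.
  rewrite !normrM !normr_tcoef !normr_expz (gtr0_norm r0) (gtr0_norm pr).
  have rm : 0 <= r ^ m by rewrite exprz_ge0 // ltW.
  have e1 : 0 <= `|p| ^ binz2 m by rewrite exprz_ge0.
  have e2 : 0 <= (`|p| * r) ^ m by rewrite exprz_ge0 // ltW.
  case: (hc i) => h.
    apply: le_trans (_ : `|b i| * (M * `|p| ^ binz2 m) * r ^ m <= _).
      by rewrite ler_wpM2r // ler_pM.
    rewrite -!mulrA ler_wpM2l // ler_wpM2l // lerDl.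
    by rewrite mulr_ge0.
  apply: le_trans (_ : `|b i| * `|p| ^ nn i * (M * `|p| ^ (binz2 m + m - nn i)) * r ^ m <= _).
    by rewrite ler_wpM2r // ler_pM.
  rewrite -!mulrA ler_wpM2l // mulrCA ler_wpM2l //.
  rewrite mulrA -expfzDr ?gt_eqF // (_ : nn i + _ = binz2 m + m); last by ring.
  by rewrite expfzDr ?gt_eqF // -mulrA -expfzMl lerDr mulr_ge0.
have [h1 h2] := laurent_fun_sum ha; split; last first.
  by apply: laurent_fun_ext h2 => y y0; apply: eq_csum => i; rewrite aE.
move=> y y0; have h := abs_bounded_csum (I := I) (J := int) (F := fun k => a k.1 k.2 * y ^ k.2) _.
have {}h := h _; apply: abs_bounded_le (h _) => [i|].
  by rewrite /= -aE.
have := ha `|y|; rewrite normr_gt0 y0 => /(_ isT).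
by apply: abs_bounded_le => n; rewrite !normrM !normr_expz normr_id.
Qed.

Lemma hfun_n1 n : n != 0 -> hfun n 1 = 0.
Proof.
move=> n0; have := hfun_mul n (oner_neq0 C); rewrite mulr1 theta1 //.
move/eqP; rewrite mulf_eq0 => /orP[|/eqP //]; rewrite subr_eq0 eq_sym => /eqP pn.
have hn1 : `|p| ^ n = 1 by rewrite -normr_expz pn normr1.
case: (ltrP n 0) => hn.
  have : `|p| ^ (-1) <= `|p| ^ n by apply: expz_anti; lia.
  by rewrite hn1 exprN1 invf_le1 // => /(lt_le_trans p1); rewrite ltxx.
have : `|p| ^ n <= `|p| ^ 1 by apply: expz_anti; lia.
by rewrite hn1 expr1z => /(lt_le_trans p1); rewrite ltxx.
Qed.

(** The triple product without its factor [1 - y] agrees with [hfun 0] on the circle of radius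
    [1 / 2], hence also at [1]. Together with [hfun_n1] it evaluates a series of [hfun] at [1] by
    one term, which is the residue computation. *)
Lemma hfun01 : hfun 0 1 = poch p ^+ 3.
Proof.
pose Q y := poch (p * y) * poch (p * y^-1) * poch p.
have hQ : laurent_fun Q.
  have h := laurent_funM (laurent_fun_scale p0 (laurent_fun_poch p01))
     (laurent_fun_inv (laurent_fun_scale p0 (laurent_fun_poch p01))).
  by apply: laurent_fun_ext (laurent_funZ (poch p) h) => y _; rewrite mulrC.
have hh : laurent_fun (hfun 0) by exists (hcoef 0) => //; exact: laurent_hcoef.
have r0 : 0 < 2^-1 :> C by rewrite invr_gt0.
rewrite (laurent_fun_eq hh hQ r0) ?oner_neq0 //; first by rewrite /Q mulr1 invr1 mulr1 !exprS expr0 mulr1 mulrA.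
move=> y yr; have y0 : y != 0 by rewrite -normr_gt0 yr.
have y1 : 1 - y != 0.
  apply/eqP => /eqP; rewrite subr_eq0 => /eqP e.
  have : 2^-1 < 1 :> C by rewrite invf_lt1 ?ltr1n.
  by rewrite -yr -e normr1 ltxx.
apply: (mulfI y1); have := hfun_mul 0 y0; rewrite expr0z mul1r => ->.
rewrite thetaE // /jprod [poch y]poch_eq // /Q.
by rewrite !mulrA.
Qed.

End Kernel.

(** * Quasi-periodic functions of degree one and two *)

Section ThetaDegree.
Variable C : sum_field.

Lemma int_const (T : Type) (g : int -> T) : (forall n, g (n + 1) = g n) -> forall n, g n = g 0.
Proof.
move=> h; case=> n; first by elim: n => // n <-; rewrite -[RHS]h; congr g; lia.
elim: n => [|n IH]; first by rewrite -(h (Negz 0)).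
by rewrite -IH -(h (Negz n.+1)); congr g; lia.
Qed.

Lemma int_rec_solve (e : int -> C) (a P : C) : a != 0 -> P != 0 ->
  (forall n, e (n + 1) = a * P ^ n * e n) -> forall n, e n = a ^ n * P ^ binz2 n * e 0.
Proof.
move=> a0 P0 h n.
have := @int_const C (fun n => e n / (a ^ n * P ^ binz2 n)) _ n.
rewrite expr0z binz20 expr0z mulr1 divr1 => <- => [|m].
  by rewrite mulrC mulfVK // mulf_neq0 ?expfz_neq0.
rewrite h binz2S !expfzDr // expr1z; field.
by rewrite a0 !expfz_neq0.
Qed.

Lemma has_sum_parity (F : int -> C) A B :
  has_sum (fun k => F (2 * k)) A -> has_sum (fun k => F (2 * k + 1)) B -> has_sum F (A + B).
Proof.
move=> hA hB.
have div2 k : ((2 * k + 1) %/ 2)%Z = k /\ ((2 * k) %/ 2)%Z = k.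
  by rewrite [2 * k]mulrC divzMDl // mulzK // addr0.
have par n : n = 2 * (n %/ 2)%Z \/ n = 2 * (n %/ 2)%Z + 1.
  have := divz_eq n 2; have := modz_ge0 n (isT : 2 != 0 :> int); have := @ltz_pmod n 2 isT; lia.
pose Fe n := if n == 2 * (n %/ 2)%Z then F n else 0.
pose Fo n := if n == 2 * (n %/ 2)%Z then 0 else F n.
have he : has_sum Fe A.
  apply: (@has_sum_inj C _ _ (fun k => 2 * k) (fun n => (n %/ 2)%Z)) => [k|n|].
  - exact: (proj2 (div2 k)).
  - by rewrite inE /= /Fe eq_sym; case: eqP => _; [left|right].
  by apply: eq_has_sum hA => k; rewrite /= /Fe (proj2 (div2 k)) eqxx.
have ho : has_sum Fo B.
  apply: (@has_sum_inj C _ _ (fun k => 2 * k + 1) (fun n => (n %/ 2)%Z)) => [k|n|].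
  - exact: (proj1 (div2 k)).
  - rewrite inE /= /Fo; case: (n =P 2 * (n %/ 2)%Z) => h; first by right.
    by left; apply/eqP; case: (par n) => [/h|e].
  apply: eq_has_sum hB => k; rewrite /= /Fo (proj1 (div2 k)).
  by case: eqP => // h; lia.
apply: eq_has_sum (has_sumD he ho) => n; rewrite /Fe /Fo.
by case: eqP; rewrite ?addr0 ?add0r.
Qed.

Variable p : C.
Hypothesis p01 : 0 < `|p| < 1.
Let p0 : p != 0. Proof. by rewrite -normr_gt0; case/andP: p01. Qed.

(** Both sides of the functional equation have Laurent expansions, so their equality on one circle
    already equates coefficients. *)
Lemma quasi_periodic_coef (f : C -> C) (e : int -> C) (c r : C) (d : int) : c != 0 -> 0 < r ->
  laurent e -> (forall y, y != 0 -> f y = lsum e y) ->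
  (forall y, `|y| = r -> f (p * y) = c * y ^ (- d) * f y) ->
  forall n, e (n + d) = c^-1 * p ^ n * e n.
Proof.
move=> c0 r0 he ef hf n.
pose g n := c * e (n + d) - p ^ n * e n.
have hg1 : forall y, y != 0 ->
    has_sum (fun n => g n * y ^ n) (c * y ^ (- d) * f y - f (p * y)).
  move=> y y0; have h1 := has_sumZ (c * y ^ (- d)) (laurent_sum he y0).
  have h2 := laurent_sum he (mulf_neq0 p0 y0); rewrite -ef ?mulf_neq0 // in h2; rewrite -ef // in h1.
  have h3 := has_sum_reindex (phi := fun n => n + d) (psi := fun n => n - d) (fun m => addrK d m) (fun m => subrK d m) h1.
  apply: eq_has_sum (has_sumB h3 h2) => m /=; rewrite /g expfzDr // -invr_expz expfzMl.
  by field; rewrite expfz_neq0.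
have hg : laurent g.
  move=> s s0; have sn : s != 0 by rewrite gt_eqF.
  have h1 := abs_boundedZ (c * s ^ (- d)) (laurent_bounded he sn).
  have h2 := abs_boundedZ (-1) (laurent_bounded he (mulf_neq0 p0 sn)).
  have h3 := abs_bounded_inj (phi := fun n => n + d) (@addIr _ d) h1.
  apply: abs_bounded_le (abs_boundedD h3 h2) => m /=.
  rewrite (_ : g m * s ^ m = c * s ^ (- d) * (e (m + d) * s ^ (m + d)) + -1 * (e m * (p * s) ^ m)) //.
  rewrite /g expfzDr // -invr_expz expfzMl; field.
  by rewrite expfz_neq0.
have : g n = 0.
  apply: (laurent_uniq hg r0) => y yr; have y0 : y != 0 by rewrite -normr_gt0 yr.
  by rewrite /lsum (csumE (hg1 y y0)) hf // subrr.
move/eqP; rewrite subr_eq0 => /eqP h; apply: (mulfI c0).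
by rewrite h !mulrA divff // mul1r.
Qed.

Lemma theta_degree1 (f : C -> C) (c r : C) : c != 0 -> 0 < r -> laurent_fun f ->
  (forall y, `|y| = r -> f (p * y) = c * y^-1 * f y) ->
  exists K, forall y, y != 0 -> f y = K * theta p (- (y / c)).
Proof.
move=> c0 r0 [e he ef] hf.
have h : forall n, e (n + 1) = c^-1 * p ^ n * e n.
  by apply: (@quasi_periodic_coef f e c r 1) => // y /hf; rewrite exprN1.
have cV : c^-1 != 0 by rewrite invr_eq0.
have {}h := int_rec_solve cV p0 h; exists (e 0) => y y0; rewrite ef //.
have yc : - (y / c) != 0 by rewrite oppr_eq0 mulf_neq0.
apply: csumE; apply: eq_has_sum (has_sumZ (e 0) (theta_sum p01 yc)) => n.
rewrite (h n) tcoefE -(mulN1r (y / c)) !expfzMl; set s := (-1) ^ n.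
have ss : s * s = 1 by rewrite /s -expfzMl mulrN1 opprK exp1rz.
by transitivity (s * s * (e 0 * p ^ binz2 n * y ^ n * c^-1 ^ n)); [ring|rewrite ss; ring].
Qed.

(** The recursion links exponents of equal parity only, so [e 0] and [e 1] are the two free
    parameters; each parity class sums to a theta function of base [p ^+ 2]. *)
Lemma theta_degree2 (f : C -> C) (c r : C) : c != 0 -> 0 < r -> laurent_fun f ->
  (forall y, `|y| = r -> f (p * y) = c * y ^- 2 * f y) ->
  exists K0 K1, forall y, y != 0 ->
    f y = K0 * theta (p ^+ 2) (- (y ^+ 2 / c)) + K1 * y * theta (p ^+ 2) (- (p * y ^+ 2 / c)).
Proof.
move=> c0 r0 [e he ef] hf.
have h : forall n, e (n + 2) = c^-1 * p ^ n * e n.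
  by apply: (@quasi_periodic_coef f e c r 2) => // y /hf; rewrite exprnN.
have cV : c^-1 != 0 by rewrite invr_eq0.
have P0 : p ^+ 2 != 0 by rewrite expf_neq0.
have pc0 : c^-1 * p != 0 by rewrite mulf_neq0.
have P01 : 0 < `|p ^+ 2| < 1.
  by case/andP: p01 => a b; rewrite normrX exprn_gt0 //= exprn_ilt1.
have P2 (k : int) : p ^ (2 * k) = (p ^+ 2) ^ k by rewrite -exprz_exp.
have he0 := @int_rec_solve (fun k => e (2 * k)) _ _ cV P0.
have he1 := @int_rec_solve (fun k => e (2 * k + 1)) _ _ pc0 P0.
have {}he0 k : e (2 * k) = c^-1 ^ k * (p ^+ 2) ^ binz2 k * e 0.
  by rewrite he0 ?mulr0 // => n; rewrite mulrDr mulr1 h P2.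
have {}he1 k : e (2 * k + 1) = (c^-1 * p) ^ k * (p ^+ 2) ^ binz2 k * e 1.
  rewrite he1 ?mulr0 ?add0r // => n.
  have -> : 2 * (n + 1) + 1 = (2 * n + 1) + 2 by ring.
  by rewrite h expfzDr // expr1z P2; ring.
exists (e 0), (e 1) => y y0; rewrite ef //; apply: csumE.
have y2 : y ^+ 2 != 0 by rewrite expf_neq0.
have yc : - (y ^+ 2 / c) != 0 by rewrite oppr_eq0 mulf_neq0.
have yd : - (p * y ^+ 2 / c) != 0 by rewrite oppr_eq0 !mulf_neq0.
have Y2 (k : int) : y ^ (2 * k) = (y ^+ 2) ^ k by rewrite -exprz_exp.
apply: has_sum_parity.
  apply: eq_has_sum (has_sumZ (e 0) (theta_sum P01 yc)) => n.
  rewrite he0 Y2 tcoefE -(mulN1r (y ^+ 2 / c)) (expfzMl (-1)) (expfzMl (y ^+ 2)); set s := (-1) ^ n.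
  have ss : s * s = 1 by rewrite /s -expfzMl mulrN1 opprK exp1rz.
  transitivity (s * s * (e 0 * (p ^+ 2) ^ binz2 n * (y ^+ 2) ^ n * c^-1 ^ n)); [ring|rewrite ss; ring].
apply: eq_has_sum (has_sumZ (e 1 * y) (theta_sum P01 yd)) => n.
rewrite he1 expfzDr // Y2 expr1z tcoefE -(mulN1r (p * y ^+ 2 / c)) (expfzMl (-1)) (expfzMl (p * y ^+ 2)) (expfzMl p (y ^+ 2)) (expfzMl c^-1); set s := (-1) ^ n.
have ss : s * s = 1 by rewrite /s -expfzMl mulrN1 opprK exp1rz.
transitivity (s * s * (e 1 * y * (p ^+ 2) ^ binz2 n * (y ^+ 2) ^ n * p ^ n * c^-1 ^ n)); [ring|rewrite ss; ring].
Qed.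

End ThetaDegree.

(** * Kronecker's identity and Appell-Lerch sums *)

Section Kronecker.
Variable C : sum_field.
Variable p : C.
Hypothesis p01 : 0 < `|p| < 1.

Local Notation tcoef := (theta_coef p).
Local Notation poch := (poch p).
Local Notation theta := (theta p).
Local Notation hfun := (hfun p).

Let p1 : `|p| < 1. Proof. by case/andP: p01. Qed.
Let p0 : p != 0. Proof. by rewrite -normr_gt0; case/andP: p01. Qed.
Let pp : 0 < `|p|. Proof. by case/andP: p01. Qed.

(** A summable majorant on the annulus: [|a ^ n|] is [weight a n] for [n >= 0] and
    [weight a n * |p| ^ n] for [n < 0], the two regimes of [hfun_sum]. *)
Definition weight (a : C) (n : int) : C :=
  if 0 <= n then `|a| ^+ `|n| else (`|p| / `|a|) ^+ `|n|.

Lemma weight_bounded a : `|p| < `|a| < 1 -> abs_bounded (weight a).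
Proof.
case/andP=> pa a1; apply: abs_bounded_int => /=.
  by apply: abs_bounded_geo; rewrite normr_id.
have r1 : `|(`|p| / `|a|)| < 1.
  have a0 : 0 < `|a| := lt_trans pp pa.
  by rewrite ger0_norm ?divr_ge0 // ltr_pdivrMr // mul1r.
apply: (abs_bounded_inj (phi := succn) _ (abs_bounded_geo r1)); exact: succn_inj.
Qed.

Lemma annulus_neq0 (y : C) : `|p| < `|y| < 1 -> y != 0.
Proof. by case/andP=> h _; rewrite -normr_gt0; apply: lt_trans h. Qed.

Lemma theta_annulus (y : C) : `|p| < `|y| < 1 -> theta y != 0.
Proof. by move=> h; apply: (@theta_neq0 C p p01 y 0); rewrite add0r expr1z expr0z. Qed.

Lemma sub1_neq0 (y : C) n : y != 0 -> theta y != 0 -> 1 - p ^ n * y != 0.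
Proof. by move=> y0; apply: contraNneq => h; rewrite -(hfun_mul p01 n y0) h mul0r. Qed.

Lemma hfunE n (y : C) : y != 0 -> theta y != 0 -> hfun n y = theta y / (1 - p ^ n * y).
Proof.
by move=> y0 ty; rewrite -(hfun_mul p01 n y0) [_ * hfun _ _]mulrC mulfK // sub1_neq0.
Qed.

Lemma hfun_p n (y : C) : y != 0 -> theta y != 0 -> hfun n (p * y) = - y^-1 * hfun (n + 1) y.
Proof.
move=> y0 ty; have py0 : p * y != 0 by rewrite mulf_neq0.
have tpy : theta (p * y) != 0 by rewrite theta_p // mulf_neq0 // oppr_eq0 invr_eq0.
rewrite !hfunE // theta_p // expfzDr // expr1z mulrA.
by rewrite mulrA.
Qed.

(** Shifting [n] shows that the sum is quasi-periodic of degree one in [b], hence a multiple of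
    [theta (a * b)]; at [b = 1] only the term [n = 0] survives and fixes the constant. *)
Lemma kronecker_hfun (a b : C) : `|p| < `|a| < 1 -> b != 0 ->
  has_sum (fun n => a ^ n * hfun n b) (poch p ^+ 3 / theta a * theta (a * b)).
Proof.
move=> ha; have a0 := annulus_neq0 ha; have ta := theta_annulus ha.
have an0 : 0 < `|a| by rewrite normr_gt0.
have [|hb hl] := @hfun_sum C p p01 _ (fun n : int => a ^ n) (weight a) id (weight_bounded ha).
  case=> n; [left|right]; rewrite normr_expz /weight /= normrX; first by rewrite normr_id.
  rewrite ger0_norm ?divr_ge0 // NegzE -!exprnN expr_div_n.
  by rewrite mulrAC divff ?expf_neq0 ?gt_eqF // mul1r.
set G := fun y => _ in hl.
have GE y : y != 0 -> has_sum (fun n => a ^ n * hfun n y) (G y) by move=> /hb/csumP.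
have cn : - a^-1 != 0 by rewrite oppr_eq0 invr_eq0.
have [|K hK] := theta_degree1 p01 cn an0 hl.
- move=> y ya; have hy : `|p| < `|y| < 1 by rewrite ya.
  have y0 := annulus_neq0 hy; have ty := theta_annulus hy.
  apply: has_sum_unique (GE _ (mulf_neq0 p0 y0)) _.
  have := has_sum_reindex (phi := fun n => n + 1) (psi := fun n => n - 1)
    (fun n => addrK 1 n) (fun n => subrK 1 n) (has_sumZ (- a^-1 * y^-1) (GE y y0)).
  apply: eq_has_sum => n /=; rewrite hfun_p // expfzDr // expr1z; field.
  by rewrite a0 y0.
move=> b0; rewrite (_ : _ * theta (a * b) = G b); first exact: GE.
have K1 : K = poch p ^+ 3 / theta a.
  have := hK 1 (oner_neq0 _); have -> : G 1 = poch p ^+ 3.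
    apply: csumE; apply: eq_has_sum (has_sum_delta 0 (poch p ^+ 3)) => n.
    by case: eqP => [->|/eqP n0]; rewrite ?hfun01 // ?hfun_n1 ?mulr0 // expr0z mul1r.
  rewrite mul1r invrN invrK opprK => ->.
  by rewrite mulfK.
by rewrite hK // K1; congr (_ * theta _); field.
Qed.

Lemma kronecker (a b : C) : `|p| < `|a| < 1 -> b != 0 -> theta b != 0 ->
  has_sum (fun n => a ^ n / (1 - p ^ n * b)) (poch p ^+ 3 * theta (a * b) / (theta a * theta b)).
Proof.
move=> ha b0 tb; have ta := theta_annulus ha.
have := has_sumZ (theta b)^-1 (kronecker_hfun ha b0).
rewrite (_ : (theta b)^-1 * _ = poch p ^+ 3 * theta (a * b) / (theta a * theta b)); last first.
  by field; rewrite ta tb.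
apply: eq_has_sum => n; rewrite hfunE //.
by field; rewrite tb sub1_neq0.
Qed.

(* [appell_sum u w / theta (- u)] is Mortenson's [m (- w / u, p, - u)]. *)
Definition appell_sum (u w : C) : C := csum (fun r : int => p ^ binz2 r * u ^ r / (1 - p ^ (r - 1) * w)).

(** This is [theta w * appell_sum u w], continued across the zeros of [theta]. *)
Definition appell_entire (u w : C) : C := csum (fun r : int => p ^ binz2 r * u ^ r * hfun (r - 1) w).

Lemma theta_sumN u : u != 0 -> has_sum (fun r : int => p ^ binz2 r * u ^ r) (theta (- u)).
Proof.
move=> u0; have nu : - u != 0 by rewrite oppr_eq0.
apply: eq_has_sum (theta_sum p01 nu) => n; rewrite tcoefE -(mulN1r u) expfzMl; set s := (-1) ^ n.
have ss : s * s = 1 by rewrite /s -expfzMl mulrN1 opprK exp1rz.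
by transitivity (s * s * (p ^ binz2 n * u ^ n)); [ring|rewrite ss; ring].
Qed.

Lemma appell_coef_bounded u : u != 0 -> abs_bounded (fun r : int => p ^ binz2 r * u ^ r).
Proof.
move=> u0; apply: abs_bounded_le (laurent_bounded (laurent_tcoef p01) u0) => n.
by rewrite [leRHS]normrM normr_tcoef normrM normr_expz.
Qed.

Lemma appell_hfun u : u != 0 ->
  (forall w, w != 0 -> abs_bounded (fun r : int => p ^ binz2 r * u ^ r * hfun (r - 1) w)) /\
  laurent_fun (appell_entire u).
Proof.
move=> u0; apply: (@hfun_sum C p p01 _ _ _ (fun r => r - 1) (appell_coef_bounded u0)).
by move=> r; left.
Qed.

Lemma appell_sumP u w : u != 0 -> w != 0 -> theta w != 0 ->
  abs_bounded (fun r : int => p ^ binz2 r * u ^ r / (1 - p ^ (r - 1) * w)) /\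
  appell_entire u w = theta w * appell_sum u w.
Proof.
move=> u0 w0 tw; have [hb _] := appell_hfun u0.
have E r : p ^ binz2 r * u ^ r / (1 - p ^ (r - 1) * w) =
    (theta w)^-1 * (p ^ binz2 r * u ^ r * hfun (r - 1) w).
  by rewrite hfunE //; field; rewrite tw sub1_neq0.
have B := abs_boundedZ (theta w)^-1 (hb w w0); split; first by under eq_fun do rewrite E.
rewrite /appell_sum (eq_csum E) (csumE (has_sumZ _ (csumP (hb w w0)))).
by rewrite mulrA divff // mul1r.
Qed.

Lemma appell_sum_has u w : u != 0 -> w != 0 -> theta w != 0 ->
  has_sum (fun r : int => p ^ binz2 r * u ^ r / (1 - p ^ (r - 1) * w)) (appell_sum u w).
Proof. by move=> u0 w0 tw; apply: csumP; have [] := appell_sumP u0 w0 tw. Qed.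

Lemma laurent_appell_sum w : w != 0 -> theta w != 0 -> laurent_fun (appell_sum ^~ w).
Proof.
move=> w0 tw; exists (fun r => p ^ binz2 r / (1 - p ^ (r - 1) * w)).
  move=> u u0; have un : u != 0 by rewrite gt_eqF.
  by apply: abs_bounded_le (proj1 (appell_sumP un w0 tw)) => r; rewrite mulrAC.
by move=> u u0; apply: eq_csum => r; rewrite mulrAC.
Qed.

(** The new factor [p ^ r] is [p / w * (1 - (1 - p ^ (r - 1) * w))], and the second part cancels the
    denominator. *)
Lemma appell_sum_pl u w : u != 0 -> w != 0 -> theta w != 0 ->
  appell_sum (p * u) w = p / w * (appell_sum u w - theta (- u)).
Proof.
move=> u0 w0 tw; apply: csumE.
apply: eq_has_sum (has_sumZ (p / w) (has_sumB (appell_sum_has u0 w0 tw) (theta_sumN u0))) => r.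
have h := @sub1_neq0 w (r - 1) w0 tw.
have pr : p ^ r = p ^ (r - 1) * p by rewrite expfzDr // exprN1 mulfVK.
rewrite expfzMl pr; move: (p ^ (r - 1)) h => P h.
by field; rewrite w0 h.
Qed.

(** After a shift of [r] the factor [P^-1] with [P = p ^ r] appears, and [P^-1 / (1 - P * w) = P^-1
    + w / (1 - P * w)]. *)
Lemma appell_sum_pr u w : u != 0 -> w != 0 -> theta w != 0 ->
  appell_sum u (p * w) = theta (- u) + w / u * appell_sum u w.
Proof.
move=> u0 w0 tw; apply: csumE.
have nu : u / p != 0 by rewrite mulf_neq0 ?invr_eq0.
have tu : theta (- u) = p / u * theta (- (u / p)).
  have {1}-> : - u = p * - (u / p) by rewrite mulrN mulrCA divff ?mulr1.
  rewrite theta_p ?oppr_eq0 // invrN opprK; field.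
  by rewrite u0 p0.
have h1 := has_sumZ (p / u) (theta_sumN nu).
have h2 := has_sumZ (w / u) (appell_sum_has u0 w0 tw).
have := has_sum_reindex (phi := fun n => n + 1) (psi := fun n => n - 1)
    (fun n => addrK 1 n) (fun n => subrK 1 n) (has_sumD h1 h2).
rewrite -tu; apply: eq_has_sum => r /=.
have h := @sub1_neq0 w r w0 tw; have P0 := expfz_neq0 r p0.
rewrite addrK binz2S !(expfzDr _ _ p0) !(expfzDr _ _ nu) !(expfzDr _ _ u0) !expr1z exprN1.
rewrite expfzMl exprz_inv -invr_expz; move: (p ^ r) h P0 => P h P0.
field; rewrite u0 p0 P0 h /= ?andbT //.
Qed.

End Kronecker.

(** * Infinite products in bases q and q^2 *)

Section Doubling.
Variable C : sum_field.

Definition tends (u : nat -> C) (v : C) :=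
  forall e, 0 < e -> exists N, forall n, (N <= n)%N -> `|v - u n| < e.

Lemma tends_unique u v w : tends u v -> tends u w -> v = w.
Proof.
move=> hv hw; apply/eqP; rewrite -subr_eq0 -normr_le0; apply/ler_addgt0Pr => e e0.
have e2 : 0 < e / 2 by rewrite divr_gt0.
have [N hN] := hv _ e2; have [M hM] := hw _ e2.
have h1 := hN _ (leq_maxl N M); have h2 := hM _ (leq_maxr N M).
rewrite add0r (splitr e); apply: le_trans (ltW (ltrD h1 h2)).
by rewrite [X in _ <= _ + X]distrC; apply: le_trans (ler_normD _ _); rewrite addrA subrK.
Qed.

Lemma tends_mul u v a b : tends u a -> tends v b -> tends (fun n => u n * v n) (a * b).
Proof.
move=> hu hv e e0; pose k := `|a| + `|b| + 1 + e.
have k0 : 0 < k by rewrite ltr_wpDl // !addr_ge0.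
have d0 : 0 < e / k by rewrite divr_gt0.
have [N hN] := hu _ d0; have [M hM] := hv _ d0.
exists (maxn N M) => n; rewrite geq_max => /andP[/hN h1 /hM h2].
have -> : a * b - u n * v n = a * (b - v n) + (a - u n) * b - (a - u n) * (b - v n) by ring.
apply: le_lt_trans (_ : `|a| * (e / k) + (e / k) * `|b| + (e / k) * 1 < e); last first.
  rewrite mulrC -!mulrDr mulrAC ltr_pdivrMr // ltr_pM2l //.
  by rewrite ltrDl.
apply: le_trans (ler_normB _ _) _; apply: lerD.
  apply: le_trans (ler_normD _ _) _; rewrite !normrM; apply: lerD.
    by rewrite ler_wpM2l // ltW.
  by rewrite ler_wpM2r // ltW.
rewrite normrM ler_pM // ?ltW //; apply: lt_le_trans h2 _.
by rewrite ler_pdivrMr // mul1r lerDr !addr_ge0.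
Qed.

Variable q : C.
Hypothesis q01 : 0 < `|q| < 1.

Lemma sqr01 : 0 < `|q ^+ 2| < 1.
Proof. by case/andP: q01 => a b; rewrite normrX exprn_gt0 //= exprn_ilt1. Qed.

(** The factors with even and with odd powers of [q] are collected separately. *)
Lemma poch_split x : poch q x = poch (q ^+ 2) x * poch (q ^+ 2) (q * x).
Proof.
have h := tends_mul (poch_conv sqr01 x) (poch_conv sqr01 (q * x)).
apply: (@tends_unique _ _ _ _ h) => e e0; have [N hN] := poch_conv q01 x e0.
exists N => n nN; have := hN n.*2 _; rewrite -addnn (leq_trans nN (leq_addr _ _)) => /(_ isT).
congr (`|_ - _| < e); elim: n {nN} => [|n IH]; first by rewrite !big_geq // mulr1.
rewrite addSn addnS !big_nat_recr //= IH.
by rewrite -exprM mul2n -addnn (exprS q (n + n)); ring.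
Qed.

Lemma poch_sqr x : poch (q ^+ 2) (x ^+ 2) = poch q x * poch q (- x).
Proof.
apply: (@tends_unique _ _ _ (poch_conv sqr01 (x ^+ 2))).
have h := tends_mul (poch_conv q01 x) (poch_conv q01 (- x)).
move=> e /h[N hN]; exists N => n /hN; congr (`|_ - _| < e).
rewrite -big_split /=; apply: eq_bigr => k _.
by rewrite -exprM mulnC exprM; ring.
Qed.

End Doubling.

(** * Theta constants and a relation between two Appell-Lerch sums *)

Section Constants.
Variable C : sum_field.
Variable q : C.
Hypothesis q01 : 0 < `|q| < 1.
Local Notation p := (q ^+ 2).
Let p01 : 0 < `|p| < 1 := sqr01 q01.
Let P01 : 0 < `|p ^+ 2| < 1 := sqr01 p01.
Let q0 : q != 0. Proof. by rewrite -normr_gt0; case/andP: q01. Qed.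
Let q1 : `|q| < 1. Proof. by case/andP: q01. Qed.
Local Notation J1 := (poch q q).
Local Notation J2 := (poch p p).
Local Notation J4 := (poch (p ^+ 2) (p ^+ 2)).

Lemma poch_diag_neq0 (s : C) : 0 < `|s| < 1 -> poch s s != 0.
Proof.
move=> s01; apply: (poch_neq0 s01) => k; rewrite -exprSr.
by have := sub1_expr_neq0 s01 k; rewrite subr_eq0 eq_sym.
Qed.

Lemma theta_split x : x != 0 -> theta q x = J1 / J2 ^+ 2 * (theta p x * theta p (q * x)).
Proof.
move=> x0; have J20 := poch_diag_neq0 p01.
rewrite !thetaE ?mulf_neq0 // /jprod (poch_split q01 x) (poch_split q01 (q / x)).
have -> : p / (q * x) = q / x by field; rewrite x0 q0.
have -> : q * (q / x) = p / x by rewrite mulrA.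
by field.
Qed.

Lemma theta_sqr x : x != 0 -> theta (p ^+ 2) (x ^+ 2) = J4 / J2 ^+ 2 * (theta p x * theta p (- x)).
Proof.
move=> x0; have J20 := poch_diag_neq0 p01.
rewrite !thetaE ?expf_neq0 ?oppr_eq0 // /jprod (poch_sqr p01 x).
have -> : p ^+ 2 / x ^+ 2 = (p / x) ^+ 2 by rewrite expr_div_n.
rewrite (poch_sqr p01) (_ : p / - x = - (p / x)); last by rewrite invrN mulrN.
by field.
Qed.

Lemma theta_pN1 : theta p (- 1) = 2 * J4 ^+ 2 / J2.
Proof.
have J20 := poch_diag_neq0 p01.
have hJ4 : J4 = J2 * poch p (- p) by rewrite -poch_sqr.
rewrite thetaE ?oppr_eq0 ?oner_eq0 // /jprod invrN invr1 mulrN1 poch_eq // mulrN1 hJ4.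
by field.
Qed.

(** This is [theta_sqr] at [q], where the triple product evaluates [theta (p ^+ 2) p] to
    [J2 ^+ 2 / J4]. *)
Lemma theta_pq : theta p q * theta p (- q) = J2 ^+ 4 / J4 ^+ 2.
Proof.
have J20 := poch_diag_neq0 p01; have J40 := poch_diag_neq0 P01.
have := theta_sqr q0; rewrite thetaE ?expf_neq0 // /jprod.
have -> : p ^+ 2 / p = p by field; rewrite q0.
have hJ2 : J2 = poch (p ^+ 2) p * J4 by rewrite {1}poch_split // -expr2.
have -> : poch (p ^+ 2) p = J2 / J4 by rewrite hJ2; field; rewrite J40.
move=> h; have -> : theta p q * theta p (- q) = J2 ^+ 2 / J4 * (J4 / J2 ^+ 2 * (theta p q * theta p (- q))).
  by field; rewrite ?J20 ?J40.
by rewrite -h; field; rewrite ?J20 ?J40.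
Qed.

Let pq : `|p| < `|q|.
Proof. by rewrite normrX expr2 gtr_pMr //; case/andP: q01. Qed.

Lemma theta_shift_neq0 (x : C) : `|q| < `|x| < 1 -> theta p (q * x) != 0.
Proof.
case/andP=> a b; apply: (theta_annulus p01).
have qp : 0 < `|q| by rewrite normr_gt0.
rewrite normrX normrM expr2 ltr_pM2l // a /=; apply: lt_trans q1.
by rewrite gtr_pMr.
Qed.

Lemma theta_p_neq0 (x : C) : `|q| < `|x| < 1 -> theta p x != 0.
Proof. by case/andP=> a b; apply: (theta_annulus p01); rewrite (lt_trans pq a). Qed.

Lemma theta_pM_neq0 (x y : C) : `|q| < `|x| < 1 -> `|q| < `|y| < 1 -> theta p (x * y) != 0.
Proof.
case/andP=> a b /andP[c d]; apply: (theta_annulus p01); rewrite normrX normrM expr2.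
have qp : 0 <= `|q| by [].
rewrite ltr_pM //=; apply: lt_trans b; rewrite gtr_pMr //.
exact: le_lt_trans a.
Qed.

(* The case [e = 1] (resp. [-1]) amounts to the equality of the residues in [y] of the two
   sides of the theorem at [y = 1] (resp. [-1]). *)
Lemma appell_pair (e x z : C) : e ^+ 2 = 1 -> `|q| < `|x| < 1 -> `|q| < `|z| < 1 ->
  appell_sum p (e * z) (q * x) / theta p (- (e * z)) + appell_sum p (e * x) (q * z) / theta p (- (e * x))
  = 1 - J2 ^+ 3 * theta p (x * z) * theta p (- (e * q))
        / (theta p (- (e * x)) * theta p (- (e * z)) * theta p (q * x) * theta p (q * z)).
Proof.
move=> e2 hx hz.
have ne : `|e| = 1 by apply/eqP; rewrite -(@pexpr_eq1 _ _ 2) // -normrX e2 normr1.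
have e0 : e != 0 by rewrite -normr_gt0 ne.
have x0 := annulus_neq0 q01 hx; have z0 := annulus_neq0 q01 hz.
have norm_e (w : C) : `|- (e * w)| = `|w| by rewrite normrN normrM ne mul1r.
have tez : theta p (- (e * z)) != 0 by apply: theta_p_neq0; rewrite norm_e.
have tqz := theta_shift_neq0 hz.
have ez0 : e * z != 0 by rewrite mulf_neq0.
have qz0 : q * z != 0 by rewrite mulf_neq0.
(* [N] is the difference of the two sides as a function of [w] in place of [x], times
   [theta p (- (e * w)) * theta p (q * w)]; all poles in [w] are gone. *)
pose N w := theta p (- (e * w)) * appell_entire p (e * z) (q * w) / theta p (- (e * z))
  + theta p (q * w) * appell_sum p (e * w) (q * z) - theta p (- (e * w)) * theta p (q * w)
  + J2 ^+ 3 * theta p (z * w) * theta p (- (e * q)) / (theta p (- (e * z)) * theta p (q * z)).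
have NE w : `|q| < `|w| < 1 -> N w = theta p (- (e * w)) * theta p (q * w) *
   (appell_sum p (e * z) (q * w) / theta p (- (e * z)) + appell_sum p (e * w) (q * z) / theta p (- (e * w)) - 1
   + J2 ^+ 3 * theta p (w * z) * theta p (- (e * q))
        / (theta p (- (e * w)) * theta p (- (e * z)) * theta p (q * w) * theta p (q * z))).
  move=> hw; have w0 := annulus_neq0 q01 hw.
  have tew : theta p (- (e * w)) != 0 by apply: theta_p_neq0; rewrite norm_e.
  have tqw := theta_shift_neq0 hw.
  have qw0 : q * w != 0 by rewrite mulf_neq0.
  rewrite /N (proj2 (appell_sumP p01 ez0 qw0 tqw)) [z * w]mulrC; field.
  by rewrite tez tqz tew tqw.
have lT (a : C) : a != 0 -> laurent_fun (fun w => theta p (a * w)).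
  by move=> a0; exact: laurent_fun_scale a0 (laurent_fun_theta p01).
have ne0 : - e != 0 by rewrite oppr_eq0.
have lTe : laurent_fun (fun w => theta p (- (e * w))).
  by apply: laurent_fun_ext (lT _ ne0) => w _; rewrite mulNr.
have lB : laurent_fun (fun w => appell_entire p (e * z) (q * w)).
  exact: laurent_fun_scale q0 (proj2 (appell_hfun p01 ez0)).
have lA : laurent_fun (fun w => appell_sum p (e * w) (q * z)).
  exact: (laurent_fun_scale e0 (laurent_appell_sum p01 qz0 tqz)).
have lN : laurent_fun N.
  pose c1 := (theta p (- (e * z)))^-1.
  pose c2 := J2 ^+ 3 * theta p (- (e * q)) / (theta p (- (e * z)) * theta p (q * z)).
  have h := laurent_funD (laurent_funB (laurent_funD (laurent_funZ c1 (laurent_funM lTe lB))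
     (laurent_funM (lT _ q0) lA)) (laurent_funM lTe (lT _ q0))) (laurent_funZ c2 (lT _ z0)).
  apply: laurent_fun_ext h => w w0; rewrite /N /c1 /c2; field.
  by rewrite tez tqz.
have cz : - z^-1 != 0 by rewrite oppr_eq0 invr_eq0.
have xr : 0 < `|x| by rewrite normr_gt0.
(* Since [N (p * w) = - (z * w)^-1 * N w], [N w] is a constant multiple of [theta p (z * w)]. *)
have [w wx|K hK] := theta_degree1 p01 cz xr lN.
  have hw : `|q| < `|w| < 1 by rewrite wx.
  have w0 := annulus_neq0 q01 hw; have tqw := theta_shift_neq0 hw.
  have qw0 : q * w != 0 by rewrite mulf_neq0.
  have ew0 : e * w != 0 by rewrite mulf_neq0.
  have p0 : p != 0 by rewrite expf_neq0.
  have pw0 : p * w != 0 by rewrite mulf_neq0.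
  have tew : theta p (- (e * w)) != 0 by apply: theta_p_neq0; rewrite norm_e.
  have E1 : theta p (- (e * (p * w))) = (e * w)^-1 * theta p (- (e * w)).
    have -> : - (e * (p * w)) = p * - (e * w) by ring.
    by rewrite theta_p ?oppr_eq0 // invrN opprK.
  have E2 : theta p (q * (p * w)) = - (q * w)^-1 * theta p (q * w).
    by rewrite mulrCA theta_p.
  have E3 : theta p (z * (p * w)) = - (z * w)^-1 * theta p (z * w).
    by rewrite mulrCA theta_p ?mulf_neq0.
  have E4 : appell_entire p (e * z) (q * (p * w)) =
     - (q * w)^-1 * theta p (q * w) * (theta p (- (e * z)) + q * w / (e * z) * appell_sum p (e * z) (q * w)).
    rewrite -E2 (proj2 (appell_sumP p01 ez0 _ _)) ?E2 ?mulf_neq0 ?oppr_eq0 ?invr_eq0 //.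
    by rewrite [q * (p * w)]mulrCA appell_sum_pr.
  have E5 : appell_sum p (e * (p * w)) (q * z) = p / (q * z) * (appell_sum p (e * w) (q * z) - theta p (- (e * w))).
    by rewrite mulrCA appell_sum_pl.
  rewrite /N E1 E2 E3 E4 E5 (proj2 (appell_sumP p01 ez0 qw0 tqw)).
  have eV : e^-1 = e by apply: (mulfI e0); rewrite divff // -expr2.
  rewrite ![(e * _)^-1]invfM eV.
  field: e2; rewrite ?tez ?tqz ?q0 ?z0 ?w0 ?e0 //.
(* At [w = q^-1] the factor [theta p (q * w)] vanishes and the two remaining terms cancel, while
   [theta p (z / q)] is nonzero. *)
have K0 : K = 0.
  have qV : q^-1 != 0 by rewrite invr_eq0.
  have := hK q^-1 qV; rewrite /N divff // theta1 // !mul0r.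
  have -> : appell_entire p (e * z) 1 = e * z * J2 ^+ 3.
    apply: csumE; apply: eq_has_sum (has_sum_delta 1 (e * z * J2 ^+ 3)) => r.
    case: eqP => [->|/eqP r1]; last by rewrite hfun_n1 ?subr_eq0 ?mulr0.
    by rewrite subrr hfun01 // expr0z mul1r expr1z.
  have E1 : theta p (- (e * q)) = q / e * theta p (- (e / q)).
    have -> : - (e * q) = p * - (e / q) by field.
    rewrite theta_p ?oppr_eq0 ?mulf_neq0 ?invr_eq0 // invrN opprK; congr (_ * _).
    by field; rewrite q0 e0.
  have E2 : theta p (q * z) = - (q / z) * theta p (z / q).
    have -> : q * z = p * (z / q) by field.
    rewrite theta_p ?mulf_neq0 ?invr_eq0 //; congr (_ * _).
    by field; rewrite q0 z0.
  have tzq : theta p (z / q) != 0 by apply: contraNneq tqz => h; rewrite E2 h mulr0.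
  have -> : - (q^-1 / - z^-1) = z / q by field; rewrite ?q0 ?z0 ?oppr_eq0 ?oner_eq0.
  rewrite E1 E2 => h.
  apply: (mulIf tzq); rewrite mul0r -h; field: e2.
  by rewrite ?tez ?tzq ?q0 ?z0 ?e0.
have := NE x hx; rewrite hK // K0 mul0r => /esym/eqP; rewrite mulf_eq0.
have tex : theta p (- (e * x)) != 0 by apply: theta_p_neq0; rewrite norm_e.
have tqx := theta_shift_neq0 hx.
rewrite (negbTE (mulf_neq0 tex tqx)) /= => /eqP h.
by apply/eqP; rewrite -subr_eq0 -h; apply/eqP; ring.
Qed.

End Constants.

(** * Geometric series over the two half-lines *)

Section Geometric.
Variable C : sum_field.

Lemma geometric (w : C) : `|w| < 1 -> has_sum (fun n : nat => w ^+ n) (1 - w)^-1.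
Proof.
move=> w1; have h := csumP (abs_bounded_geo w1).
have h2 : has_sum (fun n => w ^+ n) (1 + w * csum (fun n : nat => w ^+ n)).
  rewrite -[X in X + _](expr0 w); apply: has_sum_nat_shift.
  by apply: eq_has_sum (has_sumZ w h) => n; rewrite exprS.
have w0 : 1 - w != 0 by rewrite subr_eq0; apply: contraTneq w1 => <-; rewrite normr1 ltxx.
rewrite (_ : (1 - w)^-1 = csum (fun n : nat => w ^+ n)) //.
apply: (mulfI w0); rewrite divff // mulrBl mul1r.
by rewrite {1}(has_sum_unique h h2) addrK.
Qed.

(** The two expansions of [1 / (1 - w)]: inside the unit circle over [n >= 0], outside over [n < 0]
    with a minus sign. This is where the sign conditions of the triple series come from. *)
Lemma geometric_int (w : C) (b : bool) : (if b then `|w| < 1 else 1 < `|w|) ->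
  has_sum (fun n : int => if (0 <= n) == b then w ^ n else 0) ((if b then 1 else -1) / (1 - w)).
Proof.
case: b => hw.
  rewrite mul1r; apply: (@has_sum_inj C _ _ Posz absz) => //; last by apply: geometric.
  by case=> n; [left; rewrite inE|right].
have w0 : w != 0 by rewrite -normr_gt0; apply: lt_trans hw.
have wV : `|w^-1| < 1 by rewrite normfV invf_lt1 // (lt_trans ltr01).
have w1 : 1 - w != 0 by rewrite subr_eq0; apply: contraTneq hw => <-; rewrite normr1 ltxx.
apply: (@has_sum_inj C _ _ Negz (fun n => `|n|.-1)%N) => //.
  by case=> n; [right|left; rewrite inE].
rewrite (_ : -1 / (1 - w) = w^-1 * (1 - w^-1)^-1); last first.
  have w2 : w - 1 != 0 by rewrite -oppr_eq0 opprB.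
  by field; rewrite ?w0 ?w1 ?w2.
by apply: eq_has_sum (has_sumZ w^-1 (geometric wV)) => n /=; rewrite -exprS exprVn.
Qed.

End Geometric.

Section IntFacts.

Lemma subz1_ge0 (r : int) : (0 <= r - 1) = (0 < r).
Proof. by apply/idP/idP; lia. Qed.

Lemma subz1_lt0 (r : int) : (r - 1 < 0) = (r <= 0).
Proof. by apply/idP/idP; lia. Qed.

Lemma mulz_neg_ge (r t : int) : r < 0 -> t < 0 -> -1 <= r * t + (r + t).
Proof.
move=> r0 t0; have : 0 <= (- r - 1) * (- t - 1) by apply: mulr_ge0; lia.
by rewrite (_ : (- r - 1) * (- t - 1) = r * t + (r + t) + 1); [lia|ring].
Qed.

Lemma divz2_cases (r : int) : r = 2 * (r %/ 2)%Z \/ r = 2 * (r %/ 2)%Z + 1.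
Proof.
have := divz_eq r 2; have := modz_ge0 r (isT : 2 != 0 :> int).
have := @ltz_pmod r 2 isT; lia.
Qed.

Lemma modz2_half (r t : int) : (r = t %[mod 2])%Z -> r + t = 2 * ((r + t) %/ 2)%Z.
Proof.
move=> h; case: (divz2_cases (r + t)) => // e.
have := divz_eq r 2; have := divz_eq t 2; rewrite h => h1 h2; lia.
Qed.

Lemma double_ge0 (m : int) : (0 <= 2 * m) = (0 <= m).
Proof. by apply/idP/idP; lia. Qed.

Lemma double_lt0 (m : int) : (2 * m < 0) = ~~ (0 <= m).
Proof. by rewrite ltNge double_ge0. Qed.

End IntFacts.

(** * The triple series as a double series with poles *)

Section TripleSum.
Variable C : sum_field.
Variables q x z : C.
Hypothesis q01 : 0 < `|q| < 1.
Hypothesis hx : `|q| < `|x| < 1.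
Hypothesis hz : `|q| < `|z| < 1.
Local Notation p := (q ^+ 2).
Let p01 : 0 < `|p| < 1. Proof. exact: sqr01 q01. Qed.
Let P01 : 0 < `|p ^+ 2| < 1. Proof. exact: sqr01 p01. Qed.
Let qq : 0 < `|q|. Proof. by case/andP: q01. Qed.
Let q0 : q != 0. Proof. by rewrite -normr_gt0; case/andP: q01. Qed.
Let q1 : `|q| < 1. Proof. by case/andP: q01. Qed.
Let p0 : p != 0. Proof. by rewrite expf_neq0. Qed.
Let x0 : x != 0. Proof. exact (annulus_neq0 q01 hx). Qed.
Let z0 : z != 0. Proof. exact (annulus_neq0 q01 hz). Qed.
Local Notation J2 := (poch p p).
Local Notation J4 := (poch (p ^+ 2) (p ^+ 2)).

Definition same_parity (r t : int) : bool := (r == t %[mod 2])%Z.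

Definition sgn2 (r t : int) : C :=
  if (0 <= r) && (0 <= t) then 1 else if (r < 0) && (t < 0) then -1 else 0.

(** The two corrections carry no sign condition: they are whole lines, so the boundary terms of the
    shift are bilateral series. *)
Lemma sgn2B r t : sgn2 r t = sgn2 (r - 1) (t - 1) + (r == 0)%:R + (t == 0)%:R.
Proof.
rewrite /sgn2 !subz1_ge0 !subz1_lt0.
case: (ltgtP r 0) => hr; case: (ltgtP t 0) => ht /=; rewrite ?addr0 ?add0r ?addNr //; try by ring.
Qed.

Definition monom (r t : int) : C := q ^ (r * t) * x ^ r * z ^ t.

Definition pair_coef (k : int * int) : C :=
  if same_parity k.1 k.2 then sgn2 k.1 k.2 * monom k.1 k.2 else 0.

Definition pair_weight (k : int * int) : C := weight q x k.1 * weight q z k.2.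

Lemma pair_weight_bounded : abs_bounded pair_weight.
Proof. exact: abs_bounded_mul (weight_bounded q01 hx) (weight_bounded q01 hz). Qed.

Lemma weight_ge0 (a : C) n : 0 <= weight q a n.
Proof. by rewrite /weight; case: ifP => _; rewrite exprn_ge0 ?divr_ge0. Qed.

Lemma normr_weight (a : C) n : a != 0 ->
  `|a ^ n| = weight q a n * (if 0 <= n then 1 else `|q| ^ n).
Proof.
move=> a0; rewrite normr_expz /weight; case: n => n /=; first by rewrite mulr1.
rewrite NegzE -!exprnN expr_div_n mulrAC divff ?mul1r // expf_neq0 // gt_eqF //.
Qed.

(** In the negative quadrant the monomial exceeds the weight by [|q| ^ (r + t)] only, because
    [r * t >= 0]. *)
Lemma sgn2_bound r t :
  `|sgn2 r t * monom r t| <= `|pair_weight (r, t)| \/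
  `|sgn2 r t * monom r t| <= `|pair_weight (r, t)| * `|q| ^ (r + t).
Proof.
rewrite /pair_weight /= [ `|weight q x r * _|]ger0_norm ?mulr_ge0 ?weight_ge0 //.
have hq n : 0 <= n -> `|q ^ n| <= 1.
  by move=> n0; rewrite normr_expz -[leRHS](expr0z `|q|); apply: (expz_anti q01).
rewrite /sgn2 /monom; case: ifP => [/andP[r0 t0]|_].
  left; rewrite mul1r 2!normrM (normr_weight _ x0) (normr_weight _ z0) r0 t0 !mulr1.
  rewrite -mulrA ler_piMl ?mulr_ge0 ?weight_ge0 //; apply: hq; exact: mulr_ge0.
case: ifP => [/andP[r0 t0]|_]; last by left; rewrite mul0r normr0 mulr_ge0 ?weight_ge0.
right; rewrite mulN1r normrN 2!normrM (normr_weight _ x0) (normr_weight _ z0).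
rewrite leNgt r0 leNgt t0 /= expfzDr ?gt_eqF // -mulrA mulrACA ler_piMl //.
  by rewrite !mulr_ge0 ?weight_ge0 ?exprz_ge0.
by apply: hq; rewrite -mulrNN mulr_ge0 // oppr_ge0 ltW.
Qed.

Lemma sgn2_bounded : abs_bounded (fun k : int * int => sgn2 k.1 k.2 * monom k.1 k.2).
Proof.
(* In the negative quadrant the exponent [r * t + (r + t)] can drop to [-1], which costs the
   constant [|q|^-1]. *)
apply: abs_bounded_le (abs_boundedZ `|q|^-1 pair_weight_bounded) => -[r t] /=.
rewrite [leRHS]normrM [ `|pair_weight _|]ger0_norm ?mulr_ge0 ?weight_ge0 // normfV normr_id.
have W0 : 0 <= pair_weight (r, t) by rewrite mulr_ge0 ?weight_ge0.
rewrite -exprN1 /sgn2; case: ifP => [/andP[r0 t0]|_].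
  rewrite mul1r /monom 2!normrM (normr_weight _ x0) (normr_weight _ z0) r0 t0 !mulr1 -mulrA.
  rewrite ler_wpM2r // normr_expz; apply: (expz_anti q01).
  by apply: le_trans (mulr_ge0 r0 t0).
case: ifP => [/andP[r0 t0]|_]; last by rewrite mul0r normr0 mulr_ge0 ?exprz_ge0.
rewrite mulN1r normrN /monom 2!normrM (normr_weight _ x0) (normr_weight _ z0).
rewrite leNgt r0 leNgt t0 /= -mulrA mulrACA [X in _ * X]mulrC mulrA.
rewrite (_ : weight q x r * weight q z t = pair_weight (r, t)) // ler_wpM2r //.
rewrite normr_expz -!expfzDr ?gt_eqF //; apply: (expz_anti q01).
exact: mulz_neg_ge.
Qed.

(** For exponents of equal parity [q ^ (r + t)] is this power of [p], so all poles are removed by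
    theta functions of base [p]. *)
Definition half_sum (k : int * int) : int := ((k.1 + k.2) %/ 2)%Z.

Lemma half_sumE k : same_parity k.1 k.2 -> p ^ half_sum k = q ^ (k.1 + k.2).
Proof.
case: k => r t; rewrite /same_parity /half_sum /= => /eqP h.
by rewrite {2}(modz2_half h) -exprz_exp.
Qed.

Lemma pair_coef_bound k : `|pair_coef k| <= `|pair_weight k| \/
  `|pair_coef k| <= `|pair_weight k| * `|p| ^ half_sum k.
Proof.
rewrite /pair_coef; case: ifP => [h|_]; last by left; rewrite normr0.
case: k h => r t h; have := sgn2_bound r t; rewrite -[ `|q| ^ _]normr_expz -(half_sumE h).
by rewrite [ `|p ^ _|]normr_expz.
Qed.

Definition signed_coef (k : int * int) : C := (-1) ^ k.1 * pair_coef k.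

Lemma signed_coef_bound k : `|signed_coef k| <= `|pair_weight k| \/
  `|signed_coef k| <= `|pair_weight k| * `|p| ^ half_sum k.
Proof. by rewrite /signed_coef normrM normr_expz normrN1 exp1rz mul1r; exact: pair_coef_bound. Qed.

(** The two halves of the series, each multiplied by the theta function that removes its poles:
    [pole_pos y] accounts for those at [y = p ^ n], and [pole_neg (- y)] for those at
    [y = - p ^ n]. *)
Definition pole_pos (y : C) : C := csum (fun k => pair_coef k * hfun p (half_sum k) y).
Definition pole_neg (y : C) : C := csum (fun k => signed_coef k * hfun p (half_sum k) y).

Lemma pole_posP : (forall y, y != 0 -> abs_bounded (fun k => pair_coef k * hfun p (half_sum k) y)) /\
  laurent_fun pole_pos.
Proof. exact: (hfun_sum p01 pair_weight_bounded pair_coef_bound). Qed.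

Lemma pole_negP : (forall y, y != 0 -> abs_bounded (fun k => signed_coef k * hfun p (half_sum k) y)) /\
  laurent_fun pole_neg.
Proof. exact: (hfun_sum p01 pair_weight_bounded signed_coef_bound). Qed.

(* [parity_pole r w] is the sum of [w ^ s] over [s >= 0] with [s = r] modulo 2. *)
Definition parity_pole (r : int) (w : C) : C := ((1 - w)^-1 + (-1) ^ r / (1 + w)) / 2.

Definition pair_sum (y : C) : C :=
  csum (fun k : int * int => pair_coef k * parity_pole k.1 (q ^ (k.1 + k.2) * y)).

Lemma pair_sumP y : y != 0 -> theta p y != 0 -> theta p (- y) != 0 ->
  has_sum (fun k : int * int => pair_coef k * parity_pole k.1 (q ^ (k.1 + k.2) * y)) (pair_sum y) /\
  pair_sum y = (pole_pos y / theta p y + pole_neg (- y) / theta p (- y)) / 2.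
Proof.
move=> y0 ty tny; have ny0 : - y != 0 by rewrite oppr_eq0.
have h1 := has_sumZ (theta p y)^-1 (csumP (proj1 pole_posP y y0)).
have h2 := has_sumZ (theta p (- y))^-1 (csumP (proj1 pole_negP (- y) ny0)).
have h := has_sumZ (2^-1) (has_sumD h1 h2).
have {}h : has_sum (fun k : int * int => pair_coef k * parity_pole k.1 (q ^ (k.1 + k.2) * y))
    ((pole_pos y / theta p y + pole_neg (- y) / theta p (- y)) / 2).
  rewrite [X in has_sum _ X]mulrC ![_ / theta p _]mulrC; apply: eq_has_sum h => k.
  rewrite /signed_coef /pair_coef; case: ifP => [sk|_]; last by ring.
  rewrite !hfunE // (half_sumE sk) /parity_pole mulrN.
  have d1 : 1 - q ^ (k.1 + k.2) * y != 0 by rewrite -(half_sumE sk) sub1_neq0.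
  have d2 : 1 + q ^ (k.1 + k.2) * y != 0.
    by rewrite -[_ * y]opprK -mulrN -(half_sumE sk) sub1_neq0.
  rewrite opprK; field; rewrite ty tny d1 d2 //.
by have E := csumE h; rewrite /pair_sum E.
Qed.

(** The value, by Kronecker's identity in base [q ^+ 4], of the sum of
    [u ^ (2 * n) / (1 - q ^ (4 * n) * v ^+ 2)]. The same quotients multiply the Appell-Lerch
    functions in the theorem. *)
Definition kron (u v : C) : C :=
  J4 ^+ 3 * theta (p ^+ 2) (u ^+ 2 * v ^+ 2) / (theta (p ^+ 2) (u ^+ 2) * theta (p ^+ 2) (v ^+ 2)).

Lemma kron_has (u v : C) : `|q| < `|u| < 1 -> v != 0 -> theta p v != 0 -> theta p (- v) != 0 ->
  has_sum (fun n => (u ^+ 2) ^ n / (1 - (p ^+ 2) ^ n * v ^+ 2)) (kron u v).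
Proof.
move=> /andP[a b] v0 tv tnv; apply: (kronecker P01); rewrite ?expf_neq0 //.
  rewrite !normrX exprn_ilt1 // andbT ltrXn2r ?exprn_ge0 //; apply: lt_trans a.
  by rewrite expr2 gtr_pMr.
by rewrite theta_sqr // !mulf_neq0 ?invr_eq0 ?expf_neq0 ?poch_diag_neq0.
Qed.

Lemma expz_double (a : C) (k : int) : a ^ (2 * k) = (a ^+ 2) ^ k.
Proof. by rewrite -exprz_exp. Qed.

Lemma sgn_pred (r : int) : (-1 : C) ^ (r - 1) = - (-1) ^ r.
Proof. by rewrite expfzDr ?oppr_eq0 ?oner_eq0 // exprN1 invrN1 mulrN1. Qed.

Lemma sqr_expz (a : C) (k : int) : (a ^ k) ^+ 2 = (a ^+ 2) ^ k.
Proof. by rewrite -[LHS]/((a ^ k) ^ (2 : int)) exprz_exp mulrC -exprz_exp. Qed.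

Lemma sgn_even (k : int) : (-1 : C) ^ (2 * k) = 1.
Proof. by rewrite -exprz_exp (_ : (-1 : C) ^ (2 : int) = 1) ?exp1rz // -[LHS]/((-1) ^+ 2) sqrrN expr1n. Qed.

(** Only even exponents contribute. Expanding each denominator of Kronecker's series geometrically
    gives back the double sum, with the factor [sgn2]. *)
Lemma kron_pair : has_sum (fun k : int * int => pair_coef k * ((1 + (-1) ^ k.1) / 2)) (kron x z).
Proof.
have hb : abs_bounded (fun k : int * int => pair_coef k * ((1 + (-1) ^ k.1) / 2)).
  apply: abs_bounded_le sgn2_bounded => k; rewrite normrM /pair_coef.
  case: ifP => _; last by rewrite normr0 mul0r.
  rewrite ler_piMr // normrM normfV [ `|2|]ger0_norm // ler_pdivrMr // mul1r.
  apply: le_trans (ler_normD _ _) _.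
  by rewrite normr1 normr_expz normrN1 exp1rz.
have := csum_pair hb; suff h : has_sum (fun r => csum (fun t => pair_coef (r, t) * ((1 + (-1) ^ r) / 2))) (kron x z).
  by move=> /has_sum_unique /(_ h) <-; apply: csumP.
apply: (@has_sum_inj C _ _ (fun m : int => 2 * m) (fun r => (r %/ 2)%Z)) => [m|r|].
- by rewrite mulrC mulzK.
- case: (boolP (r == 2 * (r %/ 2)%Z)) => hr; first by left; rewrite inE eq_sym.
  right; apply: csumE; apply: eq_has_sum (@has_sum0 C int) => t.
  rewrite (_ : r = 2 * (r %/ 2)%Z + 1); last by case: (divz2_cases r) => // e; rewrite -e eqxx in hr.
  by rewrite expfzDr ?oppr_eq0 ?oner_eq0 // sgn_even expr1z mul1r subrr mul0r mulr0.
apply: eq_has_sum (kron_has hx z0 (theta_p_neq0 q01 hz) _); last by apply: theta_p_neq0; rewrite ?normrN.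
move=> m /=; apply/esym/csumE; rewrite sgn_even.
(* As [|q| < |z| < 1], the sign of [m] decides which expansion converges, so both exponents get the
   same sign. *)
have hw : if 0 <= m then `|(p ^+ 2) ^ m * z ^+ 2| < 1 else 1 < `|(p ^+ 2) ^ m * z ^+ 2|.
  case/andP: hz => z1 z2; rewrite normrM normr_expz; case: m => m /=; rewrite !normrX.
    apply: le_lt_trans (_ : `|z| ^+ 2 < 1); last by rewrite exprn_ilt1.
    by rewrite ler_piMl ?exprn_ge0 // -exprnP -!exprM exprn_ile1 // ltW.
  rewrite NegzE -exprnN -!exprM mulrC ltr_pdivlMr ?exprn_gt0 // mul1r.
  apply: le_lt_trans (_ : `|q| ^+ 2 < _); last by rewrite ltrXn2r // ltW.
  by rewrite ler_wiXn2l ?(ltW q1) // -mulnA leq_pmulr.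
set w := (p ^+ 2) ^ m * z ^+ 2 in hw *.
have := geometric_int hw => /(has_sumZ ((if 0 <= m then 1 else -1) * (x ^+ 2) ^ m)) h.
rewrite (_ : (x ^+ 2) ^ m / (1 - w) = (if 0 <= m then 1 else -1) * (x ^+ 2) ^ m * ((if 0 <= m then 1 else -1) / (1 - w))); last first.
  by case: ifP => _; ring.
apply: (@has_sum_inj C _ _ (fun n : int => 2 * n) (fun t => (t %/ 2)%Z)) => [n|t|].
- by rewrite mulrC mulzK.
- case: (boolP (t == 2 * (t %/ 2)%Z)) => ht; first by left; rewrite inE eq_sym.
  right; rewrite /pair_coef /same_parity /= ifF ?mul0r //.
  apply/negbTE; rewrite modzMr; apply: contra ht => /eqP ht.
  by apply/eqP; have := divz_eq t 2; rewrite -ht addr0 mulrC.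
apply: eq_has_sum h => n /=; rewrite /pair_coef /same_parity /= !modzMr eqxx.
rewrite (_ : (1 + 1) / 2 = 1 :> C); last by field.
rewrite mulr1 /sgn2 /monom.
rewrite !double_ge0 !double_lt0.
have E : x ^+ 2 ^ m * w ^ n = q ^ (2 * m * (2 * n)) * x ^ (2 * m) * z ^ (2 * n).
  rewrite (_ : 2 * m * (2 * n) = 2 * (2 * (m * n))); last by ring.
  rewrite !expz_double /w (expfzMl ((p ^+ 2) ^ m)) exprz_exp.
  by move: (x ^+ 2) (z ^+ 2) ((p ^+ 2) ^ (m * n)) => X Z P; ring.
by case: (0 <= m); case: (0 <= n) => /=; rewrite ?mulr0 ?mul0r ?mul1r ?mulN1r ?mulNr // E.
Qed.

Lemma parity_pole_even (m : int) (w : C) : 1 - w != 0 -> 1 + w != 0 ->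
  parity_pole (2 * m) w = (1 - w ^+ 2)^-1.
Proof.
move=> a b; rewrite /parity_pole sgn_even (_ : 1 - w ^+ 2 = (1 - w) * (1 + w)); last by ring.
by field; rewrite a b.
Qed.

Section Generic.
Variable y : C.
Hypothesis y0 : y != 0.
Hypothesis ty : theta p y != 0.
Hypothesis tny : theta p (- y) != 0.

Lemma pole_factors_neq0 k : same_parity k.1 k.2 ->
  1 - q ^ (k.1 + k.2) * y != 0 /\ 1 + q ^ (k.1 + k.2) * y != 0.
Proof.
move=> sk; have ny0 : - y != 0 by rewrite oppr_eq0.
rewrite -(half_sumE sk) sub1_neq0 //; split => //.
by rewrite -[_ * y]opprK -mulrN sub1_neq0.
Qed.

(** On the edge [r = 0] parity forces [t = 2 * n], and the two poles combine into
    [1 / (1 - w ^+ 2)]: this is Kronecker's series for [z] and [y]. *)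
Lemma edge_left : has_sum (fun k : int * int => if same_parity k.1 k.2 then
   (k.1 == 0)%:R * (monom k.1 k.2 * parity_pole k.1 (q ^ (k.1 + k.2) * y)) else 0) (kron z y).
Proof.
apply: (@has_sum_inj C _ _ (fun n : int => (0, 2 * n)) (fun k => (k.2 %/ 2)%Z)) => [n|[r t]|].
- by rewrite mulrC mulzK.
- rewrite inE xpair_eqE /same_parity /=; case: (r =P 0) => [->|hr]; last first.
    by right; rewrite mul0r; case: ifP.
  case: (boolP (t == 2 * (t %/ 2)%Z)) => ht; first by left; rewrite eq_sym.
  right; rewrite ifF //; apply/negbTE; apply: contra ht => /eqP ht.
  by apply/eqP; have := divz_eq t 2; rewrite -ht addr0 mulrC.
apply: eq_has_sum (kron_has hz y0 ty tny) => n /=; rewrite /same_parity modzMr eqxx mul1r.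
have [a b] := @pole_factors_neq0 (0, 2 * n) (introT eqP (esym (modzMr n 2))).
rewrite -[X in parity_pole X](mulr0 2) parity_pole_even // /monom mul0r !expr0z !mul1r add0r.
by rewrite !expz_double (exprMn _ (p ^ n)) sqr_expz.
Qed.

Lemma edge_right : has_sum (fun k : int * int => if same_parity k.1 k.2 then
   (k.2 == 0)%:R * (monom k.1 k.2 * parity_pole k.1 (q ^ (k.1 + k.2) * y)) else 0) (kron x y).
Proof.
apply: (@has_sum_inj C _ _ (fun n : int => (2 * n, 0)) (fun k => (k.1 %/ 2)%Z)) => [n|[r t]|].
- by rewrite mulrC mulzK.
- rewrite inE xpair_eqE /same_parity /= andbC; case: (t =P 0) => [->|hr]; last first.
    by right; rewrite mul0r; case: ifP.
  case: (boolP (r == 2 * (r %/ 2)%Z)) => hr; first by left; rewrite eq_sym.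
  right; rewrite ifF //; apply/negbTE; apply: contra hr => /eqP hr.
  by apply/eqP; have := divz_eq r 2; rewrite hr addr0 mulrC.
apply: eq_has_sum (kron_has hx y0 ty tny) => n /=; rewrite /same_parity modzMr eqxx mul1r.
have [a b] := @pole_factors_neq0 (2 * n, 0) (introT eqP (modzMr n 2)).
rewrite parity_pole_even // /monom mulr0 !expr0z mul1r mulr1 addr0.
by rewrite !expz_double (exprMn _ (p ^ n)) sqr_expz.
Qed.

Lemma theta_pN_neq0 (w : C) : w != 0 -> theta p w != 0 -> theta p (p * w) != 0.
Proof. by move=> w0 tw; rewrite theta_p // mulf_neq0 // oppr_eq0 invr_eq0. Qed.

Lemma pair_sum_p : pair_sum (p * y) =
  kron x z + q * y / (x * z) * (pair_sum y - kron z y - kron x y).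
Proof.
have py0 : p * y != 0 by rewrite mulf_neq0.
have tpy := theta_pN_neq0 y0 ty.
have ny0 : - y != 0 by rewrite oppr_eq0.
have tnpy : theta p (- (p * y)) != 0 by rewrite -mulrN theta_pN_neq0.
pose phi (k : int * int) := (k.1 - 1, k.2 - 1); pose psi (k : int * int) := (k.1 + 1, k.2 + 1).
have phiK : cancel phi psi by case=> a b; rewrite /phi /psi /= !subrK.
have psiK : cancel psi phi by case=> a b; rewrite /phi /psi /= !addrK.
have h1 := has_sum_reindex phiK psiK (proj1 (pair_sumP py0 tpy tnpy)).
have h2 := has_sum_reindex phiK psiK kron_pair.
have h3 := proj1 (pair_sumP y0 ty tny).
have h4 := has_sumZ (q * y / (x * z)) (has_sumB (has_sumB h3 edge_left) edge_right).
(* Termwise this rests on [parity_pole (r - 1) w = w * parity_pole r w + (1 - (-1) ^ r) / 2] at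
   [w = q ^ (r + t) * y]; the last summand yields [kron x z], and [sgn2B] yields the two edges. *)
apply: has_sum_unique h1 _; apply: eq_has_sum (has_sumD h2 h4) => -[r t] /=.
rewrite /pair_coef /phi /=.
have -> : same_parity (r - 1) (t - 1) = same_parity r t.
  by rewrite /same_parity eqz_modDr.
case: ifP => sk; last by ring.
have [a b] := @pole_factors_neq0 (r, t) sk; rewrite /= in a b.
rewrite (sgn2B r t); set s := sgn2 (r - 1) (t - 1).
have -> : q ^ (r - 1 + (t - 1)) * (p * y) = q ^ (r + t) * y.
  by rewrite mulrA -[p]/(q ^ (2 : int)) -expfzDr //; congr (q ^ _ * _); ring.
have -> : monom (r - 1) (t - 1) = monom r t * q / (q ^ (r + t) * x * z).
  rewrite /monom (_ : (r - 1) * (t - 1) = r * t + 1 - (r + t)); last by ring.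
  rewrite (expfzDr (r * t + 1) _ q0) (expfzDr (r * t) 1 q0) (expfzDr r _ x0) (expfzDr t _ z0).
  rewrite -!invr_expz !expr1z; field.
  by rewrite x0 z0 !expfz_neq0.
have -> : parity_pole (r - 1) (q ^ (r + t) * y) =
  ((1 - q ^ (r + t) * y)^-1 - (-1) ^ r / (1 + q ^ (r + t) * y)) / 2.
  by rewrite /parity_pole sgn_pred mulNr.
rewrite sgn_pred.
rewrite /parity_pole; set e := (-1) ^ r; set M := monom r t.
have := expfz_neq0 (r + t) q0; move: (q ^ (r + t)) a b => W a b W0.
by field; rewrite ?x0 ?z0 ?y0 ?W0 ?a ?b.
Qed.

End Generic.

End TripleSum.

Lemma opp_sum_sign (r t : int) : (r, t) != (0, 0) -> r + t = 0 ->
  (0 <= r) && (0 <= t) = false /\ (r < 0) && (t < 0) = false.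
Proof.
rewrite xpair_eqE negb_and => /orP rt s; split; apply/negbTE/negP => /andP[]; lia.
Qed.

(** * The uniqueness argument in y *)

Section Identity.
Variable C : sum_field.
Variables q x z : C.
Hypothesis q01 : 0 < `|q| < 1.
Hypothesis hx : `|q| < `|x| < 1.
Hypothesis hz : `|q| < `|z| < 1.
Local Notation p := (q ^+ 2).
Local Notation T := (theta (q ^+ 2)).
Local Notation J1 := (poch q q).
Local Notation J2 := (poch p p).
Local Notation J4 := (poch (p ^+ 2) (p ^+ 2)).
Local Notation al := (appell_sum p).
Local Notation kron := (kron q).
Local Notation pair_sum := (pair_sum q x z).

Let p01 : 0 < `|p| < 1. Proof. exact: sqr01 q01. Qed.
Let P01 : 0 < `|p ^+ 2| < 1. Proof. exact: sqr01 p01. Qed.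
Let q0 : q != 0. Proof. by rewrite -normr_gt0; case/andP: q01. Qed.
Let p0 : p != 0. Proof. by rewrite expf_neq0. Qed.
Let x0 : x != 0. Proof. exact (annulus_neq0 q01 hx). Qed.
Let z0 : z != 0. Proof. exact (annulus_neq0 q01 hz). Qed.
Let J10 : J1 != 0. Proof. exact: poch_diag_neq0. Qed.
Let J20 : J2 != 0. Proof. exact: poch_diag_neq0. Qed.
Let J40 : J4 != 0. Proof. exact: poch_diag_neq0. Qed.
Let nx : `|q| < `|- x| < 1. Proof. by rewrite normrN. Qed.
Let nz : `|q| < `|- z| < 1. Proof. by rewrite normrN. Qed.
Let tx : T x != 0. Proof. exact: theta_p_neq0. Qed.
Let tz : T z != 0. Proof. exact: theta_p_neq0. Qed.
Let tnx : T (- x) != 0. Proof. exact: theta_p_neq0. Qed.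
Let tnz : T (- z) != 0. Proof. exact: theta_p_neq0. Qed.
Let tqx : T (q * x) != 0. Proof. exact: theta_shift_neq0. Qed.
Let tqz : T (q * z) != 0. Proof. exact: theta_shift_neq0. Qed.
Let tnxz : T (- (x * z)) != 0. Proof. by rewrite -mulNr theta_pM_neq0. Qed.
Let qx0 : q * x != 0. Proof. by rewrite mulf_neq0. Qed.
Let qz0 : q * z != 0. Proof. by rewrite mulf_neq0. Qed.
Let xz0 : x * z != 0. Proof. by rewrite mulf_neq0. Qed.

Lemma kronC u v : kron u v = kron v u.
Proof. by rewrite /kron [u ^+ 2 * _]mulrC [theta _ (u ^+ 2) * _]mulrC. Qed.

Lemma kronE u v : u != 0 -> v != 0 ->
  kron u v = J4 ^+ 2 * J2 ^+ 2 * (T (u * v) * T (- (u * v)) / (T u * T (- u) * (T v * T (- v)))).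
Proof.
move=> u0 v0; rewrite /kron -exprMn !theta_sqr ?mulf_neq0 //.
(* If a denominator vanishes, both sides are [0] because the inverse of [0] is [0]. *)
have [tu|tu] := eqVneq (T u * T (- u)) 0; first by rewrite tu mulr0 !mul0r invr0 !mulr0.
have [tv|tv] := eqVneq (T v * T (- v)) 0; first by rewrite tv !mulr0 invr0 !mulr0.
move: tu tv; set a := T u * _; set b := T v * _; set c := T (u * v) * _ => a0 b0.
by field; rewrite ?a0 ?b0 ?J20 ?J40.
Qed.

(** In the notation of the theorem, [kron v w] times the Appell-Lerch function
    [m(- q u / (v w), q^2, - v w)]. *)
Definition appell_term (u v w : C) : C := kron v w * al (v * w) (q * u) / T (- (v * w)).

Definition theta_quot (y : C) : C := J1 ^+ 3 * J2 ^+ 3 / (theta q x * theta q y * theta q z) *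
  (T (x * y) * T (x * z) * T (y * z) / (T (- x) * T (- y) * T (- z))).

Definition defect (y : C) : C := pair_sum y - appell_term x y z - appell_term y x z
  - appell_term z x y - theta_quot y.

(** The points where no denominator depending on [y] vanishes. They contain the annulus and are
    stable under [y -> p * y], as needed for a functional equation on a circle. *)
Definition generic (y : C) := [/\ y != 0, T y != 0, T (- y) != 0, T (q * y) != 0 &
  T (- (y * z)) != 0 /\ T (- (x * y)) != 0].

Lemma generic_annulus (y : C) : `|q| < `|y| < 1 -> generic y.
Proof.
move=> hy; have ny : `|q| < `|- y| < 1 by rewrite normrN.
split; [exact (annulus_neq0 q01 hy)|exact: theta_p_neq0|exact: theta_p_neq0|exact: theta_shift_neq0|].
by split; rewrite -mulrN theta_pM_neq0 ?normrN.
Qed.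

Lemma generic_p (y : C) : generic y -> generic (p * y).
Proof.
have H w : w != 0 -> T w != 0 -> T (p * w) != 0 by exact: theta_pN_neq0.
case=> y0 ty tny tqy [tyz txy]; split; rewrite ?mulf_neq0 ?H //.
- by rewrite -mulrN H // oppr_eq0.
- by rewrite mulrCA H // mulf_neq0.
split; first by rewrite -mulrA -mulrN H // oppr_eq0 mulf_neq0.
by rewrite mulrCA -mulrN H // oppr_eq0 mulf_neq0.
Qed.

Lemma theta_pN w : w != 0 -> T (- (p * w)) = w^-1 * T (- w).
Proof. by move=> w0; rewrite -mulrN theta_p ?oppr_eq0 // invrN opprK. Qed.

Section Shift.
Variable y : C.
Hypothesis gy : generic y.
Local Notation kappa := (q * y / (x * z)).

Let y0 : y != 0. Proof. by case: gy. Qed.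
Let ty : T y != 0. Proof. by case: gy. Qed.
Let tny : T (- y) != 0. Proof. by case: gy. Qed.
Let tqy : T (q * y) != 0. Proof. by case: gy. Qed.

Lemma kron_p (w : C) : w != 0 -> T w != 0 -> T (- w) != 0 ->
  kron (p * y) w = kron y w / w ^+ 2.
Proof.
move=> w0 tw tnw; rewrite !kronE ?mulf_neq0 // -[p * y * w]mulrA !(theta_p p01) ?mulf_neq0 // !theta_pN ?mulf_neq0 //.
by field; rewrite ?ty ?tny ?tw ?tnw ?y0 ?w0.
Qed.

Lemma appell_term_p1 (u w : C) : u != 0 -> w != 0 -> T w != 0 -> T (- w) != 0 ->
  T (q * u) != 0 -> T (- (y * w)) != 0 ->
  appell_term u (p * y) w = q * y / (u * w) * (appell_term u y w - kron y w).
Proof.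
move=> u0 w0 tw tnw tu tyw; have yw0 : y * w != 0 by rewrite mulf_neq0.
have qu0 : q * u != 0 by rewrite mulf_neq0.
rewrite /appell_term kron_p // -[p * y * w]mulrA theta_pN // appell_sum_pl //.
by field; rewrite ?tyw ?u0 ?w0 ?y0 ?q0.
Qed.

Lemma appell_term_p2 : appell_term (p * y) x z = kron x z + kappa * appell_term y x z.
Proof.
rewrite /appell_term [q * (p * y)]mulrCA appell_sum_pr ?mulf_neq0 //.
by field; rewrite ?tnxz ?x0 ?z0.
Qed.

Lemma theta_quot_p : theta_quot (p * y) = kappa * theta_quot y.
Proof.
rewrite /theta_quot.
have -> : theta q (p * y) = q^-1 * y ^- 2 * theta q y.
  rewrite -[p * y]mulrA !theta_p ?mulf_neq0 //.
  by field; rewrite q0 y0.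
rewrite [x * (p * y)]mulrCA -[p * y * z]mulrA !(theta_p p01) ?mulf_neq0 // theta_pN //.
rewrite !(theta_split q01) //.
by field; rewrite ?x0 ?y0 ?z0 ?q0 ?tx ?ty ?tz ?tqx ?tqy ?tqz ?tnx ?tny ?tnz ?J10 ?J20.
Qed.

(** The inhomogeneous terms match: [kron z y] and [kron x y] come from the two Appell terms with [y]
    in the theta argument, [kron x z] from the one with [y] in the denominators. *)
Lemma defect_p : defect (p * y) = kappa * defect y.
Proof.
have [_ _ _ _ [tyz txy]] := gy.
rewrite /defect pair_sum_p // appell_term_p1 // appell_term_p2 theta_quot_p.
have E a b c : appell_term a b c = appell_term a c b.
  by rewrite /appell_term kronC [b * c]mulrC.
rewrite (E z x (p * y)) appell_term_p1 // 1?[y * x]mulrC //.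
rewrite (E z x y) (kronC z y) (kronC x y).
by field; rewrite ?x0 ?z0.
Qed.

End Shift.

Definition residue_den (y : C) : C := T y * T (- y) * T (q * y).

(* [residue_den y * defect y], with all the poles in [y] cleared, see [clearedE]. *)
Definition cleared (y : C) : C :=
  (T (- y) * T (q * y) * pole_pos q x z y + T y * T (q * y) * pole_neg q x z (- y)) / 2
  - J4 ^+ 2 * J2 ^+ 2 / (T z * T (- z)) * (T (q * y) * T (z * y) * al (z * y) (q * x))
  - J4 ^+ 2 * J2 ^+ 2 / (T x * T (- x)) * (T (q * y) * T (x * y) * al (x * y) (q * z))
  - kron x z / T (- (x * z)) * (T y * T (- y) * appell_entire p (x * z) (q * y))
  - J1 ^+ 2 * J2 ^+ 5 * T (x * z) / (theta q x * theta q z * T (- x) * T (- z)) * (T (x * y) * T (z * y)).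

Lemma clearedE y : generic y -> cleared y = residue_den y * defect y.
Proof.
case=> y0 ty tny tqy [tyz txy].
rewrite /cleared /residue_den /defect (proj2 (pair_sumP q01 hx hz y0 ty tny)).
have qy0 : q * y != 0 by rewrite mulf_neq0.
rewrite (proj2 (appell_sumP p01 xz0 qy0 tqy)).
have -> : appell_term x y z = J4 ^+ 2 * J2 ^+ 2 * T (z * y) * al (z * y) (q * x) / (T y * T (- y) * (T z * T (- z))).
  by rewrite /appell_term kronE // [y * z]mulrC in tyz *; field; rewrite ?tyz ?ty ?tny ?tz ?tnz.
have -> : appell_term z x y = J4 ^+ 2 * J2 ^+ 2 * T (x * y) * al (x * y) (q * z) / (T x * T (- x) * (T y * T (- y))).
  by rewrite /appell_term kronE //; field; rewrite ?txy ?ty ?tny ?tx ?tnx.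
rewrite /appell_term /theta_quot [theta q y]theta_split // [y * z]mulrC.
have tqx1 : theta q x != 0 by rewrite theta_split // !mulf_neq0 ?invr_eq0 ?expf_neq0.
have tqz1 : theta q z != 0 by rewrite theta_split // !mulf_neq0 ?invr_eq0 ?expf_neq0.
by field; rewrite ?ty ?tny ?tqy ?tz ?tnz ?tx ?tnx ?tnxz ?tqx1 ?tqz1 ?J10 ?J20.
Qed.

Lemma laurent_cleared : laurent_fun cleared.
Proof.
have lT (a : C) : a != 0 -> laurent_fun (fun w => T (a * w)).
  by move=> a0; exact: laurent_fun_scale a0 (laurent_fun_theta p01).
have l1 : laurent_fun T := laurent_fun_theta p01.
have nN (f : C -> C) : laurent_fun f -> laurent_fun (fun w => f (- w)).
  move=> lf; apply: laurent_fun_ext (laurent_fun_scale (_ : -1 != 0) lf) => [w _|].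
    by rewrite mulN1r.
  by rewrite oppr_eq0 oner_eq0.
have lN := nN _ l1.
have lq := lT q q0.
have lP := proj2 (pole_posP q01 hx hz); have lM := nN _ (proj2 (pole_negP q01 hx hz)).
have lA1 : laurent_fun (fun w => al (z * w) (q * x)).
  exact: (laurent_fun_scale z0 (laurent_appell_sum p01 qx0 tqx)).
have lA2 : laurent_fun (fun w => al (x * w) (q * z)).
  exact: (laurent_fun_scale x0 (laurent_appell_sum p01 qz0 tqz)).
have lB : laurent_fun (fun w => appell_entire p (x * z) (q * w)).
  exact: laurent_fun_scale q0 (proj2 (appell_hfun p01 xz0)).
apply: laurent_funB; last by apply: laurent_funZ; apply: laurent_funM; exact: lT.
apply: laurent_funB; last by apply: laurent_funZ; apply: laurent_funM lB; exact: laurent_funM.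
apply: laurent_funB; last by apply: laurent_funZ; apply: laurent_funM lA2; apply: laurent_funM => //; exact: lT.
apply: laurent_funB; last by apply: laurent_funZ; apply: laurent_funM lA1; apply: laurent_funM => //; exact: lT.
have h := laurent_funZ 2^-1 (laurent_funD (laurent_funM (laurent_funM lN lq) lP) (laurent_funM (laurent_funM l1 lq) lM)).
by apply: laurent_fun_ext h => w _; rewrite mulrC.
Qed.

(** A term survives at [1] only if [r + t = 0], and then equal signs force [r = t = 0]. *)
Lemma pole_at1 : pole_pos q x z 1 = J2 ^+ 3 /\ pole_neg q x z 1 = J2 ^+ 3.
Proof.
have H (k : int * int) : k != (0, 0) -> pair_coef q x z k * hfun p (half_sum k) 1 = 0.
  move=> k0; rewrite /pair_coef; case: ifP => [sk|_]; last by rewrite mul0r.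
  have [h0|h0] := eqVneq (half_sum k) 0; last by rewrite hfun_n1 ?mulr0.
  have s0 : k.1 + k.2 = 0 by rewrite (modz2_half (eqP sk)) [X in 2 * X]h0 mulr0.
  have k0' : (k.1, k.2) != (0, 0) by rewrite -surjective_pairing.
  have [a b] := opp_sum_sign k0' s0.
  by rewrite /sgn2 a b !mul0r.
have H0 : pair_coef q x z (0, 0) * hfun p (half_sum (0, 0)) 1 = J2 ^+ 3.
  by rewrite hfun01 // /pair_coef /sgn2 /monom /= mul0r !expr0z !mul1r.
split; apply: csumE; apply: eq_has_sum (has_sum_delta (0, 0) (J2 ^+ 3)) => k.
  by case: eqP => [->|/eqP k0]; rewrite ?H0 ?H.
rewrite /signed_coef -mulrA; case: eqP => [->|/eqP k0]; last by rewrite H ?mulr0.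
by rewrite H0 expr0z mul1r.
Qed.

(** The factor [T y * T (- y)] kills the term with [appell_entire]; what remains is [appell_pair],
    once [theta_pq] has evaluated [T (q * e) * T (- (e * q))]. *)
Lemma cleared_pm1 (e : C) : e = 1 \/ e = -1 -> cleared e = 0.
Proof.
move=> he; have e2 : e ^+ 2 = 1 by case: he => ->; rewrite ?sqrrN expr1n.
have ne : `|e| = 1 by case: he => ->; rewrite ?normrN normr1.
have tT : T e * T (- e) = 0 by case: he => ->; rewrite ?opprK theta1 // ?mul0r ?mulr0.
have hP : T (- e) * T (q * e) * pole_pos q x z e + T e * T (q * e) * pole_neg q x z (- e) =
   T (- 1) * T (q * e) * J2 ^+ 3.
  have [E1 E2] := pole_at1.
  by case: he => ->; rewrite ?opprK ?E1 ?E2 theta1 // !mul0r ?addr0 ?add0r.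
rewrite /cleared hP tT mul0r mulr0 subr0.
have norm_e (w : C) : `|- (e * w)| = `|w| by rewrite normrN normrM ne mul1r.
have norm_e' (w : C) : `|e * w| = `|w| by rewrite normrM ne mul1r.
have tez : T (- (e * z)) != 0 by apply: theta_p_neq0; rewrite ?norm_e.
have tex : T (- (e * x)) != 0 by apply: theta_p_neq0; rewrite ?norm_e.
have tez' : T (e * z) != 0 by apply: theta_p_neq0; rewrite ?norm_e'.
have tex' : T (e * x) != 0 by apply: theta_p_neq0; rewrite ?norm_e'.
have Tz : T z * T (- z) = T (e * z) * T (- (e * z)).
  by case: he => ->; rewrite ?mul1r ?mulN1r ?opprK // mulrC.
have Tx : T x * T (- x) = T (e * x) * T (- (e * x)).
  by case: he => ->; rewrite ?mul1r ?mulN1r ?opprK // mulrC.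
have Tq : T (q * e) * T (- (e * q)) = J2 ^+ 4 / J4 ^+ 2.
  rewrite -theta_pq //; case: he => ->; first by rewrite mulr1 mul1r.
  by rewrite mulrN1 mulN1r opprK mulrC.
have pr := appell_pair q01 e2 hx hz.
have Txz : T x * T (q * x) * (T z * T (q * z)) * (T (- x) * T (- z)) =
  T (e * x) * T (- (e * x)) * (T (e * z) * T (- (e * z))) * T (q * x) * T (q * z).
  by rewrite -Tx -Tz; ring.
have Q : J1 ^+ 2 * J2 ^+ 5 * T (x * z) / (theta q x * theta q z * T (- x) * T (- z)) =
  J2 ^+ 9 * T (x * z) / (T (e * x) * T (- (e * x)) * (T (e * z) * T (- (e * z))) * T (q * x) * T (q * z)).
  rewrite -Txz !(theta_split q01) //; field.
  by rewrite ?tx ?tz ?tnx ?tnz ?tqx ?tqz ?J10 ?J20.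
rewrite Q Tz [z * e]mulrC Tx [x * e]mulrC theta_pN1 //.
move: pr; set A1 := al (e * z) _; set A2 := al (e * x) _ => pr.
transitivity (J4 ^+ 2 * J2 ^+ 2 * T (q * e) * (1 - (A1 / T (- (e * z)) + A2 / T (- (e * x))))
  - J2 ^+ 9 * T (x * z) / (T (- (e * x)) * T (- (e * z)) * T (q * x) * T (q * z))).
  by field; rewrite ?tez ?tex ?tez' ?tex' ?tqx ?tqz ?J20.
rewrite pr.
transitivity (J4 ^+ 2 * J2 ^+ 5 * (T (q * e) * T (- (e * q))) * T (x * z)
    / (T (- (e * x)) * T (- (e * z)) * T (q * x) * T (q * z))
  - J2 ^+ 9 * T (x * z) / (T (- (e * x)) * T (- (e * z)) * T (q * x) * T (q * z))).
  by field; rewrite ?tez ?tex ?tqx ?tqz.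
by rewrite Tq; field; rewrite ?tez ?tex ?tqx ?tqz ?J40.
Qed.

Lemma residue_den_p y : y != 0 -> residue_den (p * y) = (q * y ^+ 3)^-1 * residue_den y.
Proof.
move=> y0; rewrite /residue_den theta_pN // [q * (p * y)]mulrCA !(theta_p p01) ?mulf_neq0 //.
by field; rewrite q0 y0.
Qed.

Theorem pair_sumE y : `|q| < `|y| < 1 ->
  pair_sum y = appell_term x y z + appell_term y x z + appell_term z x y + theta_quot y.
Proof.
move=> hy; have y0 := annulus_neq0 q01 hy; have yr : 0 < `|y| by rewrite normr_gt0.
have cn : (x * z)^-1 != 0 by rewrite invr_eq0.
(* The circle through the given [y] lies in the annulus, so all its points are generic. *)
have [w wy|K0 [K1 hK]] := theta_degree2 p01 cn yr laurent_cleared.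
  have hw : `|q| < `|w| < 1 by rewrite wy.
  have gw := generic_annulus hw; have w0 := annulus_neq0 q01 hw.
  rewrite (clearedE (generic_p gw)) (clearedE gw) defect_p // residue_den_p //.
  by field; rewrite ?x0 ?z0 ?w0 ?q0.
have h1 := cleared_pm1 (or_introl (erefl 1)); have h2 := cleared_pm1 (or_intror (erefl (-1))).
rewrite hK ?oner_neq0 // in h1; rewrite hK ?oppr_eq0 ?oner_neq0 // in h2.
rewrite sqrrN !expr1n !mulr1 invrK !mul1r in h1 h2.
have hxz : `|x * z| < 1 by rewrite normrM mulr_ilt1 //; [case/andP: hx|case/andP: hz].
have hqxz : `|p| < `|x * z|.
  by rewrite normrX normrM expr2 ltr_pM //; [case/andP: hx|case/andP: hz].
have p1 : `|p| < 1 by case/andP: p01.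
have pp : 0 < `|p| by case/andP: p01.
(* From [|p| < |x * z| < 1], both [x * z] and [p * (x * z)] have modulus strictly between [|p ^+ 2|]
   and [1]. *)
have A0 : theta (p ^+ 2) (- (x * z)) != 0.
  apply: (theta_annulus P01); rewrite normrN hxz andbT; apply: lt_trans hqxz.
  by rewrite (normrX 2 p) expr2 gtr_pMr.
have A1 : theta (p ^+ 2) (- (p * (x * z))) != 0.
  apply: (theta_annulus P01); rewrite normrN (normrX 2 p) (normrM p) [X in X < _]expr2 ltr_pM2l // hqxz /=.
  by rewrite mulr_ilt1.
move: h1 h2; set a := theta (p ^+ 2) _ in A0 *; set b := theta (p ^+ 2) _ in A1 * => h1 h2.
(* The sum and the difference of the values at [1] and [-1] isolate the even and the odd part. *)
have /eqP K00 : 2 * (K0 * a) = 0 by rewrite -[RHS](addr0 0) -{1}h1 -h2; ring.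
have /eqP K10 : 2 * (K1 * b) = 0 by rewrite -[RHS](subr0 0) -{1}h1 -h2; ring.
move: K00 K10; rewrite !mulf_eq0 pnatr_eq0 /= (negbTE A0) (negbTE A1) !orbF => /eqP k0 /eqP k1.
have gy := generic_annulus hy; have := hK y y0.
rewrite k0 k1 !mul0r addr0 (clearedE gy) => /eqP; rewrite mulf_eq0.
case: (gy) => _ ty tny tqy _; rewrite (negbTE (mulf_neq0 (mulf_neq0 ty tny) tqy)) /= => /eqP h.
by apply/eqP; rewrite -subr_eq0 -h; apply/eqP; rewrite /defect; ring.
Qed.

End Identity.

(** * From the double series back to the triple series *)

Section Fibers.

Lemma sg_eq (r s : int) : (sg r == sg s) = ((0 <= r) == (0 <= s)).
Proof. by rewrite /sg; case: (0 <= r); case: (0 <= s). Qed.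

Lemma neg_exponent (r s t : int) : r < 0 -> s < 0 -> t < 0 ->
  0 <= r * s + r * t + s * t + (r + s + t).
Proof.
move=> r0 s0 t0.
have h1 : 0 <= - r * (- s - 1) by apply: mulr_ge0; lia.
have h2 : 0 <= - s * (- t - 1) by apply: mulr_ge0; lia.
have h3 : 0 <= - t * (- r - 1) by apply: mulr_ge0; lia.
have -> : r * s + r * t + s * t + (r + s + t) =
  - r * (- s - 1) + - s * (- t - 1) + - t * (- r - 1) by ring.
by rewrite !addr_ge0.
Qed.

Lemma neg_add_le (r s : int) : r < 0 -> s < 0 -> r + s <= - 2.
Proof. lia. Qed.

Lemma odd_half (r s : int) : (r == s %[mod 2])%Z = false -> exists k, r + s = 2 * k + 1.
Proof.
move=> h; case: (divz2_cases (r + s)) => e; last by exists ((r + s) %/ 2)%Z.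
have := divz2_cases r; have := divz2_cases s; move/eqP: h.
have := divz_eq r 2; have := divz_eq s 2; lia.
Qed.

End Fibers.

Section TripleSeries.
Variable C : sum_field.
Variables q x y z : C.
Hypothesis q01 : 0 < `|q| < 1.
Hypothesis hx : `|q| < `|x| < 1.
Hypothesis hy : `|q| < `|y| < 1.
Hypothesis hz : `|q| < `|z| < 1.

Let qq : 0 < `|q|. Proof. by case/andP: q01. Qed.
Let q0 : q != 0. Proof. by rewrite -normr_gt0; case/andP: q01. Qed.
Let x0 : x != 0. Proof. exact (annulus_neq0 q01 hx). Qed.
Let y0 : y != 0. Proof. exact (annulus_neq0 q01 hy). Qed.
Let z0 : z != 0. Proof. exact (annulus_neq0 q01 hz). Qed.

Definition triple (k : int * int * int) : C :=
  let: (r, s, t) := k in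
  if triple_index r s t then q ^ (r * s + r * t + s * t) * x ^ r * y ^ s * z ^ t else 0.

(** In the negative octant the monomial exceeds the weights by [|q| ^ (r + s + t)], which the
    quadratic exponent compensates by [neg_exponent]. *)
Lemma triple_bounded : abs_bounded triple.
Proof.
have hb := abs_bounded_mul (abs_bounded_mul (weight_bounded q01 hx) (weight_bounded q01 hy)) (weight_bounded q01 hz).
apply: abs_bounded_le hb => -[[r s] t]; rewrite /triple /=.
have w0 a n := weight_ge0 q a n.
rewrite [leRHS]ger0_norm ?mulr_ge0 ?w0 //.
case: ifP => [/and4P[]|_]; last by rewrite normr0 !mulr_ge0 ?w0.
rewrite !sg_eq => /eqP rs /eqP st _ _; rewrite 3!normrM.
rewrite (normr_weight q01 _ x0) (normr_weight q01 _ y0) (normr_weight q01 _ z0) -st -rs.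
have hq n : 0 <= n -> `|q| ^ n <= 1.
  by move=> n0; rewrite -[leRHS](expr0z `|q|); apply: (expz_anti q01).
case: ifP => r0.
  rewrite !mulr1 -!mulrA ler_piMl ?mulr_ge0 ?w0 // normr_expz; apply: hq.
  by rewrite !addr_ge0 // mulr_ge0 -?st -?rs.
have {}rs : s < 0 by rewrite ltNge -rs r0.
have {}st : t < 0 by rewrite ltNge -st leNgt rs.
have {}r0 : r < 0 by rewrite ltNge r0.
set a := weight q x r; set b := weight q y s; set c := weight q z t.
have -> : `|q ^ (r * s + r * t + s * t)| * (a * `|q| ^ r) * (b * `|q| ^ s) * (c * `|q| ^ t)
  = `|q| ^ (r * s + r * t + s * t + (r + s + t)) * (a * b * c).
  rewrite normr_expz (expfzDr (_ + s * t)) ?gt_eqF // (expfzDr (r + s)) ?gt_eqF // (expfzDr r) ?gt_eqF //.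
  by ring.
rewrite ler_piMl ?mulr_ge0 ?w0 //; apply: hq; exact: neg_exponent.
Qed.

Lemma sgn_parity (r s : int) : (-1 : C) ^ (r + s) = if same_parity r s then 1 else -1.
Proof.
case: ifP => h; first by rewrite (modz2_half (eqP h)) sgn_even.
by have [k ->] := odd_half h; rewrite expfzDr ?oppr_eq0 ?oner_eq0 // sgn_even expr1z mul1r.
Qed.

(** The half-line prescribed for [t] is the one where the geometric series in [w = q ^ (r + s) * z]
    converges; averaging the series at [w] and [- w] selects the parity. *)
Lemma triple_fiber (k : int * int) : has_sum (fun t => triple (k, t))
  (pair_coef q x y k * parity_pole k.1 (q ^ (k.1 + k.2) * z)).
Proof.
case: k => r s; rewrite /triple /pair_coef /triple_index /= !sg_eq.
have Z (f : int -> C) : (forall t, f t = 0) -> has_sum f 0.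
  by move=> f0; apply: eq_has_sum (@has_sum0 C int) => t; rewrite f0.
case sp: (same_parity r s); last first.
  by rewrite mul0r; apply: Z => t; rewrite -/(same_parity r s) sp andFb !andbF.
have [rs|rs] := eqVneq (0 <= r) (0 <= s); last first.
  rewrite (_ : sgn2 C r s = 0); last first.
    rewrite /sgn2 !ltNge; move: rs; by case: (0 <= r); case: (0 <= s).
  by rewrite !mul0r; apply: Z => t; rewrite andFb.
set w := q ^ (r + s) * z.
(* Two negative exponents sum to at most [-2], and [|q| ^+ 2 < |z|]. *)
have hw : if 0 <= r then `|w| < 1 else 1 < `|w|.
  case/andP: hz => z1 z2; rewrite /w normrM normr_expz; case: ifP => r0.
    apply: le_lt_trans z2; rewrite ler_piMl // -[leRHS](expr0z `|q|); apply: (expz_anti q01).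
    by rewrite addr_ge0 // -rs.
  have h : r + s <= - 2 by apply: neg_add_le; rewrite ltNge -?rs r0.
  apply: lt_le_trans (_ : `|q| ^ (-2) * `|z| <= _); last first.
    by rewrite ler_wpM2r // (expz_anti q01).
  rewrite -exprnN mulrC ltr_pdivlMr ?exprn_gt0 // mul1r; apply: lt_trans z1.
  by rewrite expr2 gtr_pMr //; case/andP: q01.
have hw' : if 0 <= r then `|- w| < 1 else 1 < `|- w| by rewrite normrN.
have h := has_sumZ (monom q x y r s / 2) (has_sumD (geometric_int hw) (has_sumZ ((-1) ^ r) (geometric_int hw'))).
have sE : sgn2 C r s = if 0 <= r then 1 else -1.
  by rewrite /sgn2 !ltNge -rs; case: (0 <= r).
rewrite sE (_ : _ * parity_pole r w = monom q x y r s / 2 *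
   ((if 0 <= r then 1 else -1) / (1 - w) + (-1) ^ r * ((if 0 <= r then 1 else -1) / (1 - - w)))); last first.
  rewrite opprK /parity_pole; move: (1 - w)^-1 (1 + w)^-1 => A B.
  by case: (0 <= r); ring.
apply: eq_has_sum h => t; rewrite /= sg_eq rs [(0 <= s) == (0 <= t)]eq_sym.
case: ((0 <= t) == (0 <= s)); last by rewrite !mulr0 addr0 mulr0.
rewrite -/(same_parity r s) sp -/(same_parity s t) /=.
have -> : same_parity s t = same_parity r t by move/eqP: sp; rewrite /same_parity => ->.
rewrite -(mulN1r w) (expfzMl (-1)) mulrA -expfzDr ?oppr_eq0 ?oner_eq0 // sgn_parity.
case: ifP => _; last by rewrite mulN1r subrr mulr0.
rewrite mul1r /monom /w (expfzMl (q ^ (r + s))) exprz_exp.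
rewrite (_ : r * s + r * t + s * t = r * s + (r + s) * t); last by ring.
by rewrite (expfzDr (r * s) _ q0); field.
Qed.

Lemma triple_has_sum : has_sum triple (pair_sum q x y z).
Proof.
have hz2 := generic_annulus q01 hx hy hz; case: hz2 => _ tz tnz _ _.
have h := csumP triple_bounded.
have := has_sum_fubini h triple_fiber => /has_sum_unique h2.
by rewrite -(h2 _ (proj1 (pair_sumP q01 hx hy z0 tz tnz))).
Qed.

(** The special functions are abstract and known only through three equations, so the algebra never
    meets their definitions as limits. *)
Lemma triple_identity (J : nat -> C) (jt : C -> C -> C) (ap : C -> C -> C -> C) :
  (forall m, (0 < m)%N -> J m = poch (q ^+ m) (q ^+ m)) ->
  (forall a b, 0 < `|b| < 1 -> jt a b = jprod b a) ->
  (forall a b c S, has_sum (fun r : int =>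
     (-1) ^ r * b ^ binz2 r * c ^ r / (1 - b ^ (r - 1) * a * c)) S -> ap a b c = (jt c b)^-1 * S) ->
  pair_sum q x y z =
    J 4%N ^+ 3 * jt (y ^+ 2 * z ^+ 2) (q ^+ 4)
      / (jt (y ^+ 2) (q ^+ 4) * jt (z ^+ 2) (q ^+ 4))
      * ap (- (q * x / (y * z))) (q ^+ 2) (- (y * z))
    + J 4%N ^+ 3 * jt (x ^+ 2 * z ^+ 2) (q ^+ 4)
      / (jt (x ^+ 2) (q ^+ 4) * jt (z ^+ 2) (q ^+ 4))
      * ap (- (q * y / (x * z))) (q ^+ 2) (- (x * z))
    + J 4%N ^+ 3 * jt (x ^+ 2 * y ^+ 2) (q ^+ 4)
      / (jt (x ^+ 2) (q ^+ 4) * jt (y ^+ 2) (q ^+ 4))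
      * ap (- (q * z / (x * y))) (q ^+ 2) (- (x * y))
    + J 1%N ^+ 3 * J 2%N ^+ 3
      / (jt x q * jt y q * jt z q)
      * (jt (x * y) (q ^+ 2) * jt (x * z) (q ^+ 2)
           * jt (y * z) (q ^+ 2)
         / (jt (- x) (q ^+ 2) * jt (- y) (q ^+ 2)
              * jt (- z) (q ^+ 2))).
Proof.
move=> hJ hj hap; have p01 := sqr01 q01; have P01 := sqr01 p01.
have q4 : q ^+ 4 = (q ^+ 2) ^+ 2 by rewrite -exprM.
have jtE a b : 0 < `|b| < 1 -> a != 0 -> jt a b = theta b a.
  by move=> hb a0; rewrite hj // -thetaE.
have apE u v w : u != 0 -> v != 0 -> w != 0 -> theta (q ^+ 2) (q * u) != 0 ->
    ap (- (q * u / (v * w))) (q ^+ 2) (- (v * w)) =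
    appell_sum (q ^+ 2) (v * w) (q * u) / theta (q ^+ 2) (- (v * w)).
  move=> u0 v0 w0 tu; have vw : v * w != 0 by rewrite mulf_neq0.
  have qu : q * u != 0 by rewrite mulf_neq0.
  rewrite (hap _ _ _ (appell_sum (q ^+ 2) (v * w) (q * u))) ?jtE ?oppr_eq0 //; first by rewrite mulrC.
  apply: eq_has_sum (appell_sum_has p01 vw qu tu) => r.
  have -> : (q ^+ 2) ^ (r - 1) * - (q * u / (v * w)) * - (v * w) = (q ^+ 2) ^ (r - 1) * (q * u).
    by field; rewrite v0 w0.
  (* The sign [(-1) ^ r] of the Appell-Lerch series cancels against the one in [(- (v * w)) ^ r]. *)
  rewrite -(mulN1r (v * w)) (expfzMl (-1)); congr (_ / _); set s := (-1) ^ r.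
  have ss : s * s = 1 by rewrite /s -expfzMl mulrN1 opprK exp1rz.
  by transitivity (s * s * ((q ^+ 2) ^ binz2 r * (v * w) ^ r)); [rewrite ss mul1r|ring].
have tqx := theta_shift_neq0 q01 hx; have tqy := theta_shift_neq0 q01 hy.
have tqz := theta_shift_neq0 q01 hz.
rewrite !apE // q4 !(jtE _ _ P01) ?mulf_neq0 ?expf_neq0 //.
rewrite !(jtE _ _ q01) // !(jtE _ _ p01) ?oppr_eq0 ?mulf_neq0 //.
(* Here [z] is the variable carrying the poles, and [x], [y] are the outer ones; the identity is
   symmetric. *)
rewrite !hJ // expr1 q4 (pair_sumE q01 hx hy hz) /appell_term /theta_quot.
rewrite /kron [z * y]mulrC [z ^+ 2 * _]mulrC !invfM; ring.
Qed.

End TripleSeries.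

(** * Limits and sums in R[i] *)

Section ComplexSeries.
Variable R : realType.
Local Notation K := (complex_sum_field R).

Lemma qpochE (x q : R[i]) : 0 < `|q| < 1 -> qpoch x q = @poch K q x.
Proof.
move=> q01; rewrite /qpoch.
have h : (fun n : nat => \prod_(0 <= k < n) (1 - q ^+ k * x) : R[i]^o) @ \oo --> (@poch K q x : R[i]^o).
  apply/cvgrPdist_lt => e e0; have [N hN] := @poch_conv K q q01 x e e0.
  by exists N => // n /= /hN.
by apply: cvg_lim h; apply: norm_hausdorff.
Qed.

Lemma JetaE (q : R[i]) m : 0 < `|q| < 1 -> (0 < m)%N -> Jeta q m = @poch K (q ^+ m) (q ^+ m).
Proof.
move=> /andP[q0 q1] m0.
have qm : 0 < `|q ^+ m| < 1 by rewrite normrX exprn_gt0 //= exprn_ilt1 // -lt0n.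
rewrite -(qpochE _ qm) /Jeta /qpoch.
have -> : (fun n : nat => \prod_(1 <= k < n.+1) (1 - q ^+ (m * k))) =
          (fun n => \prod_(0 <= k < n) (1 - (q ^+ m) ^+ k * q ^+ m)).
  apply/funext => n; rewrite big_add1 /=; apply: eq_bigr => k _.
  by rewrite -exprM -exprD mulnS addnC.
by [].
Qed.

Lemma jthetaE (x q : R[i]) : 0 < `|q| < 1 -> jtheta x q = @jprod K q x.
Proof. by move=> q01; rewrite /jtheta !qpochE. Qed.

End ComplexSeries.


Theorem theorem1p3 (R : realType) (q x y z : R[i])
    (hq : 0 < `|q| < 1)
    (x0 : x != 0) (y0 : y != 0) (z0 : z != 0)
    (hx : `|q| < `|x| < 1) (hy : `|q| < `|y| < 1) (hz : `|q| < `|z| < 1) :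
  cvg (partial_sum (triple_term q x y z) @ totally) /\
  sum (triple_term q x y z) =
    Jeta q 4 ^+ 3 * jtheta (y ^+ 2 * z ^+ 2) (q ^+ 4)
      / (jtheta (y ^+ 2) (q ^+ 4) * jtheta (z ^+ 2) (q ^+ 4))
      * appell (- (q * x / (y * z))) (q ^+ 2) (- (y * z))
    + Jeta q 4 ^+ 3 * jtheta (x ^+ 2 * z ^+ 2) (q ^+ 4)
      / (jtheta (x ^+ 2) (q ^+ 4) * jtheta (z ^+ 2) (q ^+ 4))
      * appell (- (q * y / (x * z))) (q ^+ 2) (- (x * z))
    + Jeta q 4 ^+ 3 * jtheta (x ^+ 2 * y ^+ 2) (q ^+ 4)
      / (jtheta (x ^+ 2) (q ^+ 4) * jtheta (y ^+ 2) (q ^+ 4))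
      * appell (- (q * z / (x * y))) (q ^+ 2) (- (x * y))
    + Jeta q 1 ^+ 3 * Jeta q 2 ^+ 3
      / (jtheta x q * jtheta y q * jtheta z q)
      * (jtheta (x * y) (q ^+ 2) * jtheta (x * z) (q ^+ 2)
           * jtheta (y * z) (q ^+ 2)
         / (jtheta (- x) (q ^+ 2) * jtheta (- y) (q ^+ 2)
              * jtheta (- z) (q ^+ 2))).
Proof.
have hs := @triple_has_sum (complex_sum_field R) q x y z hq hx hy hz.
(* [triple_term] is convertible to [triple] over [complex_sum_field R], so [hs] applies to it
   directly. *)
split; first by apply/cvg_ex; eexists; exact: (has_sum_partial hs).
rewrite (has_sum_sumE hs).
apply: (@triple_identity (complex_sum_field R) q x y z hq hx hy hz (Jeta q) (@jtheta R) (@appell R)).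
- by move=> m m0; apply: JetaE.
- by move=> a b hb; apply: jthetaE.
by move=> a b c S hS; rewrite /appell (has_sum_sumE hS).
Qed.
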